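(* Let $u$ be the solution of problem (P) and assume moreover $u\in C^{4,\gamma}(\bar\Omega)$. Let $\varepsilon_0\in(0,1]$ be fixed and $\varepsilon\in[\varepsilon_0,1]$. For each of the three choices (S1), (S2), (S3), let $U$ be the mesh function with $U_{i,j}=0$ at boundary nodes and $L^NU_{i,j}=F_{i,j}$ at all interior nodes, and let $U_I$ be its piecewise bilinear interpolant. Then, for all $N$ sufficiently large (depending on $\varepsilon_0$), $$\max_{i,j}|U_{i,j}-u(x_i,y_j)|\le CN^{-2}\quad\text{and}\quad\|U_I-u\|_{L_\infty(\Omega)}\le CN^{-2},$$ where $C$ may depend on $\varepsilon_0$ and the data but not on $N$.
   Context: Problem (P). Let $\varepsilon\in(0,1]$, $\Omega=(0,1)^2$, and $Lu:=-\varepsilon\Delta u+a_1u_x+a_2u_y+bu=f$ in $\Omega$, $u=0$ on $\partial\Omega$, where $a_1>\alpha_1>0$, $a_2>\alpha_2>0$, $b\ge 0$ on $\bar\Omega$ ($\alpha_1,\alpha_2$ constants), $a_1,a_2,b,f\in C^{5,\gamma}(\bar\Omega)$, $f$ vanishes at the four corners of $\Omega$, and $\partial^{i+j}f/\partial x^i\partial y^j(0,0)=0$ for $0\le i+j\le4$. Mesh. Let $N\ge 4$ be even, $\tau_x=\min\{1/2,\,2\varepsilon\ln N/\alpha_1\}$, $\tau_y=\min\{1/2,\,2\varepsilon\ln N/\alpha_2\}$. The nodes $0=x_0<\dots<x_N=1$ are piecewise uniform with $N/2$ equal subintervals in $[0,1-\tau_x]$ and $N/2$ equal subintervals in $[1-\tau_x,1]$;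 the nodes $y_j$ are analogous with $\tau_y$. Put $h_i=x_i-x_{i-1}$, $k_j=y_j-y_{j-1}$, $\bar h_i=(h_i+h_{i+1})/2$, $\bar k_j=(k_j+k_{j+1})/2$. Scheme. Let $\sigma(t)=t/(1-e^{-t})$. Set $\bar a_{1:i,j}=\tfrac12(a_1(x_{i-1},y_j)+a_1(x_i,y_j))$, $\rho_{1:i,j}=\bar a_{1:i,j}h_i/\varepsilon$, $\bar a_{2:i,j}=\tfrac12(a_2(x_i,y_{j-1})+a_2(x_i,y_j))$, $\rho_{2:i,j}=\bar a_{2:i,j}k_j/\varepsilon$. At an interior node $(x_i,y_j)$ the weights are one of: (S1) $Q^-_x=h_i\frac{\sigma(\rho_{1:i,j})-1}{\rho_{1:i,j}}$, $Q^+_x=h_{i+1}\frac{1-\sigma(-\rho_{1:i+1,j})}{\rho_{1:i+1,j}}$, $Q^-_y=k_j\frac{\sigma(\rho_{2:i,j})-1}{\rho_{2:i,j}}$, $Q^+_y=k_{j+1}\frac{1-\sigma(-\rho_{2:i,j+1})}{\rho_{2:i,j+1}}$; (S2) $Q^-_x=h_i\frac{1-\sigma(-\rho_{1:i,j})}{\rho_{1:i,j}}$, $Q^+_x=h_{i+1}\frac{\sigma(\rho_{1:i+1,j})-1}{\rho_{1:i+1,j}}$, and analogously in $y$; (S3) $Q^-_x=h_i/2$, $Q^+_x=h_{i+1}/2$, $Q^-_y=k_j/2$, $Q^+_y=k_{j+1}/2$. Put $Q^C_x=Q^-_x+Q^+_x$, $Q^C_y=Q^-_y+Q^+_y$. For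 a mesh function $Z$ and interior node $(x_i,y_j)$ define $L^N_xZ_{i,j}=\frac{\varepsilon}{\bar h_i}\Bigl[\sigma(\rho_{1:i,j})\frac{Z_{i,j}-Z_{i-1,j}}{h_i}-\sigma(-\rho_{1:i+1,j})\frac{Z_{i+1,j}-Z_{i,j}}{h_{i+1}}\Bigr]$, $L^N_yZ_{i,j}=\frac{\varepsilon}{\bar k_j}\Bigl[\sigma(\rho_{2:i,j})\frac{Z_{i,j}-Z_{i,j-1}}{k_j}-\sigma(-\rho_{2:i,j+1})\frac{Z_{i,j+1}-Z_{i,j}}{k_{j+1}}\Bigr]$, $L^NZ_{i,j}=\frac{Q^C_y}{\bar k_j}L^N_xZ_{i,j}+\frac{Q^C_x}{\bar h_i}L^N_yZ_{i,j}+b(x_i,y_j)\frac{Q^C_xQ^C_y}{\bar h_i\bar k_j}Z_{i,j}$. With $q_x(i-1)=Q^-_x$, $q_x(i)=Q^C_x$, $q_x(i+1)=Q^+_x$ and similarly $q_y$, define $F_{i,j}=\frac{1}{4\bar h_i\bar k_j}\sum_{n=i-1}^{i+1}\sum_{m=j-1}^{j+1}q_x(n)q_y(m)f(x_n,y_m)$. The piecewise bilinear interpolant of a mesh function $Z$ is $Z_I(x,y)=\sum_{i,j=0}^NZ_{i,j}p_i(x)p^j(y)$, where $p_i,p^j$ are the standard hat functions on the mesh centred at $x_i$, $y_j$. *)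

(* Defs.v *)
From Stdlib Require Import Reals Lra Lia.
From Coquelicot Require Import Coquelicot.
Open Scope R_scope.

Definition in_closed (x y : R) : Prop := 0 <= x <= 1 /\ 0 <= y <= 1.
Definition in_open (x y : R) : Prop := 0 < x < 1 /\ 0 < y < 1.
Definition on_boundary (x y : R) : Prop :=
  in_closed x y /\ (x = 0 \/ x = 1 \/ y = 0 \/ y = 1).

(* ---------- Hoelder spaces C^{k,gamma}(closed square) ----------
   D i j is the partial derivative d^{i+j} / dx^i dy^j (a family of functions).
   - in the open square, D (i+1) j (resp. D i (j+1)) is the partial derivative
     in x (resp. y) of D i j, for i + j < k;
   - every D i j (i + j <= k) is continuous on the closed square
     (i.e. extends continuously to the closure);
   - the derivatives of order exactly k are uniformly Hoelder with exponent gamma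
     on the closed square. *)
Definition holder_family (k : nat) (gamma : R) (D : nat -> nat -> R -> R -> R) : Prop :=
  (forall i j : nat, (i + j < k)%nat -> forall x y, in_open x y ->
       is_derive (fun t => D i j t y) x (D (S i) j x y) /\
       is_derive (fun t => D i j x t) y (D i (S j) x y)) /\
  (forall i j : nat, (i + j <= k)%nat -> forall x y, in_closed x y ->
       forall e, 0 < e -> exists d, 0 < d /\
         forall x' y', in_closed x' y' -> Rabs (x' - x) < d -> Rabs (y' - y) < d ->
           Rabs (D i j x' y' - D i j x y) < e) /\
  (exists H : R, forall i j : nat, (i + j = k)%nat ->
       forall x y x' y', in_closed x y -> in_closed x' y' ->
         Rabs (D i j x y - D i j x' y') <=
           H * Rpower (sqrt ((x - x') ^ 2 + (y - y') ^ 2)) gamma).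

Definition Ckg_with (k : nat) (gamma : R) (g : R -> R -> R) (D : nat -> nat -> R -> R -> R) : Prop :=
  holder_family k gamma D /\ (forall x y, in_closed x y -> D 0%nat 0%nat x y = g x y).

Definition Ckg (k : nat) (gamma : R) (g : R -> R -> R) : Prop :=
  exists D, Ckg_with k gamma g D.

Definition sigma (t : R) : R := t / (1 - exp (- t)).

Definition tau (eps alpha : R) (N : nat) : R :=
  Rmin (1 / 2) (2 * eps * ln (INR N) / alpha).

(* piecewise uniform Shishkin nodes, N even: N/2 intervals on [0,1-tau],
   N/2 intervals on [1-tau,1] *)
Definition node (N : nat) (t : R) (i : nat) : R :=
  if (i <=? N / 2)%nat then INR i * ((1 - t) / (INR N / 2))
  else (1 - t) + INR (i - N / 2) * (t / (INR N / 2)).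

Inductive scheme : Type := S1 | S2 | S3.

Definition Qminus (s : scheme) (h rho : R) : R :=
  match s with
  | S1 => h * (sigma rho - 1) / rho
  | S2 => h * (1 - sigma (- rho)) / rho
  | S3 => h / 2
  end.

Definition Qplus (s : scheme) (h rho : R) : R :=
  match s with
  | S1 => h * (1 - sigma (- rho)) / rho
  | S2 => h * (sigma rho - 1) / rho
  | S3 => h / 2
  end.

Section Scheme.
Variables (eps : R) (a1 a2 b f : R -> R -> R) (xs ys : nat -> R) (s : scheme).

Definition hx (i : nat) : R := xs i - xs (i - 1).
Definition ky (j : nat) : R := ys j - ys (j - 1).
Definition hbar (i : nat) : R := (hx i + hx (i + 1)) / 2.
Definition kbar (j : nat) : R := (ky j + ky (j + 1)) / 2.

Definition rho1 (i j : nat) : R :=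
  ((a1 (xs (i - 1)) (ys j) + a1 (xs i) (ys j)) / 2) * hx i / eps.
Definition rho2 (i j : nat) : R :=
  ((a2 (xs i) (ys (j - 1)) + a2 (xs i) (ys j)) / 2) * ky j / eps.

Definition Qmx (i j : nat) : R := Qminus s (hx i) (rho1 i j).
Definition Qpx (i j : nat) : R := Qplus s (hx (i + 1)) (rho1 (i + 1) j).
Definition Qmy (i j : nat) : R := Qminus s (ky j) (rho2 i j).
Definition Qpy (i j : nat) : R := Qplus s (ky (j + 1)) (rho2 i (j + 1)).
Definition QCx (i j : nat) : R := Qmx i j + Qpx i j.
Definition QCy (i j : nat) : R := Qmy i j + Qpy i j.

Definition LNx (Z : nat -> nat -> R) (i j : nat) : R :=
  eps / hbar i *
  (sigma (rho1 i j) * (Z i j - Z (i - 1)%nat j) / hx i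
   - sigma (- rho1 (i + 1) j) * (Z (i + 1)%nat j - Z i j) / hx (i + 1)).

Definition LNy (Z : nat -> nat -> R) (i j : nat) : R :=
  eps / kbar j *
  (sigma (rho2 i j) * (Z i j - Z i (j - 1)%nat) / ky j
   - sigma (- rho2 i (j + 1)) * (Z i (j + 1)%nat - Z i j) / ky (j + 1)).

Definition LN (Z : nat -> nat -> R) (i j : nat) : R :=
  QCy i j / kbar j * LNx Z i j + QCx i j / hbar i * LNy Z i j
  + b (xs i) (ys j) * (QCx i j * QCy i j) / (hbar i * kbar j) * Z i j.

(* q_x(i-1+d) for d = 0,1,2 : Q^-_x, Q^C_x, Q^+_x  (and similarly q_y) *)
Definition qx (i j d : nat) : R :=
  match d with 0%nat => Qmx i j | 1%nat => QCx i j | _ => Qpx i j end.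
Definition qy (i j e : nat) : R :=
  match e with 0%nat => Qmy i j | 1%nat => QCy i j | _ => Qpy i j end.

Definition sum3 (g : nat -> R) : R := g 0%nat + g 1%nat + g 2%nat.

Definition Frhs (i j : nat) : R :=
  / (4 * hbar i * kbar j) *
  sum3 (fun d => sum3 (fun e =>
     qx i j d * qy i j e * f (xs (i + d - 1)%nat) (ys (j + e - 1)%nat))).

End Scheme.

Definition hat (xs : nat -> R) (N i : nat) (x : R) : R :=
  if ((0 <? i)%nat && (if Rle_dec (xs (i - 1)%nat) x then true else false)
      && (if Rle_dec x (xs i) then true else false))%bool
  then (x - xs (i - 1)%nat) / (xs i - xs (i - 1)%nat)
  else if ((i <? N)%nat && (if Rle_dec (xs i) x then true else false)
      && (if Rle_dec x (xs (i + 1)%nat) then true else false))%bool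
  then (xs (i + 1)%nat - x) / (xs (i + 1)%nat - xs i)
  else 0.

Definition bilin_interp (xs ys : nat -> R) (N : nat) (Z : nat -> nat -> R) (x y : R) : R :=
  sum_f_R0 (fun i => sum_f_R0 (fun j => Z i j * hat xs N i x * hat ys N j y) N) N.

(* Main.v *)
(* For eps >= eps0 and N large both transition points equal 1/2: the mesh is uniform with h = 1/N, and the
   scheme is a second-order perturbation of central differences. The constant may depend neither on u nor on
   eps, so u has to be bounded a priori. On the square, the integral of w_xx w_yy - w_xy^2 reduces to boundary
   terms; for w = u, u_x, u_y, u_xy these are controlled through the equation and the zero boundary values, which
   bounds the third derivatives and u_xxyy in L2, and the second derivatives uniformly. Averaging the equation
   against the bilinear hat function of a node produces the second differences of u exactly in one variable, so
   that the truncation error is O(h^2) in the discrete L2 norm with only these derivatives. To pass to the maximum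
   norm, one solves (L^N + lambda) z = T approximately; a discrete H2 energy estimate bounds z, and the
   discrete maximum principle with barrier x bounds the rest, since L^N (e - z) = lambda z up to the residual. *)

(* Taylor expansion combined with the discrete maximum principle would need fourth derivatives of u
   in the maximum norm, bounded by the data alone. The energy identities give them only in L2. Hence
   the truncation error may contain them only through integrals over the patch of a node, and the
   stability estimate must accept a right-hand side measured in the discrete L2 norm. The boundary
   terms of the identities have the same order as the norms to be bounded. They are lowered by the
   equation itself: on an edge x = 0 or x = 1, where u, u_y and u_yy vanish, it reads u_xx = P u_x -
   S and may be differentiated along the edge. A trace inequality with a small weight eta then
   leaves a small multiple of the norm being estimated, which is absorbed; the numerical weights are
   chosen for this absorption only. For w = u_xy the products u_xxy u_xyy at the corners are treated
   in the same way. The shift lambda is chosen from eps0 and the data so large that, in the test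
   with the discrete Laplacian, it dominates all terms of L^N of order below two, whatever their
   sign. *)
Require Import Defs.
From Stdlib Require Import Reals Lra Lia.
From Coquelicot Require Import Coquelicot.
Open Scope R_scope.

(** * Continuity and integrals *)

(* Coquelicot lemmas leave equations at the carrier of a normed module, which [ring] does not recognise as [R]. *)
Ltac eqR := match goal with |- @eq _ ?a ?b => change (@eq R a b) end.

(** Continuity is asked at every real point, so that integrals and their parameters need no side
    conditions. Functions known only on the square are brought to this form by [clamp]. *)
Definition cont1 (g : R -> R) : Prop := forall x, continuity_pt g x.
Definition cont2 (g : R -> R -> R) : Prop := forall x y, continuity_2d_pt g x y.

Lemma cont1_continuous g x : cont1 g -> continuous g x.
Proof. intros H. apply continuity_pt_filterlim, H. Qed.

Lemma cont1_const c : cont1 (fun _ => c).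
Proof. intros x. apply continuity_pt_const. intros u v; reflexivity. Qed.
Lemma cont1_id : cont1 (fun x => x).
Proof. intros x. apply derivable_continuous_pt, derivable_pt_id. Qed.
Lemma cont1_plus f g : cont1 f -> cont1 g -> cont1 (fun x => f x + g x).
Proof. intros Hf Hg x. apply (continuity_pt_plus f g); auto. Qed.
Lemma cont1_minus f g : cont1 f -> cont1 g -> cont1 (fun x => f x - g x).
Proof. intros Hf Hg x. apply (continuity_pt_minus f g); auto. Qed.
Lemma cont1_mult f g : cont1 f -> cont1 g -> cont1 (fun x => f x * g x).
Proof. intros Hf Hg x. apply (continuity_pt_mult f g); auto. Qed.
Lemma cont1_opp f : cont1 f -> cont1 (fun x => - f x).
Proof. intros Hf x. apply (continuity_pt_opp f); auto. Qed.
Lemma cont1_comp f g : cont1 f -> cont1 g -> cont1 (fun x => f (g x)).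
Proof. intros Hf Hg x. apply (continuity_pt_comp g f); auto. Qed.
Lemma cont1_abs f : cont1 f -> cont1 (fun x => Rabs (f x)).
Proof. intros Hf x. apply (continuity_pt_comp f Rabs); auto. apply Rcontinuity_abs. Qed.
Lemma cont1_div f c : cont1 f -> cont1 (fun x => f x / c).
Proof. intros Hf. unfold Rdiv. apply cont1_mult; auto using cont1_const. Qed.
Lemma cont1_pow f n : cont1 f -> cont1 (fun x => f x ^ n).
Proof.
  intros Hf. induction n as [|n IH]; simpl; [apply cont1_const|].
  now apply cont1_mult.
Qed.
Lemma cont1_ext f g : (forall x, f x = g x) -> cont1 f -> cont1 g.
Proof. intros E Hf x. apply (continuity_pt_ext f); auto. Qed.

Lemma cont2_const c : cont2 (fun _ _ => c).
Proof. intros x y; apply continuity_2d_pt_const. Qed.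
Lemma cont2_plus f g : cont2 f -> cont2 g -> cont2 (fun x y => f x y + g x y).
Proof. intros Hf Hg x y. apply continuity_2d_pt_plus; auto. Qed.
Lemma cont2_minus f g : cont2 f -> cont2 g -> cont2 (fun x y => f x y - g x y).
Proof. intros Hf Hg x y. apply continuity_2d_pt_minus; auto. Qed.
Lemma cont2_mult f g : cont2 f -> cont2 g -> cont2 (fun x y => f x y * g x y).
Proof. intros Hf Hg x y. apply continuity_2d_pt_mult; auto. Qed.
Lemma cont2_opp f : cont2 f -> cont2 (fun x y => - f x y).
Proof. intros Hf x y. apply continuity_2d_pt_opp; auto. Qed.
Lemma cont2_div f c : cont2 f -> cont2 (fun x y => f x y / c).
Proof. intros Hf. unfold Rdiv. apply cont2_mult; auto using cont2_const. Qed.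
Lemma cont2_pow f n : cont2 f -> cont2 (fun x y => f x y ^ n).
Proof.
  intros Hf. induction n as [|n IH]; simpl; [apply cont2_const|].
  now apply cont2_mult.
Qed.
Lemma cont2_comp1 f g : cont1 f -> cont2 g -> cont2 (fun x y => f (g x y)).
Proof. intros Hf Hg x y. apply continuity_1d_2d_pt_comp; auto. Qed.
Lemma cont2_abs g : cont2 g -> cont2 (fun x y => Rabs (g x y)).
Proof. intros Hg. apply (cont2_comp1 Rabs g); auto. intros x; apply Rcontinuity_abs. Qed.
Lemma cont2_fst f : cont1 f -> cont2 (fun x _ => f x).
Proof. intros Hf. apply (cont2_comp1 f (fun x _ => x)); auto. intros x y; apply continuity_2d_pt_id1. Qed.
Lemma cont2_snd f : cont1 f -> cont2 (fun _ y => f y).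
Proof. intros Hf. apply (cont2_comp1 f (fun _ y => y)); auto. intros x y; apply continuity_2d_pt_id2. Qed.
Lemma cont2_ext f g : (forall x y, f x y = g x y) -> cont2 f -> cont2 g.
Proof. intros E Hf x y. apply (continuity_2d_pt_ext f); auto. Qed.

Lemma cont2_comp g p q : cont2 g -> cont2 p -> cont2 q ->
  cont2 (fun x y => g (p x y) (q x y)).
Proof.
  intros Hg Hp Hq x y e.
  destruct (Hg (p x y) (q x y) e) as [d Hd].
  destruct (Hp x y d) as [d1 H1]. destruct (Hq x y d) as [d2 H2].
  assert (Hm : 0 < Rmin d1 d2) by (apply Rmin_pos; apply cond_pos).
  exists (mkposreal _ Hm). simpl. intros u v Hu Hv.
  apply Hd; [apply H1 | apply H2];
    (eapply Rlt_le_trans; [eassumption|]); auto using Rmin_l, Rmin_r.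
Qed.

Lemma cont2_swap g : cont2 g -> cont2 (fun x y => g y x).
Proof.
  intros Hg. apply (cont2_comp g (fun _ y => y) (fun x _ => x)); auto.
  apply (cont2_snd (fun t => t)), cont1_id. apply (cont2_fst (fun t => t)), cont1_id.
Qed.

Lemma cont2_cont1 g : cont2 (fun x _ => g x) -> cont1 g.
Proof.
  intros H x e He. destruct (H x 0 (mkposreal e He)) as [d Hd].
  exists d. split; [apply cond_pos|]. intros u [_ Hu].
  simpl in *. unfold R_dist in *. apply (Hd u 0); auto.
  rewrite Rminus_diag, Rabs_R0. apply cond_pos.
Qed.

Lemma cont1_comp2 g p q : cont2 g -> cont1 p -> cont1 q -> cont1 (fun t => g (p t) (q t)).
Proof.
  intros Hg Hp Hq. apply cont2_cont1. apply cont2_comp; auto; now apply cont2_fst.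
Qed.
Lemma cont1_x g y : cont2 g -> cont1 (fun t => g t y).
Proof. intros Hg. apply cont1_comp2; auto using cont1_id, cont1_const. Qed.
Lemma cont1_y g x : cont2 g -> cont1 (fun t => g x t).
Proof. intros Hg. apply cont1_comp2; auto using cont1_id, cont1_const. Qed.

Lemma ex_RInt_cont1 g a b : cont1 g -> ex_RInt g a b.
Proof. intros H. apply (@ex_RInt_continuous R_CompleteNormedModule). intros z _. now apply cont1_continuous. Qed.

Lemma RInt_plus1 f g a b : cont1 f -> cont1 g ->
  RInt (fun x => f x + g x) a b = RInt f a b + RInt g a b.
Proof. intros Hf Hg. apply (@RInt_plus R_CompleteNormedModule); now apply ex_RInt_cont1. Qed.
Lemma RInt_minus1 f g a b : cont1 f -> cont1 g ->
  RInt (fun x => f x - g x) a b = RInt f a b - RInt g a b.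
Proof. intros Hf Hg. apply (@RInt_minus R_CompleteNormedModule); now apply ex_RInt_cont1. Qed.
Lemma RInt_scal1 f c a b : cont1 f -> RInt (fun x => c * f x) a b = c * RInt f a b.
Proof. intros Hf. apply (@RInt_scal R_CompleteNormedModule); now apply ex_RInt_cont1. Qed.
Lemma RInt_const1 (c a b : R) : RInt (fun _ => c) a b = (b - a) * c.
Proof. apply (@RInt_const R_CompleteNormedModule). Qed.
Lemma RInt_Chasles1 f a b c : cont1 f -> RInt f a b + RInt f b c = RInt f a c.
Proof. intros Hf. apply (@RInt_Chasles R_CompleteNormedModule); now apply ex_RInt_cont1. Qed.
Lemma RInt_le1 f g a b : a <= b -> cont1 f -> cont1 g ->
  (forall x, a < x < b -> f x <= g x) -> RInt f a b <= RInt g a b.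
Proof. intros H Hf Hg Hle. apply RInt_le; auto using ex_RInt_cont1. Qed.
Lemma RInt_ge01 f a b : a <= b -> cont1 f -> (forall x, a < x < b -> 0 <= f x) -> 0 <= RInt f a b.
Proof.
  intros H Hf H0. replace 0 with ((b - a) * 0) by ring. rewrite <- (RInt_const1 0 a b).
  apply RInt_le1; auto using cont1_const.
Qed.
Lemma RInt_abs_le1 f a b : a <= b -> cont1 f -> Rabs (RInt f a b) <= RInt (fun x => Rabs (f x)) a b.
Proof. intros H Hf. apply abs_RInt_le; auto using ex_RInt_cont1. Qed.

Lemma RInt_unif_close f g a b e : a <= b -> cont1 f -> cont1 g ->
  (forall x, a <= x <= b -> Rabs (f x - g x) <= e) ->
  Rabs (RInt f a b - RInt g a b) <= e * (b - a).
Proof.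
  intros Hab Hf Hg He. rewrite <- RInt_minus1 by auto.
  eapply Rle_trans; [apply RInt_abs_le1; auto; now apply cont1_minus|].
  rewrite (Rmult_comm e), <- (RInt_const1 e a b).
  apply RInt_le1; auto using cont1_const.
  - apply cont1_abs; now apply cont1_minus.
  - intros x Hx; apply He; lra.
Qed.

Lemma cont1_RInt_param g a b : a <= b -> cont2 g -> cont1 (fun x => RInt (fun y => g x y) a b).
Proof.
  intros Hab Hg x e He.
  (* The [+ 1] keeps the denominator positive when [a = b]. *)
  assert (He' : 0 < e / (2 * (b - a + 1))) by (apply Rdiv_lt_0_compat; lra).
  destruct (uniform_continuity_2d_1d' g a b x (fun y _ => Hg x y) (mkposreal _ He')) as [d Hd].
  exists d. split; [apply cond_pos|]. intros u [_ Hu].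
  simpl in *. unfold R_dist in *.
  apply Rabs_lt_between' in Hu.
  eapply Rle_lt_trans.
  - apply (RInt_unif_close _ _ a b (e / (2 * (b - a + 1)))); auto.
    + now apply (cont1_y g).
    + now apply (cont1_y g).
    + pose proof (cond_pos d).
      intros y Hy. left. apply (Hd y x y u); try lra.
      rewrite Rminus_diag, Rabs_R0. lra.
  - apply Rmult_lt_reg_r with (2 * (b - a + 1)); [lra|]. field_simplify; [|lra]. nra.
Qed.

Lemma is_derive_RInt1 f a t : cont1 f -> is_derive (fun s => RInt f a s) t (f t).
Proof.
  intros Hf. apply (is_derive_RInt f (fun s => RInt f a s) a).
  - exists (mkposreal 1 Rlt_0_1). intros s _. apply (@RInt_correct R_CompleteNormedModule). now apply ex_RInt_cont1.
  - now apply cont1_continuous.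
Qed.

Lemma RInt_derive1 f g a b : cont1 g -> (forall x, is_derive f x (g x)) ->
  RInt g a b = f b - f a.
Proof.
  intros Hg Hd. apply is_RInt_unique.
  apply (is_RInt_derive f g); intros; auto. now apply cont1_continuous.
Qed.

(** The derivative is known only inside the interval. The difference of [f] and the primitive of [g]
    is continuous up to the ends and has derivative zero inside, so the mean value theorem makes it
    constant. *)
Lemma RInt_derive_open f g a b : a <= b -> cont1 f -> cont1 g ->
  (forall x, a < x < b -> is_derive f x (g x)) -> RInt g a b = f b - f a.
Proof.
  intros Hab Hf Hg Hd.
  destruct (MVT_gen (fun t => f t - RInt g a t) a b (fun _ => 0)) as [c [_ Hc]].
  - rewrite Rmin_left, Rmax_right by auto. intros x Hx.
    replace 0 with (g x - g x) by ring.
    apply (@is_derive_minus R_AbsRing R_NormedModule f (fun t => RInt g a t)); auto using is_derive_RInt1.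
  - intros x _. apply (continuity_pt_minus f (fun t => RInt g a t)); auto.
    apply derivable_continuous_pt. exists (g x). apply is_derive_Reals, is_derive_RInt1; auto.
  - rewrite RInt_point in Hc. unfold zero in Hc; simpl in Hc. lra.
Qed.

(** As a function of the upper limit in x, the right-hand side vanishes at [a], and differentiation
    under the integral gives the inner integral of the left-hand side as its derivative. *)
Lemma RInt_fubini g a b c d : cont2 g -> a <= b -> c <= d ->
  RInt (fun x => RInt (fun y => g x y) c d) a b = RInt (fun y => RInt (fun x => g x y) a b) c d.
Proof.
  intros Hg Hab Hcd.
  assert (Hint : forall t y, is_derive (fun s => RInt (fun x => g x y) a s) t (g t y)).
  { intros t y. apply (is_derive_RInt1 (fun x => g x y)). now apply cont1_x. }
  assert (Hd : forall t y, Derive (fun s => RInt (fun x => g x y) a s) t = g t y)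
    by (intros; now apply is_derive_unique).
  assert (HC2 : forall t, a <= t -> cont1 (fun y => RInt (fun x => g x y) a t)).
  { intros t Ht. apply (cont1_RInt_param (fun y x => g x y)); auto. now apply cont2_swap. }
  assert (HC2' : forall t, t <= a -> cont1 (fun y => RInt (fun x => g x y) a t)).
  { intros t Ht. apply cont1_ext with (fun y => - RInt (fun x => g x y) t a).
    - intros y. pose proof (RInt_Chasles1 (fun x => g x y) a t a (cont1_x g y Hg)) as E.
      rewrite RInt_point in E. unfold zero in E; simpl in E. lra.
    - apply cont1_opp. apply (cont1_RInt_param (fun y x => g x y)); auto. now apply cont2_swap. }
  assert (HD : forall t, is_derive (fun s => RInt (fun y => RInt (fun x => g x y) a s) c d) t
                (RInt (fun y => g t y) c d)).
  { intros t. rewrite <- (RInt_ext (fun y => Derive (fun s => RInt (fun x => g x y) a s) t)) by (intros; apply Hd).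
    apply is_derive_RInt_param.
    - exists (mkposreal 1 Rlt_0_1). intros s _ y _. exists (g s y); apply Hint.
    - intros y _. apply continuity_2d_pt_ext with g; auto.
    - exists (mkposreal 1 Rlt_0_1). intros s _. apply ex_RInt_cont1.
      destruct (Rle_dec a s); [apply HC2 | apply HC2']; lra. }
  rewrite (RInt_derive1 (fun s => RInt (fun y => RInt (fun x => g x y) a s) c d)); auto.
  - rewrite (RInt_ext (fun y => RInt (fun x => g x y) a a) (fun _ => 0)).
    + rewrite RInt_const1. eqR. ring.
    + intros y _. apply (RInt_point a (fun x => g x y)).
  - now apply cont1_RInt_param.
Qed.

Lemma is_derive_plus1 (f g : R -> R) (x df dg : R) :
  is_derive f x df -> is_derive g x dg -> is_derive (fun t => f t + g t) x (df + dg).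
Proof. apply (@is_derive_plus R_AbsRing R_NormedModule). Qed.
Lemma is_derive_minus1 (f g : R -> R) (x df dg : R) :
  is_derive f x df -> is_derive g x dg -> is_derive (fun t => f t - g t) x (df - dg).
Proof. apply (@is_derive_minus R_AbsRing R_NormedModule). Qed.
Lemma is_derive_mult1 (f g : R -> R) (x df dg : R) :
  is_derive f x df -> is_derive g x dg -> is_derive (fun t => f t * g t) x (df * g x + f x * dg).
Proof. intros Hf Hg. apply (is_derive_mult f g); auto. intros; apply Rmult_comm. Qed.
Lemma is_derive_scal1 (f : R -> R) (x c df : R) :
  is_derive f x df -> is_derive (fun t => c * f t) x (c * df).
Proof. intros Hf. now apply is_derive_scal. Qed.
Lemma is_derive_scalr1 (f : R -> R) (x c df : R) :
  is_derive f x df -> is_derive (fun t => f t * c) x (df * c).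
Proof.
  intros Hf. rewrite Rmult_comm. apply is_derive_ext with (fun t => c * f t).
  - intros t; apply Rmult_comm.
  - now apply is_derive_scal.
Qed.
Lemma is_derive_eq1 (f : R -> R) (x l l' : R) : l = l' -> is_derive f x l -> is_derive f x l'.
Proof. now intros ->. Qed.

(** * Double integrals on the unit square *)

Ltac ct := intros; repeat (first
  [ assumption
  | apply cont1_const | apply cont1_id | apply cont2_const
  | apply cont1_plus | apply cont1_minus | apply cont1_mult | apply cont1_opp
  | apply cont1_abs | apply cont1_div | apply cont1_pow
  | apply cont2_plus | apply cont2_minus | apply cont2_mult | apply cont2_opp
  | apply cont2_abs | apply cont2_div | apply cont2_pow
  | apply cont1_x | apply cont1_y ]).

Definition I2 (g : R -> R -> R) : R := RInt (fun x => RInt (fun y => g x y) 0 1) 0 1.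

Lemma cont1_inner g : cont2 g -> cont1 (fun x => RInt (fun y => g x y) 0 1).
Proof. intros H. apply (cont1_RInt_param g 0 1); [lra|auto]. Qed.

Lemma I2_swap g : cont2 g -> I2 g = RInt (fun y => RInt (fun x => g x y) 0 1) 0 1.
Proof. intros H. unfold I2. apply (RInt_fubini g 0 1 0 1); auto; lra. Qed.
Lemma I2_transpose g : cont2 g -> I2 (fun x y => g y x) = I2 g.
Proof. intros H. now rewrite (I2_swap g). Qed.
Lemma I2_ext f g : (forall x y, f x y = g x y) -> I2 f = I2 g.
Proof. intros E. apply RInt_ext; intros; apply RInt_ext; intros; apply E. Qed.
Lemma I2_plus f g : cont2 f -> cont2 g -> I2 (fun x y => f x y + g x y) = I2 f + I2 g.
Proof.
  intros Hf Hg. unfold I2. rewrite <- RInt_plus1 by now apply cont1_inner.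
  apply RInt_ext; intros. apply RInt_plus1; ct.
Qed.
Lemma I2_minus f g : cont2 f -> cont2 g -> I2 (fun x y => f x y - g x y) = I2 f - I2 g.
Proof.
  intros Hf Hg. unfold I2. rewrite <- RInt_minus1 by now apply cont1_inner.
  apply RInt_ext; intros. apply RInt_minus1; ct.
Qed.
Lemma I2_scal f c : cont2 f -> I2 (fun x y => c * f x y) = c * I2 f.
Proof.
  intros Hf. unfold I2. rewrite <- RInt_scal1 by now apply cont1_inner.
  apply RInt_ext; intros. apply RInt_scal1; ct.
Qed.
Lemma I2_const c : I2 (fun _ _ => c) = c.
Proof.
  unfold I2. rewrite (RInt_ext _ (fun _ => c)).
  - rewrite RInt_const1. eqR. ring.
  - intros. rewrite RInt_const1. eqR. ring.
Qed.
Lemma I2_le f g : cont2 f -> cont2 g ->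
  (forall x y, 0 < x < 1 -> 0 < y < 1 -> f x y <= g x y) -> I2 f <= I2 g.
Proof.
  intros Hf Hg H. apply RInt_le1; try lra; try now apply cont1_inner.
  intros. apply RInt_le1; ct; auto; lra.
Qed.
Lemma I2_sq_ge0 f : cont2 f -> 0 <= I2 (fun x y => f x y ^ 2).
Proof.
  intros Hf. rewrite <- (I2_const 0). apply I2_le; ct. apply pow2_ge_0.
Qed.

(** The variable of differentiation stays in the open interval but the other one is arbitrary: the
    relation holds on the edges as well, where traces are differentiated along the edge. *)
Definition pdx (g g' : R -> R -> R) : Prop :=
  forall x y, 0 < x < 1 -> is_derive (fun t => g t y) x (g' x y).
Definition pdy (g g' : R -> R -> R) : Prop :=
  forall x y, 0 < y < 1 -> is_derive (fun t => g x t) y (g' x y).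

Lemma locally_unit_interval s (Q : R -> Prop) :
  0 < s < 1 -> (forall u, 0 < u < 1 -> Q u) -> locally s Q.
Proof.
  intros Hs HQ.
  assert (Hm : 0 < Rmin s (1 - s)) by (apply Rmin_pos; lra).
  exists (mkposreal _ Hm). intros u Hu. apply HQ.
  change (Rabs (u - s) < Rmin s (1 - s)) in Hu.
  pose proof (Rmin_l s (1 - s)). pose proof (Rmin_r s (1 - s)).
  apply Rabs_lt_between' in Hu. lra.
Qed.

Lemma is_derive_inner g g' s : cont2 g -> cont2 g' -> pdx g g' -> 0 < s < 1 ->
  is_derive (fun t => RInt (fun y => g t y) 0 1) s (RInt (fun y => g' s y) 0 1).
Proof.
  intros Hg Hg' Hd Hs.
  rewrite <- (RInt_ext (fun y => Derive (fun t => g t y) s))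
    by (intros; apply is_derive_unique, Hd, Hs).
  apply is_derive_RInt_param.
  - apply locally_unit_interval; auto. intros u Hu y _. exists (g' u y). now apply Hd.
  - intros y _. apply continuity_2d_pt_ext_loc with g'; [|apply Hg'].
    destruct (locally_unit_interval s (fun u => 0 < u < 1) Hs (fun u Hu => Hu)) as [d Hd'].
    exists d. intros u v Hu _. symmetry. apply is_derive_unique, Hd. now apply Hd'.
  - apply locally_unit_interval; auto. intros u Hu. apply ex_RInt_cont1. ct.
Qed.

Lemma cont1_bounded g a b : a <= b -> cont1 g -> exists M, 0 <= M /\ forall x, a <= x <= b -> Rabs (g x) <= M.
Proof.
  intros Hab Hg.
  destruct (continuity_ab_maj (fun x => Rabs (g x)) a b Hab (fun x _ => cont1_abs g Hg x)) as [m [Hm _]].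
  exists (Rabs (g m)). split; [apply Rabs_pos|auto].
Qed.

(** The integrand pairs the slice of [F] at s with the slice of [H] at a different t; the chain rule
    on the diagonal in [I2_jacobian] needs continuity in both parameters jointly. *)
Lemma cont2_RInt_prod F H : cont2 F -> cont2 H ->
  cont2 (fun s t => RInt (fun y => F s y * H t y) 0 1).
Proof.
  intros HF HH s t e.
  destruct (cont1_bounded (fun y => H t y) 0 1) as [M1 [HM1 B1]]; [lra|ct|].
  destruct (cont1_bounded (fun y => F s y) 0 1) as [M2 [HM2 B2]]; [lra|ct|].
  (* With both increments below [e1 <= 1], the product changes by at most [e1 * (M1 + M2 + 1)]; the
     2 in the denominator makes the final inequality strict. *)
  set (e1 := Rmin 1 (e / (M1 + M2 + 2))).
  assert (He0 := cond_pos e).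
  assert (Hq : 0 < e / (M1 + M2 + 2)) by (apply Rdiv_lt_0_compat; lra).
  assert (He1 : 0 < e1) by (apply Rmin_pos; lra).
  destruct (uniform_continuity_2d_1d' F 0 1 s (fun y _ => HF s y) (mkposreal _ He1)) as [d1 Hd1].
  destruct (uniform_continuity_2d_1d' H 0 1 t (fun y _ => HH t y) (mkposreal _ He1)) as [d2 Hd2].
  assert (Hm : 0 < Rmin d1 d2) by (apply Rmin_pos; apply cond_pos).
  exists (mkposreal _ Hm). simpl. intros u v Hu Hv.
  assert (Hu' : Rabs (u - s) < d1) by (eapply Rlt_le_trans; [exact Hu|apply Rmin_l]).
  assert (Hv' : Rabs (v - t) < d2) by (eapply Rlt_le_trans; [exact Hv|apply Rmin_r]).
  apply Rabs_lt_between' in Hu'. apply Rabs_lt_between' in Hv'.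
  pose proof (cond_pos d1) as P1. pose proof (cond_pos d2) as P2.
  assert (L1 : e1 <= 1) by apply Rmin_l.
  assert (L2 : e1 * (M1 + M2 + 2) <= e).
  { apply Rle_trans with (e / (M1 + M2 + 2) * (M1 + M2 + 2)).
    - apply Rmult_le_compat_r; [lra|apply Rmin_r].
    - right. field. lra. }
  eapply Rle_lt_trans.
  - apply (RInt_unif_close _ _ 0 1 (e1 * (M1 + M2 + 1))); ct; try lra.
    rename x into y.
    assert (A1 : Rabs (F u y - F s y) < e1).
    { apply (Hd1 y s y u); try lra. rewrite Rminus_diag, Rabs_R0. lra. }
    assert (A2 : Rabs (H v y - H t y) < e1).
    { apply (Hd2 y t y v); try lra. rewrite Rminus_diag, Rabs_R0. lra. }
    specialize (B1 y H0). specialize (B2 y H0).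
    replace (F u y * H v y - F s y * H t y) with
      ((F u y - F s y) * (H v y - H t y) + (F u y - F s y) * H t y + F s y * (H v y - H t y)) by ring.
    eapply Rle_trans; [apply Rabs_triang|].
    eapply Rle_trans; [apply Rplus_le_compat_r, Rabs_triang|].
    rewrite !Rabs_mult.
    pose proof (Rabs_pos (F u y - F s y)). pose proof (Rabs_pos (H v y - H t y)).
    pose proof (Rabs_pos (F s y)). pose proof (Rabs_pos (H t y)).
    assert (Rabs (F u y - F s y) * Rabs (H v y - H t y) <= e1 * 1) by (apply Rmult_le_compat; lra).
    assert (Rabs (F u y - F s y) * Rabs (H t y) <= e1 * M1) by (apply Rmult_le_compat; lra).
    assert (Rabs (F s y) * Rabs (H v y - H t y) <= M2 * e1) by (apply Rmult_le_compat; lra).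
    lra.
  - nra.
Qed.

Lemma RInt_by_parts_open f f' g g' : cont1 f -> cont1 f' -> cont1 g -> cont1 g' ->
  (forall x, 0 < x < 1 -> is_derive f x (f' x)) -> (forall x, 0 < x < 1 -> is_derive g x (g' x)) ->
  RInt (fun x => f x * g' x) 0 1 = f 1 * g 1 - f 0 * g 0 - RInt (fun x => f' x * g x) 0 1.
Proof.
  intros Hf Hf' Hg Hg' Df Dg.
  assert (E : RInt (fun x => f' x * g x + f x * g' x) 0 1 = f 1 * g 1 - f 0 * g 0).
  { apply (RInt_derive_open (fun x => f x * g x)); ct; try lra.
    apply (is_derive_mult1 f g); auto. }
  rewrite RInt_plus1 in E by ct. lra.
Qed.

(* Formally [Px Qy - M^2 = d/dx (P Qy) - d/dy (P M)], but [Qy] need not be differentiable; the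
   derivative is taken instead on the diagonal of [beta s t], the integral over [y] of
   [P s y * Qy t y], after an integration by parts in [y]. *)
Lemma I2_jacobian P Q Px Qy M :
  cont2 P -> cont2 Q -> cont2 Px -> cont2 Qy -> cont2 M ->
  pdx P Px -> pdy P M -> pdx Q M -> pdy Q Qy ->
  I2 (fun x y => Px x y * Qy x y - M x y ^ 2) =
    (P 1 1 * Q 1 1 - P 1 0 * Q 1 0 - (P 0 1 * Q 0 1 - P 0 0 * Q 0 0))
    - (RInt (fun y => M 1 y * Q 1 y) 0 1 - RInt (fun y => M 0 y * Q 0 y) 0 1)
    - (RInt (fun x => P x 1 * M x 1) 0 1 - RInt (fun x => P x 0 * M x 0) 0 1).
Proof.
  intros cP cQ cPx cQy cM dPx dPy dQx dQy.
  set (beta := fun s t => RInt (fun y => P s y * Qy t y) 0 1).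
  assert (E : forall s t, beta s t =
    P s 1 * Q t 1 - P s 0 * Q t 0 - RInt (fun y => M s y * Q t y) 0 1).
  { intros s t. unfold beta. apply (RInt_by_parts_open (fun y => P s y) (fun y => M s y) (fun y => Q t y)); ct.
    now apply dPy. now apply dQy. }
  assert (Ds : forall s t, 0 < s < 1 -> is_derive (fun s => beta s t) s (RInt (fun y => Px s y * Qy t y) 0 1)).
  { intros s t Hs. apply (is_derive_inner (fun s y => P s y * Qy t y) (fun s y => Px s y * Qy t y)); auto.
    - apply cont2_mult; auto. apply cont2_snd; ct.
    - apply cont2_mult; auto. apply cont2_snd; ct.
    - intros x y Hx. apply (is_derive_scalr1 (fun x => P x y)). now apply dPx. }
  assert (Dt : forall s t, 0 < t < 1 -> is_derive (fun t => beta s t) t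
     (P s 1 * M t 1 - P s 0 * M t 0 - RInt (fun y => M s y * M t y) 0 1)).
  { intros s t Ht.
    apply is_derive_ext with (fun t => P s 1 * Q t 1 - P s 0 * Q t 0 - RInt (fun y => M s y * Q t y) 0 1).
    { intros u. now rewrite E. }
    apply (is_derive_minus1 (fun t => P s 1 * Q t 1 - P s 0 * Q t 0)).
    - apply (is_derive_minus1 (fun t => P s 1 * Q t 1)).
      + apply is_derive_scal1. now apply dQx.
      + apply is_derive_scal1. now apply dQx.
    - apply (is_derive_inner (fun t y => M s y * Q t y) (fun t y => M s y * M t y)); auto.
      + apply cont2_mult; auto. apply cont2_snd; ct.
      + apply cont2_mult; auto. apply cont2_snd; ct.
      + intros x y Hx. apply is_derive_scal1. now apply dQx. }
  (* For the chain rule, the derivative in the first variable must exist nearby and be continuous,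
     whereas the one in the second variable is needed only at the point. *)
  assert (Dd : forall t, 0 < t < 1 -> is_derive (fun t => beta t t) t
     (RInt (fun y => Px t y * Qy t y) 0 1 +
      (P t 1 * M t 1 - P t 0 * M t 0 - RInt (fun y => M t y * M t y) 0 1))).
  { intros t Ht. apply is_derive_Reals.
    set (B := P t 1 * M t 1 - P t 0 * M t 0 - RInt (fun y => M t y * M t y) 0 1).
    set (A := RInt (fun y => Px t y * Qy t y) 0 1).
    replace (A + B) with (A * 1 + B * 1) by ring.
    apply (derivable_pt_lim_comp_2d beta (fun t => t) (fun t => t)); try apply derivable_pt_lim_id.
    apply filterdiff_differentiable_pt_lim.
    apply (is_derive_filterdiff beta t t (fun s t => RInt (fun y => Px s y * Qy t y) 0 1)).
    - destruct (locally_unit_interval t (fun u => 0 < u < 1) Ht (fun u Hu => Hu)) as [d Hd].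
      exists d. intros [u v] [Hu Hv]. simpl. apply Ds. now apply Hd.
    - now apply Dt.
    - apply (continuity_2d_pt_filterlim (fun s t => RInt (fun y => Px s y * Qy t y) 0 1) t t).
      now apply cont2_RInt_prod. }
  assert (cb : cont1 (fun t => beta t t)).
  { apply (cont1_comp2 beta (fun t => t) (fun t => t)); ct. now apply cont2_RInt_prod. }
  assert (c1 : cont1 (fun t => RInt (fun y => Px t y * Qy t y) 0 1)) by (apply (cont1_inner (fun x y => Px x y * Qy x y)); ct).
  assert (c2 : cont1 (fun t => RInt (fun y => M t y * M t y) 0 1)) by (apply (cont1_inner (fun x y => M x y * M x y)); ct).
  assert (F := fun c => RInt_derive_open (fun t => beta t t) (fun t => RInt (fun y => Px t y * Qy t y) 0 1 +
      (P t 1 * M t 1 - P t 0 * M t 0 - RInt (fun y => M t y * M t y) 0 1)) 0 1 Rle_0_1 cb c Dd).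
  specialize (F ltac:(ct)). simpl in F.
  assert (G : I2 (fun x y => Px x y * Qy x y - M x y ^ 2) =
     RInt (fun t => RInt (fun y => Px t y * Qy t y) 0 1) 0 1 - RInt (fun t => RInt (fun y => M t y * M t y) 0 1) 0 1).
  { rewrite I2_minus by ct. unfold I2. f_equal. apply RInt_ext; intros. apply RInt_ext; intros. simpl. eqR. ring. }
  rewrite RInt_plus1, RInt_minus1, RInt_minus1, !E in F by ct.
  rewrite G. lra.
Qed.

Lemma RInt_sub_le f a b : cont1 f -> (forall x, 0 <= f x) -> 0 <= a <= b -> b <= 1 ->
  RInt f a b <= RInt f 0 1.
Proof.
  intros Hf H0 Ha Hb.
  rewrite <- (RInt_Chasles1 f 0 a 1), <- (RInt_Chasles1 f a b 1) by auto.
  pose proof (RInt_ge01 f 0 a (proj1 Ha) Hf (fun x _ => H0 x)).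
  pose proof (RInt_ge01 f b 1 Hb Hf (fun x _ => H0 x)). lra.
Qed.

(** The squares at two points differ by an integral of 2 f f', which Young's inequality splits with
    weight eta; averaging over the second point gives the bound. A small eta makes the derivative
    term absorbable. *)
Lemma trace_1d f f' x0 eta : cont1 f -> cont1 f' -> 0 < eta -> 0 <= x0 <= 1 ->
  (forall x, 0 < x < 1 -> is_derive f x (f' x)) ->
  f x0 ^ 2 <= (1 + / eta) * RInt (fun x => f x ^ 2) 0 1 + eta * RInt (fun x => f' x ^ 2) 0 1.
Proof.
  intros Hf Hf' He Hx0 Hd.
  set (K := RInt (fun x => / eta * f x ^ 2 + eta * f' x ^ 2) 0 1).
  assert (HK : K = / eta * RInt (fun x => f x ^ 2) 0 1 + eta * RInt (fun x => f' x ^ 2) 0 1).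
  { unfold K. rewrite RInt_plus1, !RInt_scal1 by ct. reflexivity. }
  assert (Hie : 0 < / eta) by now apply Rinv_0_lt_compat.
  assert (pos : forall x, 0 <= / eta * f x ^ 2 + eta * f' x ^ 2).
  { intros x. pose proof (pow2_ge_0 (f x)). pose proof (pow2_ge_0 (f' x)). nra. }
  assert (AG : forall x, Rabs (2 * f x * f' x) <= / eta * f x ^ 2 + eta * f' x ^ 2).
  { intros x. apply Rabs_le.
    assert (E1 : / eta * f x ^ 2 + eta * f' x ^ 2 - 2 * f x * f' x = / eta * (f x - eta * f' x) ^ 2) by (field; lra).
    assert (E2 : / eta * f x ^ 2 + eta * f' x ^ 2 + 2 * f x * f' x = / eta * (f x + eta * f' x) ^ 2) by (field; lra).
    pose proof (pow2_ge_0 (f x - eta * f' x)). pose proof (pow2_ge_0 (f x + eta * f' x)).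
    split; nra. }
  assert (step : forall a b, 0 <= a <= b -> b <= 1 -> Rabs (f b ^ 2 - f a ^ 2) <= K).
  { intros a b Ha Hb.
    rewrite <- (RInt_derive_open (fun x => f x ^ 2) (fun x => 2 * f x * f' x)); ct; try lra.
    - eapply Rle_trans; [apply RInt_abs_le1; ct; lra|].
      eapply Rle_trans; [|apply (RInt_sub_le _ a b); ct; auto; lra].
      apply RInt_le1; ct; auto; lra.
    - replace (2 * f x * f' x) with (INR 2 * f' x * f x ^ 1) by (simpl; ring).
      apply (is_derive_pow f 2). apply Hd; lra. }
  assert (bnd : forall x, 0 <= x <= 1 -> f x0 ^ 2 <= f x ^ 2 + K).
  { intros x Hx. destruct (Rle_dec x x0).
    - specialize (step x x0). apply Rabs_le_between in step; lra.
    - specialize (step x0 x). apply Rabs_le_between in step; lra. }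
  assert (R1 : RInt (fun _ => f x0 ^ 2) 0 1 <= RInt (fun x => f x ^ 2 + K) 0 1).
  { apply RInt_le1; ct; try lra. apply bnd; lra. }
  rewrite RInt_plus1, !RInt_const1 in R1 by ct. lra.
Qed.

Lemma trace_x g g' x0 eta : cont2 g -> cont2 g' -> pdx g g' -> 0 < eta -> 0 <= x0 <= 1 ->
  RInt (fun y => g x0 y ^ 2) 0 1 <=
    (1 + / eta) * I2 (fun x y => g x y ^ 2) + eta * I2 (fun x y => g' x y ^ 2).
Proof.
  intros Hg Hg' Hd He Hx0.
  rewrite !I2_swap by ct.
  assert (C1 : cont1 (fun y => RInt (fun x => g x y ^ 2) 0 1)).
  { apply (cont1_inner (fun y x => g x y ^ 2)), (cont2_swap (fun x y => g x y ^ 2)). ct. }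
  assert (C2 : cont1 (fun y => RInt (fun x => g' x y ^ 2) 0 1)).
  { apply (cont1_inner (fun y x => g' x y ^ 2)), (cont2_swap (fun x y => g' x y ^ 2)). ct. }
  rewrite <- !RInt_scal1, <- RInt_plus1 by ct.
  apply RInt_le1; [lra|ct|ct|]. intros y _.
  apply (trace_1d (fun x => g x y) (fun x => g' x y)); ct. now apply Hd.
Qed.

Lemma pdx_transpose g g' : pdy g g' -> pdx (fun x y => g y x) (fun x y => g' y x).
Proof. intros H x y Hx. now apply H. Qed.

Lemma trace_y g g' y0 eta : cont2 g -> cont2 g' -> pdy g g' -> 0 < eta -> 0 <= y0 <= 1 ->
  RInt (fun x => g x y0 ^ 2) 0 1 <=
    (1 + / eta) * I2 (fun x y => g x y ^ 2) + eta * I2 (fun x y => g' x y ^ 2).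
Proof.
  intros Hg Hg' Hd He Hy0.
  rewrite <- (I2_transpose (fun x y => g x y ^ 2)), <- (I2_transpose (fun x y => g' x y ^ 2)) by ct.
  apply (trace_x (fun x y => g y x) (fun x y => g' y x)); auto using cont2_swap, pdx_transpose.
Qed.

(** A trace estimate in x on the line y = y0, followed by traces of g and g_x in y. The only second
    derivative that enters is the mixed one. *)
Lemma sup_bound g gx gy gxy eta x0 y0 :
  cont2 g -> cont2 gx -> cont2 gy -> cont2 gxy ->
  pdx g gx -> pdy g gy -> pdy gx gxy -> 0 < eta -> 0 <= x0 <= 1 -> 0 <= y0 <= 1 ->
  g x0 y0 ^ 2 <= (1 + / eta) * (2 * I2 (fun x y => g x y ^ 2) + I2 (fun x y => gy x y ^ 2))
     + eta * (2 * I2 (fun x y => gx x y ^ 2) + I2 (fun x y => gxy x y ^ 2)).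
Proof.
  intros Hg Hgx Hgy Hgxy Dx Dy Dxy He Hx Hy.
  pose proof (trace_1d (fun x => g x y0) (fun x => gx x y0) x0 eta ltac:(ct) ltac:(ct) He Hx
    (fun x Hx => Dx x y0 Hx)) as T. simpl in T.
  pose proof (trace_y g gy y0 1 Hg Hgy Dy Rlt_0_1 Hy) as T1.
  pose proof (trace_y gx gxy y0 1 Hgx Hgxy Dxy Rlt_0_1 Hy) as T2.
  simpl in *. rewrite Rinv_1 in T1, T2.
  assert (0 < / eta) by now apply Rinv_0_lt_compat.
  eapply Rle_trans; [exact T|]. apply Rplus_le_compat; apply Rmult_le_compat_l; lra.
Qed.

(** * A priori estimates *)

(** Continuity is stated for all indices, even above order k; [clamp] sets those members to 0. *)
Definition fam (k : nat) (D : nat -> nat -> R -> R -> R) : Prop :=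
  (forall i j, cont2 (D i j)) /\
  (forall i j, (i + j < k)%nat -> pdx (D i j) (D (S i) j)) /\
  (forall i j, (i + j < k)%nat -> pdy (D i j) (D i (S j))).

Definition famT (D : nat -> nat -> R -> R -> R) : nat -> nat -> R -> R -> R :=
  fun i j x y => D j i y x.

Lemma fam_transpose k D : fam k D -> fam k (famT D).
Proof.
  intros (H1 & H2 & H3). split; [|split].
  - intros i j. apply (cont2_swap (D j i)), H1.
  - intros i j Hij x y Hx. apply (H3 j i); auto; lia.
  - intros i j Hij x y Hx. apply (H2 j i); auto; lia.
Qed.

(* [Laplace u = P u_x + Q u_y + R u - S]: the differential equation divided by [eps]. *)
Record regsol (K M0 : R) (u P Q R S : nat -> nat -> R -> R -> R) : Prop := {
  rs_u : fam 4 u; rs_P : fam 2 P; rs_Q : fam 2 Q; rs_R : fam 2 R; rs_S : fam 2 S;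
  rs_pde : forall x y, u 2%nat 0%nat x y + u 0%nat 2%nat x y =
     P 0%nat 0%nat x y * u 1%nat 0%nat x y + Q 0%nat 0%nat x y * u 0%nat 1%nat x y
     + R 0%nat 0%nat x y * u 0%nat 0%nat x y - S 0%nat 0%nat x y;
  rs_bound : forall i j x y, (i + j <= 2)%nat ->
     Rabs (P i j x y) <= K /\ Rabs (Q i j x y) <= K /\ Rabs (R i j x y) <= K /\ Rabs (S i j x y) <= K;
  rs_sup : forall x y, Rabs (u 0%nat 0%nat x y) <= M0;
  rs_x : forall j x y, (j <= 2)%nat -> x = 0 \/ x = 1 -> u 0%nat j x y = 0;
  rs_y : forall i x y, (i <= 2)%nat -> y = 0 \/ y = 1 -> u i 0%nat x y = 0 }.
Arguments rs_u {K M0 u P Q R S}.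
Arguments rs_P {K M0 u P Q R S}.
Arguments rs_Q {K M0 u P Q R S}.
Arguments rs_R {K M0 u P Q R S}.
Arguments rs_S {K M0 u P Q R S}.
Arguments rs_pde {K M0 u P Q R S}.
Arguments rs_bound {K M0 u P Q R S}.
Arguments rs_sup {K M0 u P Q R S}.
Arguments rs_x {K M0 u P Q R S}.
Arguments rs_y {K M0 u P Q R S}.

(** Estimates are proved for one variable or one pair of edges and carried to the other by this
    exchange of x and y. *)
Lemma regsol_transpose K M0 u P Q R S :
  regsol K M0 u P Q R S -> regsol K M0 (famT u) (famT Q) (famT P) (famT R) (famT S).
Proof.
  intros H. destruct H. constructor; auto using fam_transpose; unfold famT; intros.
  - rewrite Rplus_comm, rs_pde0. ring.
  - destruct (rs_bound0 j i y x) as (? & ? & ? & ?); [lia|auto].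
  - apply rs_sup0.
  - now apply rs_y0.
  - now apply rs_x0.
Qed.
Arguments regsol_transpose {K M0 u P Q R S}.

Lemma sq_add a b A B : a ^ 2 <= A -> b ^ 2 <= B -> (a + b) ^ 2 <= 2 * A + 2 * B.
Proof. intros. pose proof (pow2_ge_0 (a - b)). nra. Qed.
Lemma sq_sub a b A B : a ^ 2 <= A -> b ^ 2 <= B -> (a - b) ^ 2 <= 2 * A + 2 * B.
Proof. intros. pose proof (pow2_ge_0 (a + b)). nra. Qed.
Lemma sq_mul K p a : Rabs p <= K -> (p * a) ^ 2 <= K ^ 2 * a ^ 2.
Proof.
  intros H. rewrite Rpow_mult_distr. apply Rmult_le_compat_r; [apply pow2_ge_0|].
  rewrite <- (pow2_abs p). apply pow_incr. split; auto using Rabs_pos.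
Qed.
Lemma sq_abs K p : Rabs p <= K -> p ^ 2 <= K ^ 2 * 1.
Proof. intros H. pose proof (sq_mul K p 1 H). rewrite Rmult_1_r in H0. simpl in *; lra. Qed.

Lemma cont1_eq_closed f g : cont1 f -> cont1 g -> (forall x, 0 < x < 1 -> f x = g x) ->
  forall x, 0 <= x <= 1 -> f x = g x.
Proof.
  intros Hf Hg E x Hx. destruct (Req_dec (f x) (g x)) as [|N]; auto. exfalso.
  assert (Hp : 0 < Rabs (f x - g x)) by (apply Rabs_pos_lt; lra).
  destruct (cont1_minus f g Hf Hg x _ Hp) as [d [Hd H]].
  set (m := Rmin (d / 2) (1 / 4)).
  assert (0 < m) by (apply Rmin_pos; lra).
  assert (m <= d / 2) by apply Rmin_l. assert (m <= 1 / 4) by apply Rmin_r.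
  assert (exists z, 0 < z < 1 /\ z <> x /\ Rabs (z - x) < d) as (z & Hz & Nz & Dz).
  { destruct (Rle_dec x (1 / 2)).
    - exists (x + m). repeat split; try lra. rewrite Rabs_right; lra.
    - exists (x - m). repeat split; try lra. rewrite Rabs_left; lra. }
  specialize (H z). simpl in H. unfold R_dist in H. rewrite (E z Hz) in H.
  assert (HH : Rabs (g z - g z - (f x - g x)) < Rabs (f x - g x)).
  { apply H. split; [split; [exact I|auto]|auto]. }
  rewrite Rminus_diag in HH. rewrite <- Rabs_Ropp in HH.
  replace (- (0 - (f x - g x))) with (f x - g x) in HH by ring. lra.
Qed.

(** * The equation on the edges, its derivatives, and the identities of second order *)

Section Reg.
Variables (K M0 : R) (u P Q R S : nat -> nat -> Rdefinitions.R -> Rdefinitions.R -> Rdefinitions.R).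
Hypothesis (H : regsol K M0 u P Q R S).


Let cu i j : cont2 (u i j). Proof. apply (rs_u H). Qed.
Let cP i j : cont2 (P i j). Proof. apply (rs_P H). Qed.
Let cQ i j : cont2 (Q i j). Proof. apply (rs_Q H). Qed.
Let cR i j : cont2 (R i j). Proof. apply (rs_R H). Qed.
Let cS i j : cont2 (S i j). Proof. apply (rs_S H). Qed.
Let ux i j : (i + j < 4)%nat -> pdx (u i j) (u (Datatypes.S i) j). Proof. apply (rs_u H). Qed.
Let uy i j : (i + j < 4)%nat -> pdy (u i j) (u i (Datatypes.S j)). Proof. apply (rs_u H). Qed.
Let Px i j : (i + j < 2)%nat -> pdx (P i j) (P (Datatypes.S i) j). Proof. apply (rs_P H). Qed.
Let Py i j : (i + j < 2)%nat -> pdy (P i j) (P i (Datatypes.S j)). Proof. apply (rs_P H). Qed.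
Let Qx i j : (i + j < 2)%nat -> pdx (Q i j) (Q (Datatypes.S i) j). Proof. apply (rs_Q H). Qed.
Let Qy i j : (i + j < 2)%nat -> pdy (Q i j) (Q i (Datatypes.S j)). Proof. apply (rs_Q H). Qed.
Let Rx i j : (i + j < 2)%nat -> pdx (R i j) (R (Datatypes.S i) j). Proof. apply (rs_R H). Qed.
Let Ry i j : (i + j < 2)%nat -> pdy (R i j) (R i (Datatypes.S j)). Proof. apply (rs_R H). Qed.
Let Sx i j : (i + j < 2)%nat -> pdx (S i j) (S (Datatypes.S i) j). Proof. apply (rs_S H). Qed.
Let Sy i j : (i + j < 2)%nat -> pdy (S i j) (S i (Datatypes.S j)). Proof. apply (rs_S H). Qed.

Ltac cc := ct; try apply cu; try apply cP; try apply cQ; try apply cR; try apply cS.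

(** Since u, u_y and u_yy vanish on such an edge, the equation expresses u_xx there by u_x, one
    order lower. The next two lemmas differentiate this relation along the edge. *)
Let x_edge x0 : x0 = 0 \/ x0 = 1 -> forall y,
  u 2 0 x0 y = P 0 0 x0 y * u 1 0 x0 y - S 0 0 x0 y.
Proof.
  intros Hx y. pose proof (rs_pde H x0 y) as E1.
  rewrite (rs_x H 2), (rs_x H 1), (rs_x H 0) in E1 by (auto; lia).
  lra.
Qed.

(** Carried by continuity to the closed edge, because [H4_corner] evaluates it at the corners. *)
Lemma x_edge_1 x0 : x0 = 0 \/ x0 = 1 -> forall y, 0 <= y <= 1 ->
  u 2 1 x0 y = P 0 1 x0 y * u 1 0 x0 y
    + P 0 0 x0 y * u 1 1 x0 y - S 0 1 x0 y.
Proof.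
  intros Hx. apply cont1_eq_closed; cc. rename x into y.
  assert (D1 := uy 2 0 ltac:(lia) x0 y H0).
  apply is_derive_unique in D1. rewrite <- D1. apply is_derive_unique.
  apply is_derive_ext with (fun y => P 0 0 x0 y * u 1 0 x0 y - S 0 0 x0 y).
  { intros; symmetry; now apply x_edge. }
  apply is_derive_minus1; [apply (is_derive_mult1 (fun y => P 0 0 x0 y))|].
  - apply Py; auto; lia.
  - apply uy; auto; lia.
  - apply Sy; auto; lia.
Qed.

Lemma x_edge_2 x0 : x0 = 0 \/ x0 = 1 -> forall y, 0 < y < 1 ->
  u 2 2 x0 y = P 0 2 x0 y * u 1 0 x0 y
    + P 0 1 x0 y * u 1 1 x0 y
    + (P 0 1 x0 y * u 1 1 x0 y
    + P 0 0 x0 y * u 1 2 x0 y) - S 0 2 x0 y.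
Proof.
  intros Hx y Hy.
  assert (D1 := uy 2 1 ltac:(lia) x0 y Hy).
  apply is_derive_unique in D1. rewrite <- D1. apply is_derive_unique.
  apply is_derive_ext_loc with (fun y => P 0 1 x0 y * u 1 0 x0 y
    + P 0 0 x0 y * u 1 1 x0 y - S 0 1 x0 y).
  { apply locally_unit_interval; auto. intros; symmetry. apply x_edge_1; auto; lra. }
  apply is_derive_minus1; [apply is_derive_plus1|].
  - apply (is_derive_mult1 (fun y => P 0 1 x0 y)).
    + apply Py; auto; lia.
    + apply uy; auto; lia.
  - apply (is_derive_mult1 (fun y => P 0 0 x0 y)).
    + apply Py; auto; lia.
    + apply uy; auto; lia.
  - apply Sy; auto; lia.
Qed.

Lemma pde_x x y : 0 < x < 1 ->
  u 3 0 x y + u 1 2 x y =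
    P 1 0 x y * u 1 0 x y + P 0 0 x y * u 2 0 x y
    + (Q 1 0 x y * u 0 1 x y + Q 0 0 x y * u 1 1 x y)
    + (R 1 0 x y * u 0 0 x y + R 0 0 x y * u 1 0 x y)
    - S 1 0 x y.
Proof.
  intros Hx.
  assert (D1 := is_derive_plus1 _ _ _ _ _ (ux 2 0 ltac:(lia) x y Hx) (ux 0 2 ltac:(lia) x y Hx)).
  apply is_derive_unique in D1. rewrite <- D1. apply is_derive_unique.
  eapply is_derive_ext. { intros t; symmetry; apply (rs_pde H). }
  assert (MM : forall (A B A' B' : Rdefinitions.R -> Rdefinitions.R -> Rdefinitions.R),
    pdx A A' -> pdx B B' -> is_derive (fun t => A t y * B t y) x (A' x y * B x y + A x y * B' x y)).
  { intros A B A' B' HA HB. apply (is_derive_mult1 (fun t => A t y) (fun t => B t y)); auto. }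
  apply is_derive_minus1; [apply is_derive_plus1; [apply is_derive_plus1|]; apply MM|];
  first [ apply ux; lia | apply Px; lia | apply Qx; lia | apply Rx; lia | apply Sx; auto; lia ].
Qed.

Lemma pde_xy x y : 0 < x < 1 -> 0 < y < 1 ->
  u 3 1 x y + u 1 3 x y =
    P 1 1 x y * u 1 0 x y + P 1 0 x y * u 1 1 x y
    + (P 0 1 x y * u 2 0 x y + P 0 0 x y * u 2 1 x y)
    + (Q 1 1 x y * u 0 1 x y + Q 1 0 x y * u 0 2 x y
    + (Q 0 1 x y * u 1 1 x y + Q 0 0 x y * u 1 2 x y))
    + (R 1 1 x y * u 0 0 x y + R 1 0 x y * u 0 1 x y
    + (R 0 1 x y * u 1 0 x y + R 0 0 x y * u 1 1 x y))
    - S 1 1 x y.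
Proof.
  intros Hx Hy.
  assert (D1 := is_derive_plus1 _ _ _ _ _ (uy 3 0 ltac:(lia) x y Hy) (uy 1 2 ltac:(lia) x y Hy)).
  apply is_derive_unique in D1. rewrite <- D1. apply is_derive_unique.
  eapply is_derive_ext. { intros t; symmetry; now apply pde_x. }
  assert (MM : forall (A B A' B' : Rdefinitions.R -> Rdefinitions.R -> Rdefinitions.R),
    pdy A A' -> pdy B B' -> is_derive (fun t => A x t * B x t) y (A' x y * B x y + A x y * B' x y)).
  { intros A B A' B' HA HB. apply (is_derive_mult1 (fun t => A x t) (fun t => B x t)); auto. }
  apply is_derive_minus1;
    [apply is_derive_plus1; [apply is_derive_plus1|]; apply is_derive_plus1; apply MM|];
  first [ apply uy; lia | apply Py; lia | apply Qy; lia | apply Ry; lia | apply Sy; auto; lia ].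
Qed.


Lemma energy_x : I2 (fun x y => u 1 0 x y ^ 2) = - I2 (fun x y => u 0 0 x y * u 2 0 x y).
Proof.
  rewrite !I2_swap by cc.
  assert (c1 : cont1 (fun y => RInt (fun x => u 0 0 x y * u 2 0 x y) 0 1)).
  { apply (cont1_inner (fun y x => u 0 0 x y * u 2 0 x y)),
      (cont2_swap (fun x y => u 0 0 x y * u 2 0 x y)). cc. }
  replace (- _) with ((-1) * RInt (fun y => RInt (fun x => u 0 0 x y * u 2 0 x y) 0 1) 0 1) by ring.
  rewrite <- RInt_scal1 by auto.
  apply RInt_ext. intros y _.
  rewrite (RInt_by_parts_open (fun x => u 0 0 x y) (fun x => u 1 0 x y) (fun x => u 1 0 x y)); cc.
  - rewrite !(rs_x H 0) by (auto; lia).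
    rewrite (RInt_ext (fun x => u 1 0 x y ^ 2) (fun x => u 1 0 x y * u 1 0 x y)).
    + eqR. lra.
    + intros. eqR. simpl. lra.
  - apply ux; auto; lia.
  - apply ux; auto; lia.
Qed.

(** Each boundary term of [I2_jacobian] contains a first derivative of u tangential to the edge, and
    these vanish. *)
Lemma H2_identity : I2 (fun x y => u 2 0 x y * u 0 2 x y - u 1 1 x y ^ 2) = 0.
Proof.
  rewrite (I2_jacobian (u 1 0) (u 0 1) (u 2 0) (u 0 2) (u 1 1)); cc;
    try (apply ux; lia); try (apply uy; lia).
  rewrite !(rs_x H 1), !(rs_y H 1) by (auto; lia).
  assert (Z : forall f, (forall t, f t = 0) -> RInt f 0 1 = 0).
  { intros f Hf. rewrite (RInt_ext f (fun _ => 0)) by (intros; apply Hf). rewrite RInt_const1. eqR; ring. }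
  rewrite !Z. ring.
  all: intros t; rewrite ?(rs_x H 1), ?(rs_y H 1) by (auto; lia); ring.
Qed.

End Reg.
Arguments x_edge_1 {K M0 u P Q R S}.
Arguments x_edge_2 {K M0 u P Q R S}.
Arguments pde_x {K M0 u P Q R S}.
Arguments pde_xy {K M0 u P Q R S}.
Arguments energy_x {K M0 u P Q R S}.
Arguments H2_identity {K M0 u P Q R S}.

Lemma RInt_abs_bound f g a b : a <= b -> cont1 f -> cont1 g ->
  (forall x, a < x < b -> Rabs (f x) <= g x) -> Rabs (RInt f a b) <= RInt g a b.
Proof.
  intros Hab Hf Hg H. eapply Rle_trans; [apply RInt_abs_le1; auto|].
  apply RInt_le1; auto. now apply cont1_abs.
Qed.

Lemma abs_mul_le a b A B : a ^ 2 <= A -> b ^ 2 <= B -> Rabs (a * b) <= / 2 * (A + B).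
Proof.
  intros Ha Hb. apply Rabs_le.
  pose proof (pow2_ge_0 (a + b)). pose proof (pow2_ge_0 (a - b)). split; nra.
Qed.

(** Bounds for the sums of squared L2 norms of the derivatives up to order two, of those of order
    three, and of the mixed ones of order four. The factors are not optimised; the second power of
    [K ^ 2] comes from the weights of Young's inequality and of the traces, which are proportional
    to [K ^ 2] or its inverse. *)
Definition const2 (K M0 : R) : R := 110 * (K ^ 2) ^ 2 * (M0 ^ 2 + 1).
Definition const3 (K M0 : R) : R := 200 * (K ^ 2) ^ 2 * (const2 K M0 + 1).
Definition const4 (K M0 : R) : R := 3500 * (K ^ 2) ^ 2 * (const2 K M0 + const3 K M0 + 1).

(** * Energy bounds of orders two and three, edge and corner terms of order four *)

Section Reg.
Variables (K M0 : R) (u P Q R S : nat -> nat -> Rdefinitions.R -> Rdefinitions.R -> Rdefinitions.R).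
Hypothesis (HK : 1 <= K) (H : regsol K M0 u P Q R S).

Let E i j := I2 (fun x y => u i j x y ^ 2).
Let k := K ^ 2.

Let cu i j : cont2 (u i j). Proof. apply (rs_u H). Qed.
Let cP i j : cont2 (P i j). Proof. apply (rs_P H). Qed.
Let cQ i j : cont2 (Q i j). Proof. apply (rs_Q H). Qed.
Let cR i j : cont2 (R i j). Proof. apply (rs_R H). Qed.
Let cS i j : cont2 (S i j). Proof. apply (rs_S H). Qed.
Let ux i j : (i + j < 4)%nat -> pdx (u i j) (u (Datatypes.S i) j). Proof. apply (rs_u H). Qed.
Let uy i j : (i + j < 4)%nat -> pdy (u i j) (u i (Datatypes.S j)). Proof. apply (rs_u H). Qed.
Let KK : 1 <= k. Proof. unfold k. nra. Qed.
Let kk : k <= k ^ 2. Proof. clear -KK. simpl. nra. Qed.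
Let E0 i j : 0 <= E i j. Proof. apply I2_sq_ge0, cu. Qed.
Let bP i j x y : (i + j <= 2)%nat -> Rabs (P i j x y) <= K. Proof. apply (rs_bound H). Qed.
Let bQ i j x y : (i + j <= 2)%nat -> Rabs (Q i j x y) <= K. Proof. apply (rs_bound H). Qed.
Let bR i j x y : (i + j <= 2)%nat -> Rabs (R i j x y) <= K. Proof. apply (rs_bound H). Qed.
Let bS i j x y : (i + j <= 2)%nat -> Rabs (S i j x y) <= K. Proof. apply (rs_bound H). Qed.

Ltac cc := ct; try apply cu; try apply cP; try apply cQ; try apply cR; try apply cS.
Ltac lin := repeat first [rewrite I2_plus by cc | rewrite I2_minus by cc | rewrite I2_scal by cc | rewrite I2_const].
Ltac lin1 := repeat first [rewrite RInt_plus1 by cc | rewrite RInt_minus1 by cc | rewrite RInt_scal1 by cc | rewrite RInt_const1].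
(** Bounds the square of a sum along its syntax tree, doubling at every node. The majorants given by
    hand in the proofs below have to mirror that tree. *)
Ltac sqs := lazymatch goal with
  | |- (_ + _) ^ 2 <= _ => apply sq_add; sqs
  | |- (_ - _) ^ 2 <= _ => apply sq_sub; sqs
  | |- (_ * _) ^ 2 <= _ => apply sq_mul; sqs
  | |- (_ _ _ _ _) ^ 2 <= _ => apply sq_abs; sqs
  | |- Rabs _ <= _ => first [apply bP | apply bQ | apply bR | apply bS]; lia
  end.

Let C2 := const2 K M0.

(** By [H2_identity] the Laplacian controls all second derivatives, and by the equation it is
    controlled by first derivatives. [energy_x] interpolates these between the Laplacian and u, and
    the maximum bound [M0] on u closes the circle. *)
Lemma H2_bound : E 0 0 + E 1 0 + E 0 1 + E 2 0 + E 1 1 + E 0 2 <= C2.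
Proof.
  assert (EX := energy_x H). assert (J := H2_identity H).
  assert (EY := energy_x (regsol_transpose H)).
  unfold famT in EY.
  rewrite (I2_transpose (fun x y => u 0 1 x y ^ 2)),
    (I2_transpose (fun x y => u 0 0 x y * u 0 2 x y)) in EY by cc.
  rewrite I2_minus in J by cc.
  set (L := I2 (fun x y => (u 2 0 x y + u 0 2 x y) ^ 2)).
  assert (L1 : L = E 2 0 + E 0 2 + 2 * E 1 1).
  { unfold L. rewrite (I2_ext _ (fun x y => u 2 0 x y ^ 2 + u 0 2 x y ^ 2
      + 2 * (u 2 0 x y * u 0 2 x y))) by (intros; ring).
    lin. unfold E. lra. }
  assert (L2 : L <= k * (8 * E 1 0 + 8 * E 0 1 + 4 * E 0 0 + 2)).
  { unfold L. apply Rle_trans with (I2 (fun x y =>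
      2 * (2 * (2 * (k * u 1 0 x y ^ 2) + 2 * (k * u 0 1 x y ^ 2)) + 2 * (k * u 0 0 x y ^ 2)) + 2 * (k * 1))).
    - apply I2_le; cc. rewrite (rs_pde H). sqs.
    - lin. unfold E. lra. }
  (* With the weight 16 k, the first derivatives in [L2], which carry the factor 8 k, cost a quarter
     of [L]; this is absorbed in [L5]. *)
  assert (L3 : 16 * k * (E 1 0 + E 0 1) <= / 2 * L + / 2 * (16 * k) ^ 2 * E 0 0).
  { unfold E in *. rewrite EX, EY.
    replace (16 * k * _) with (- (16 * k) * (I2 (fun x y => u 0 0 x y * u 2 0 x y) +
       I2 (fun x y => u 0 0 x y * u 0 2 x y))) by ring.
    rewrite <- I2_plus, <- I2_scal by cc. unfold L. rewrite <- !I2_scal, <- I2_plus by cc.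
    apply I2_le; cc.
    pose proof (pow2_ge_0 ((u 2 0 x y + u 0 2 x y) + 16 * k * u 0 0 x y)). nra. }
  assert (L4 : E 0 0 <= M0 ^ 2).
  { rewrite <- (I2_const (M0 ^ 2)). apply I2_le; cc.
    pose proof (sq_abs _ _ (rs_sup H x y)). lra. }
  pose proof (E0 1 0). pose proof (E0 0 1). pose proof (E0 0 0). pose proof (E0 1 1).
  assert (k * E 0 0 <= k * M0 ^ 2) by (apply Rmult_le_compat_l; lra).
  assert (k ^ 2 * E 0 0 <= k ^ 2 * M0 ^ 2) by (apply Rmult_le_compat_l; [nra|lra]).
  assert (L5 : L <= 4 / 3 * (64 * (k ^ 2 * M0 ^ 2) + 4 * (k * M0 ^ 2) + 2 * k)).
  { clear J. ring_simplify in L3. ring_simplify in L2. nra. }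
  assert (L6 : E 1 0 + E 0 1 <= / 32 * L + 8 * (k * M0 ^ 2)).
  { apply Rmult_le_reg_l with (16 * k); [lra|].
    assert (0 <= L) by (rewrite L1; pose proof (E0 2 0); pose proof (E0 0 2); lra).
    assert (L <= k * L) by nra. lra. }
  unfold C2, const2. fold k. assert (0 <= M0 ^ 2) by apply pow2_ge_0.
  assert (k * M0 ^ 2 <= k ^ 2 * M0 ^ 2) by nra. assert (kk' := kk).
  assert (M0 ^ 2 <= k * M0 ^ 2) by nra. nra.
Qed.

Lemma edge_trace_x i j x0 : (i + j < 4)%nat -> x0 = 0 \/ x0 = 1 -> forall eta, 0 < eta ->
  RInt (fun y => u i j x0 y ^ 2) 0 1 <= (1 + / eta) * E i j + eta * E (Datatypes.S i) j.
Proof.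
  intros Hij Hx eta He. apply trace_x; auto. lra.
Qed.

Lemma H3_edge x0 : x0 = 0 \/ x0 = 1 ->
  Rabs (RInt (fun y => u 2 1 x0 y * u 1 1 x0 y) 0 1)
    <= 4 * k * C2 + 3 * k * (1 + 12 * k) * C2 + / 4 * E 2 1 + k.
Proof.
  intros Hx.
  assert (B := H2_bound).
  pose proof (E0 0 0). pose proof (E0 0 1). pose proof (E0 0 2). pose proof (E0 1 0). pose proof (E0 2 0). pose proof (E0 1 1).
  assert (T1 := edge_trace_x 1 0 x0 ltac:(lia) Hx 1 Rlt_0_1). rewrite Rinv_1 in T1.
  (* This eta leaves a quarter of [E 2 1] per edge. In [H3_bound] two edges, doubled by expanding
     the square of the Laplacian of u_x, then use up one of the two available copies of [E 2 1]. *)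
  assert (Heta : 0 < / (12 * k)) by (apply Rinv_0_lt_compat; lra).
  assert (T2 := edge_trace_x 1 1 x0 ltac:(lia) Hx _ Heta). rewrite Rinv_inv in T2.
  apply Rle_trans with (RInt (fun y => / 2 * ((2 * (2 * (k * u 1 0 x0 y ^ 2) + 2 * (k * u 1 1 x0 y ^ 2)) + 2 * (k * 1)) + u 1 1 x0 y ^ 2)) 0 1).
  - apply RInt_abs_bound; cc; try lra. apply abs_mul_le; [|lra].
    rewrite (x_edge_1 H) by (auto; lra). sqs.
  - lin1.
    set (t1 := RInt (fun y => u 1 0 x0 y ^ 2) 0 1) in *.
    set (t2 := RInt (fun y => u 1 1 x0 y ^ 2) 0 1) in *.
    assert (0 <= t2) by (apply RInt_ge01; cc; [lra|apply pow2_ge_0]).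
    assert (t2 <= k * t2) by nra.
    assert (k * t1 <= k * (2 * C2)) by (apply Rmult_le_compat_l; lra).
    assert (F : k * t2 <= k * ((1 + 12 * k) * C2 + / (12 * k) * E 2 1)).
    { apply Rmult_le_compat_l; [lra|]. eapply Rle_trans; [exact T2|].
      apply Rplus_le_compat_r, Rmult_le_compat_l; lra. }
    replace (k * ((1 + 12 * k) * C2 + / (12 * k) * E 2 1)) with (k * (1 + 12 * k) * C2 + / 12 * E 2 1) in F by (field; lra).
    lra.
Qed.

Let C3 := const3 K M0.

Lemma C2_pos : 0 <= C2.
Proof.
  pose proof H2_bound. pose proof (E0 0 0). pose proof (E0 0 1). pose proof (E0 0 2).
  pose proof (E0 1 0). pose proof (E0 2 0). pose proof (E0 1 1). lra.
Qed.

(** [I2_jacobian] for u_x. As u_xx = 0 on the horizontal edges, their integrals and the corner terms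
    vanish, and only the vertical edges of [H3_edge] remain. *)
Lemma H3_bound : E 3 0 + E 1 2 + E 2 1 <= C3.
Proof.
  assert (J := I2_jacobian (u 2 0) (u 1 1) (u 3 0) (u 1 2) (u 2 1)
   ltac:(apply cu) ltac:(apply cu) ltac:(apply cu) ltac:(apply cu) ltac:(apply cu)
   ltac:(apply ux; lia) ltac:(apply uy; lia) ltac:(apply ux; lia) ltac:(apply uy; lia)).
  rewrite !(rs_y H 2) in J by (auto; lia).
  assert (Z : forall y0, y0 = 0 \/ y0 = 1 -> RInt (fun x => u 2 0 x y0 * u 2 1 x y0) 0 1 = 0).
  { intros y0 Hy. rewrite (RInt_ext _ (fun _ => 0)).
    - rewrite RInt_const1. eqR; ring.
    - intros x _. rewrite (rs_y H) by (auto; lia). eqR; ring. }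
  rewrite !Z in J by auto.
  assert (e0 := H3_edge 0 ltac:(auto)). assert (e1 := H3_edge 1 ltac:(auto)).
  apply Rabs_le_between in e0. apply Rabs_le_between in e1.
  rewrite I2_minus in J by cc.
  set (L := I2 (fun x y => (u 3 0 x y + u 1 2 x y) ^ 2)).
  assert (L1 : L = E 3 0 + E 1 2 + 2 * I2 (fun x y => u 3 0 x y * u 1 2 x y)).
  { unfold L. rewrite (I2_ext _ (fun x y => u 3 0 x y ^ 2 + u 1 2 x y ^ 2
      + 2 * (u 3 0 x y * u 1 2 x y))) by (intros; ring).
    lin. unfold E. lra. }
  assert (B := H2_bound).
  pose proof (E0 0 0). pose proof (E0 0 1). pose proof (E0 0 2). pose proof (E0 1 0). pose proof (E0 2 0). pose proof (E0 1 1).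
  assert (L2 : L <= k * (24 * C2 + 2)).
  { unfold L. eapply Rle_trans.
    - apply (I2_le _ (fun x y => 2 * (2 * (2 * (2 * (k * u 1 0 x y ^ 2) + 2 * (k * u 2 0 x y ^ 2))
          + 2 * (2 * (k * u 0 1 x y ^ 2) + 2 * (k * u 1 1 x y ^ 2)))
          + 2 * (2 * (k * u 0 0 x y ^ 2) + 2 * (k * u 1 0 x y ^ 2))) + 2 * (k * 1))); cc.
      rewrite (pde_x H) by auto. sqs.
    - lin. fold (E 1 0) (E 2 0) (E 0 1) (E 1 1) (E 0 0).
      assert (k * (16 * (E 1 0 + E 2 0 + E 0 1 + E 1 1) + 8 * (E 0 0 + E 1 0) + 2) <= k * (24 * C2 + 2))
        by (apply Rmult_le_compat_l; lra). lra. }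
  assert (C2p := C2_pos).
  unfold C3, const3. fold k C2. fold (E 2 1) in J.
  assert (k * C2 <= k ^ 2 * C2) by (apply Rmult_le_compat_r; auto).
  assert (kk' := kk).
  assert (E 3 0 + E 1 2 + E 2 1 <= k * (24 * C2 + 2) + 4 * (4 * k * C2 + 3 * k * (1 + 12 * k) * C2 + k)) by lra.
  nra.
Qed.

Lemma H4_edge x0 : x0 = 0 \/ x0 = 1 ->
  Rabs (RInt (fun y => u 2 2 x0 y * u 1 2 x0 y) 0 1)
    <= 24 * k * C2 + 8 * k * C3 + 5 * k * (1 + 56 * k) * C3 + 5 / 56 * E 2 2 + k.
Proof.
  intros Hx.
  assert (B := H2_bound). assert (B3 := H3_bound).
  pose proof (E0 0 0). pose proof (E0 0 1). pose proof (E0 0 2). pose proof (E0 1 0). pose proof (E0 2 0). pose proof (E0 1 1).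
  pose proof (E0 3 0). pose proof (E0 1 2). pose proof (E0 2 1).
  assert (T1 := edge_trace_x 1 0 x0 ltac:(lia) Hx 1 Rlt_0_1).
  assert (T2 := edge_trace_x 1 1 x0 ltac:(lia) Hx 1 Rlt_0_1). rewrite Rinv_1 in T1, T2.
  (* The number 56 is fitted to [H4_bound]: four edges with 5/56 each and four corners with 1/28
     each, doubled, amount to exactly one of the two copies of [E 2 2]. *)
  assert (Heta : 0 < / (56 * k)) by (apply Rinv_0_lt_compat; lra).
  assert (T3 := edge_trace_x 1 2 x0 ltac:(lia) Hx _ Heta). rewrite Rinv_inv in T3.
  apply Rle_trans with (RInt (fun y => / 2 * ((2 * (2 * (2 * (k * u 1 0 x0 y ^ 2) + 2 * (k * u 1 1 x0 y ^ 2))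
     + 2 * (2 * (k * u 1 1 x0 y ^ 2) + 2 * (k * u 1 2 x0 y ^ 2))) + 2 * (k * 1)) + u 1 2 x0 y ^ 2)) 0 1).
  - apply RInt_abs_bound; cc; try lra. apply abs_mul_le; [|lra].
    rewrite (x_edge_2 H) by (auto; lra).
    apply sq_sub; [|apply sq_abs, bS; lia].
    eapply Rle_trans; [apply sq_add; [apply sq_add | apply sq_add]; apply sq_mul; apply bP; lia|]. fold k. lra.
  - lin1.
    set (t1 := RInt (fun y => u 1 0 x0 y ^ 2) 0 1) in *.
    set (t2 := RInt (fun y => u 1 1 x0 y ^ 2) 0 1) in *.
    set (t3 := RInt (fun y => u 1 2 x0 y ^ 2) 0 1) in *.
    assert (0 <= t3) by (apply RInt_ge01; cc; [lra|apply pow2_ge_0]).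
    assert (t3 <= k * t3) by (clear -KK H9; nra).
    assert (k * t1 <= k * (2 * C2)) by (apply Rmult_le_compat_l; lra).
    assert (k * t2 <= k * (2 * C2 + C3)) by (apply Rmult_le_compat_l; lra).
    assert (F : k * t3 <= k * ((1 + 56 * k) * C3 + / (56 * k) * E 2 2)).
    { apply Rmult_le_compat_l; [lra|]. eapply Rle_trans; [exact T3|].
      apply Rplus_le_compat_r, Rmult_le_compat_l; lra. }
    replace (k * ((1 + 56 * k) * C3 + / (56 * k) * E 2 2)) with (k * (1 + 56 * k) * C3 + / 56 * E 2 2) in F by (field; lra).
    assert (0 <= C2) by apply C2_pos. assert (0 <= k * C2) by (apply Rmult_le_pos; lra).
    lra.
Qed.

(** At a corner u_x vanishes too, so the edge relation becomes u_xxy = P u_xy - S_y, and [sup_bound]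
    controls u_xy pointwise. *)
Lemma H4_corner x0 y0 : x0 = 0 \/ x0 = 1 -> y0 = 0 \/ y0 = 1 ->
  u 2 1 x0 y0 ^ 2 <= 2 * k * (1 + 56 * k) * (2 * C2 + C3) + / 28 * (2 * C3 + E 2 2) + 2 * k.
Proof.
  intros Hx Hy.
  assert (B := H2_bound). assert (B3 := H3_bound).
  pose proof (E0 0 0). pose proof (E0 0 1). pose proof (E0 0 2). pose proof (E0 1 0). pose proof (E0 2 0). pose proof (E0 1 1).
  pose proof (E0 3 0). pose proof (E0 1 2). pose proof (E0 2 1).
  assert (Heta : 0 < / (56 * k)) by (apply Rinv_0_lt_compat; lra).
  assert (T := sup_bound (u 1 1) (u 2 1) (u 1 2) (u 2 2) (/ (56 * k)) x0 y0
    (cu _ _) (cu _ _) (cu _ _) (cu _ _) (ux 1 1 ltac:(lia)) (uy 1 1 ltac:(lia)) (uy 2 1 ltac:(lia)) Heta ltac:(lra) ltac:(lra)).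
  fold (E 1 1) (E 1 2) (E 2 1) (E 2 2) in T. rewrite Rinv_inv in T.
  rewrite (x_edge_1 H) by (auto; lra).
  rewrite (rs_y H 1) by (auto; lia). rewrite Rmult_0_r, Rplus_0_l.
  eapply Rle_trans; [apply sq_sub; [apply sq_mul, bP; lia|apply sq_abs, bS; lia]|]. fold k.
  assert (F : k * u 1 1 x0 y0 ^ 2 <= k * ((1 + 56 * k) * (2 * C2 + C3) + / (56 * k) * (2 * C3 + E 2 2))).
  { apply Rmult_le_compat_l; [lra|]. eapply Rle_trans; [exact T|].
    apply Rplus_le_compat; apply Rmult_le_compat_l; lra. }
  replace (k * ((1 + 56 * k) * (2 * C2 + C3) + / (56 * k) * (2 * C3 + E 2 2))) with
     (k * (1 + 56 * k) * (2 * C2 + C3) + / 56 * (2 * C3 + E 2 2)) in F by (field; lra).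
  lra.
Qed.
End Reg.
Arguments H2_bound {K M0 u P Q R S}.
Arguments H3_bound {K M0 u P Q R S}.
Arguments H4_edge {K M0 u P Q R S}.
Arguments H4_corner {K M0 u P Q R S}.
Arguments C2_pos {K M0 u P Q R S}.

Section Reg.
Variables (K M0 : R) (u P Q R S : nat -> nat -> Rdefinitions.R -> Rdefinitions.R -> Rdefinitions.R).
Hypothesis (HK : 1 <= K) (H : regsol K M0 u P Q R S).

Let E i j := I2 (fun x y => u i j x y ^ 2).
Let k := K ^ 2.
Let cu i j : cont2 (u i j). Proof. apply (rs_u H). Qed.
Let ux i j : (i + j < 4)%nat -> pdx (u i j) (u (Datatypes.S i) j). Proof. apply (rs_u H). Qed.
Let uy i j : (i + j < 4)%nat -> pdy (u i j) (u i (Datatypes.S j)). Proof. apply (rs_u H). Qed.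
Let KK : 1 <= k. Proof. unfold k. nra. Qed.
Let kk : k <= k ^ 2. Proof. clear -KK. simpl. nra. Qed.
Let E0 i j : 0 <= E i j. Proof. apply I2_sq_ge0, cu. Qed.
Let bP i j x y : (i + j <= 2)%nat -> Rabs (P i j x y) <= K. Proof. apply (rs_bound H). Qed.
Let bQ i j x y : (i + j <= 2)%nat -> Rabs (Q i j x y) <= K. Proof. apply (rs_bound H). Qed.
Let bR i j x y : (i + j <= 2)%nat -> Rabs (R i j x y) <= K. Proof. apply (rs_bound H). Qed.
Let bS i j x y : (i + j <= 2)%nat -> Rabs (S i j x y) <= K. Proof. apply (rs_bound H). Qed.

Ltac cc := ct; try apply cu.
Ltac lin := repeat first [rewrite I2_plus by cc | rewrite I2_minus by cc | rewrite I2_scal by cc | rewrite I2_const].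
Ltac sqs := lazymatch goal with
  | |- (_ + _) ^ 2 <= _ => apply sq_add; sqs
  | |- (_ - _) ^ 2 <= _ => apply sq_sub; sqs
  | |- (_ * _) ^ 2 <= _ => apply sq_mul; sqs
  | |- (_ _ _ _ _) ^ 2 <= _ => apply sq_abs; sqs
  | |- Rabs _ <= _ => first [apply bP | apply bQ | apply bR | apply bS]; lia
  end.

Let C2 := const2 K M0.
Let C3 := const3 K M0.
Let C4 := const4 K M0.
(** A new section, because the bounds of the previous one are now needed for the transposed solution
    as well. *)
Let HT := regsol_transpose H.
Let ET i j : I2 (fun x y => famT u i j x y ^ 2) = E j i.
Proof. unfold famT. apply (I2_transpose (fun x y => u j i x y ^ 2)). cc. Qed.

Lemma H3_bound_T : E 0 3 + E 2 1 + E 1 2 <= C3.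
Proof. assert (B := H3_bound HK HT). cbv beta zeta in B. rewrite !ET in B. exact B. Qed.

(** [I2_jacobian] for u_xy. The horizontal edges are the vertical ones of the transposed solution,
    and a corner product u_xxy u_xyy is bounded by its two squares, one from each of the two
    solutions. *)
Lemma H4_bound : E 3 1 + E 1 3 + E 2 2 <= C4.
Proof.
  assert (B := H2_bound HK H). assert (B3 := H3_bound HK H).
  cbv beta zeta in B, B3. fold (E 0 0) (E 1 0) (E 0 1) (E 2 0) (E 1 1) (E 0 2) (E 3 0) (E 2 1) (E 1 2) C2 C3 in B, B3.
  assert (C2p := C2_pos HK H). fold C2 in C2p.
  pose proof (E0 0 0). pose proof (E0 0 1). pose proof (E0 0 2). pose proof (E0 1 0). pose proof (E0 2 0). pose proof (E0 1 1).
  pose proof (E0 3 0). pose proof (E0 1 2). pose proof (E0 2 1).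
  assert (J := I2_jacobian (u 2 1) (u 1 2) (u 3 1) (u 1 3) (u 2 2)
   (cu _ _) (cu _ _) (cu _ _) (cu _ _) (cu _ _)
   ltac:(apply ux; lia) ltac:(apply uy; lia) ltac:(apply ux; lia) ltac:(apply uy; lia)).
  set (ce := 24 * k * C2 + 8 * k * C3 + 5 * k * (1 + 56 * k) * C3 + 5 / 56 * E 2 2 + k).
  set (cc0 := 2 * k * (1 + 56 * k) * (2 * C2 + C3) + / 28 * (2 * C3 + E 2 2) + 2 * k).
  assert (X : forall x0, x0 = 0 \/ x0 = 1 -> - ce <= RInt (fun y => u 2 2 x0 y * u 1 2 x0 y) 0 1 <= ce).
  { intros x0 Hx. apply Rabs_le_between. exact (H4_edge HK H x0 Hx). }
  assert (Y : forall y0, y0 = 0 \/ y0 = 1 -> - ce <= RInt (fun x => u 2 1 x y0 * u 2 2 x y0) 0 1 <= ce).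
  { intros y0 Hy. apply Rabs_le_between.
    assert (F := H4_edge HK HT y0 Hy). cbv beta zeta in F. rewrite !ET in F. unfold famT in F.
    rewrite (RInt_ext _ (fun x => u 2 2 x y0 * u 2 1 x y0)); [exact F|].
    intros; apply Rmult_comm. }
  assert (Z : forall x0 y0, x0 = 0 \/ x0 = 1 -> y0 = 0 \/ y0 = 1 -> - cc0 <= u 2 1 x0 y0 * u 1 2 x0 y0 <= cc0).
  { intros x0 y0 Hx Hy. apply Rabs_le_between.
    assert (F1 := H4_corner HK H x0 y0 Hx Hy).
    assert (F2 := H4_corner HK HT y0 x0 Hy Hx). cbv beta zeta in F2. rewrite !ET in F2. unfold famT in F2.
    replace cc0 with (/ 2 * (cc0 + cc0)) by field. apply abs_mul_le; assumption. }
  assert (x0 := X 0 ltac:(auto)). assert (x1 := X 1 ltac:(auto)).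
  assert (y0 := Y 0 ltac:(auto)). assert (y1 := Y 1 ltac:(auto)).
  assert (z00 := Z 0 0 ltac:(auto) ltac:(auto)). assert (z01 := Z 0 1 ltac:(auto) ltac:(auto)).
  assert (z10 := Z 1 0 ltac:(auto) ltac:(auto)). assert (z11 := Z 1 1 ltac:(auto) ltac:(auto)).
  rewrite I2_minus in J by cc.
  set (L := I2 (fun x y => (u 3 1 x y + u 1 3 x y) ^ 2)).
  assert (L1 : L = E 3 1 + E 1 3 + 2 * I2 (fun x y => u 3 1 x y * u 1 3 x y)).
  { unfold L. rewrite (I2_ext _ (fun x y => u 3 1 x y ^ 2 + u 1 3 x y ^ 2
      + 2 * (u 3 1 x y * u 1 3 x y))) by (intros; ring).
    lin. unfold E. lra. }
  assert (L2 : L <= k * (80 * C2 + 32 * C3 + 2)).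
  { unfold L. eapply Rle_trans.
    - apply (I2_le _ (fun x y => 2 * (2 * (2 * (2 * (2 * (k * u 1 0 x y ^ 2) + 2 * (k * u 1 1 x y ^ 2))
          + 2 * (2 * (k * u 2 0 x y ^ 2) + 2 * (k * u 2 1 x y ^ 2)))
          + 2 * (2 * (2 * (k * u 0 1 x y ^ 2) + 2 * (k * u 0 2 x y ^ 2))
             + 2 * (2 * (k * u 1 1 x y ^ 2) + 2 * (k * u 1 2 x y ^ 2))))
          + 2 * (2 * (2 * (k * u 0 0 x y ^ 2) + 2 * (k * u 0 1 x y ^ 2))
          + 2 * (2 * (k * u 1 0 x y ^ 2) + 2 * (k * u 1 1 x y ^ 2)))) + 2 * (k * 1))); cc.
      rewrite (pde_xy H) by auto. sqs.
    - lin. fold (E 1 0) (E 2 0) (E 0 1) (E 1 1) (E 0 0) (E 0 2) (E 2 1) (E 1 2).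
      assert (k * (32 * (E 1 0 + E 1 1 + E 2 0 + E 2 1 + E 0 1 + E 0 2 + E 1 1 + E 1 2)
        + 16 * (E 0 0 + E 0 1 + E 1 0 + E 1 1) + 2) <= k * (80 * C2 + 32 * C3 + 2))
        by (apply Rmult_le_compat_l; lra). lra. }
  fold (E 2 2) in J.
  assert (G : E 3 1 + E 1 3 + 2 * E 2 2 <= k * (80 * C2 + 32 * C3 + 2) + 8 * cc0 + 8 * ce) by lra.
  unfold ce, cc0 in G. clear X Y Z x0 x1 y0 y1 z00 z01 z10 z11 J L1 L2 L ce cc0.
  assert (0 <= C3) by lra.
  assert (k * C2 <= k ^ 2 * C2) by (apply Rmult_le_compat_r; auto).
  assert (k * C3 <= k ^ 2 * C3) by (apply Rmult_le_compat_r; auto).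
  assert (C3 <= k * C3) by (clear -KK H9; nra).
  assert (0 <= k ^ 2 * C2) by (apply Rmult_le_pos; auto; lra).
  unfold C4, const4. fold k C2 C3. assert (kk' := kk). lra.
Qed.

(** Second derivatives are bounded pointwise because [sup_bound] asks, among the fourth derivatives,
    only for u_xxxy, u_xxyy and u_xyyy, which are those of [H4_bound]. *)
Lemma sup_D i j x y : (i + j <= 2)%nat -> 0 <= x <= 1 -> 0 <= y <= 1 -> (1 <= i + j)%nat ->
  u i j x y ^ 2 <= 6 * (C2 + C3 + C4).
Proof.
  intros Hij Hx Hy Hij'.
  assert (B := H2_bound HK H). assert (B3 := H3_bound HK H).
  cbv beta zeta in B, B3. fold (E 0 0) (E 1 0) (E 0 1) (E 2 0) (E 1 1) (E 0 2) (E 3 0) (E 2 1) (E 1 2) C2 C3 in B, B3.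
  assert (B3' := H3_bound_T). assert (B4 := H4_bound).
  pose proof (E0 0 0). pose proof (E0 0 1). pose proof (E0 0 2). pose proof (E0 1 0). pose proof (E0 2 0). pose proof (E0 1 1).
  pose proof (E0 3 0). pose proof (E0 1 2). pose proof (E0 2 1). pose proof (E0 0 3).
  pose proof (E0 3 1). pose proof (E0 1 3). pose proof (E0 2 2).
  assert (T := sup_bound (u i j) (u (Datatypes.S i) j) (u i (Datatypes.S j)) (u (Datatypes.S i) (Datatypes.S j)) 1 x y
    (cu _ _) (cu _ _) (cu _ _) (cu _ _) (ux i j ltac:(lia)) (uy i j ltac:(lia)) (uy (Datatypes.S i) j ltac:(lia)) Rlt_0_1 Hx Hy).
  rewrite Rinv_1 in T. eapply Rle_trans; [exact T|].
  fold (E i j) (E (Datatypes.S i) j) (E i (Datatypes.S j)) (E (Datatypes.S i) (Datatypes.S j)).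
  assert (((i = 1 /\ j = 0) \/ (i = 0 /\ j = 1) \/ (i = 2 /\ j = 0) \/ (i = 1 /\ j = 1) \/ (i = 0 /\ j = 2))%nat) as D by lia.
  destruct D as [[-> ->]|[[-> ->]|[[-> ->]|[[-> ->]|[-> ->]]]]]; lra.
Qed.
End Reg.
Arguments H3_bound_T {K M0 u P Q R S}.
Arguments H4_bound {K M0 u P Q R S}.
Arguments sup_D {K M0 u P Q R S}.

Lemma regsol_apriori (K M0 : R) : 1 <= K -> exists C, 0 <= C /\
  forall u P Q R S, regsol K M0 u P Q R S ->
  (forall i j x y, (i + j <= 2)%nat -> 0 <= x <= 1 -> 0 <= y <= 1 -> Rabs (u i j x y) <= C) /\
  (forall i j, (2 <= i + j <= 3 \/ i = 2 /\ j = 2)%nat -> I2 (fun x y => u i j x y ^ 2) <= C).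
Proof.
  intros HK.
  set (C := const2 K M0 + const3 K M0 + const4 K M0).
  assert (HC : 0 <= C).
  { assert (0 <= (K ^ 2) ^ 2) by (apply pow2_ge_0). pose proof (pow2_ge_0 M0).
    assert (0 <= const2 K M0) by (unfold const2; nra).
    assert (0 <= const3 K M0) by (unfold const3; nra).
    assert (0 <= const4 K M0) by (unfold const4; nra). unfold C; lra. }
  exists (6 * C + 1 + Rabs M0). split; [pose proof (Rabs_pos M0); lra|].
  intros u P Q R S H. assert (Hm := Rabs_pos M0). split.
  - intros i j x y Hij Hx Hy. destruct (Nat.eq_dec (i + j) 0) as [e|ne].
    + replace i with 0%nat by lia. replace j with 0%nat by lia.
      eapply Rle_trans; [apply (rs_sup H)|]. pose proof (RRle_abs M0). lra.
    + assert (T := sup_D HK H i j x y Hij Hx Hy ltac:(lia)). fold C in T.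
      rewrite <- pow2_abs in T. pose proof (Rabs_pos (u i j x y)). nra.
  - intros i j Hij.
    assert (B := H2_bound HK H). assert (B3 := H3_bound HK H).
    assert (B3' := H3_bound_T HK H). assert (B4 := H4_bound HK H).
    cbv beta zeta in B, B3, B3', B4.
    assert (E0 : forall i j, 0 <= I2 (fun x y => u i j x y ^ 2)) by (intros; apply I2_sq_ge0, (rs_u H)).
    pose proof (E0 0%nat 0%nat). pose proof (E0 0%nat 1%nat). pose proof (E0 0%nat 2%nat). pose proof (E0 1%nat 0%nat).
    pose proof (E0 2%nat 0%nat). pose proof (E0 1%nat 1%nat). pose proof (E0 3%nat 0%nat). pose proof (E0 1%nat 2%nat).
    pose proof (E0 2%nat 1%nat). pose proof (E0 0%nat 3%nat). pose proof (E0 3%nat 1%nat). pose proof (E0 1%nat 3%nat).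
    pose proof (E0 2%nat 2%nat). cbv beta in *.
    assert (0 <= const2 K M0) by lra. assert (0 <= const3 K M0) by lra. assert (0 <= const4 K M0) by lra.
    assert (((i = 2 /\ j = 0) \/ (i = 1 /\ j = 1) \/ (i = 0 /\ j = 2) \/ (i = 3 /\ j = 0) \/ (i = 2 /\ j = 1)
      \/ (i = 1 /\ j = 2) \/ (i = 0 /\ j = 3) \/ (i = 2 /\ j = 2))%nat) as D by lia.
    destruct D as [[-> ->]|[[-> ->]|[[-> ->]|[[-> ->]|[[-> ->]|[[-> ->]|[[-> ->]|[-> ->]]]]]]]]; unfold C; lra.
Qed.

(** * The fitting factor *)

Lemma nonneg_of_derive f f' r : 0 <= r -> f 0 = 0 -> (forall t, is_derive f t (f' t)) ->
  (forall t, 0 <= t <= r -> 0 <= f' t) -> 0 <= f r.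
Proof.
  intros Hr H0 Hd Hp.
  destruct (MVT_gen f 0 r f') as [c [Hc Hm]]; auto.
  - intros x _. apply derivable_continuous_pt. exists (f' x). apply is_derive_Reals, Hd.
  - rewrite Rmin_left, Rmax_right in Hc by lra. specialize (Hp c Hc).
    assert (0 <= f' c * (r - 0)) by (apply Rmult_le_pos; lra). lra.
Qed.

(** [sh] and [ch] are twice the hyperbolic sine and cosine of r/2. *)
Definition sh (r : R) : R := exp (r / 2) - exp (- r / 2).
Definition ch (r : R) : R := exp (r / 2) + exp (- r / 2).

Lemma is_derive_sh t : is_derive sh t (ch t / 2).
Proof. unfold sh, ch. auto_derive; auto. unfold Rdiv. field. Qed.
Lemma is_derive_ch t : is_derive ch t (sh t / 2).
Proof. unfold sh, ch. auto_derive; auto. unfold Rdiv. field. Qed.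
Lemma sh_0 : sh 0 = 0.
Proof. unfold sh. replace (- 0 / 2) with (0 / 2) by field. ring. Qed.
Lemma exp_half_inv r : exp (r / 2) * exp (- r / 2) = 1.
Proof. rewrite <- exp_plus. replace (r / 2 + - r / 2) with 0 by field. apply exp_0. Qed.
Lemma ch_ge_2 r : 2 <= ch r.
Proof.
  unfold ch. pose proof (exp_half_inv r). pose proof (exp_pos (r / 2)). pose proof (exp_pos (- r / 2)).
  pose proof (pow2_ge_0 (exp (r / 2) - exp (- r / 2))). nra.
Qed.
Lemma ch_sq r : ch r ^ 2 = sh r ^ 2 + 4.
Proof. unfold ch, sh. pose proof (exp_half_inv r). nra. Qed.

Lemma sh_ge r : 0 <= r -> r <= sh r.
Proof.
  intros Hr. enough (0 <= sh r - r) by lra.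
  apply (nonneg_of_derive (fun t => sh t - t) (fun t => ch t / 2 - 1)); auto.
  - rewrite sh_0; ring.
  - intros t. apply is_derive_minus1; [apply is_derive_sh|apply (@is_derive_id R_AbsRing)].
  - intros t _. pose proof (ch_ge_2 t). lra.
Qed.

(** Equivalent, for r > 0, to [0 <= th r]; it says tanh(r/2) <= r/2. *)
Lemma sh_le_ch r : 0 <= r -> 2 * sh r <= r * ch r.
Proof.
  intros Hr. enough (0 <= r * ch r - 2 * sh r) by lra.
  apply (nonneg_of_derive (fun t => t * ch t - 2 * sh t) (fun t => t * sh t / 2)); auto.
  - rewrite sh_0; ring.
  - intros t. apply is_derive_eq1 with (1 * ch t + t * (sh t / 2) - 2 * (ch t / 2)); [field|].
    apply is_derive_minus1; [apply (is_derive_mult1 (fun t => t)); [apply (@is_derive_id R_AbsRing)|apply is_derive_ch]|].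
    apply is_derive_scal1, is_derive_sh.
  - intros t [Ht _]. pose proof (sh_ge t Ht). nra.
Qed.

(** Equivalent, for r > 0, to [th r <= r / 4]. *)
Lemma ch_le_sh r : 0 <= r -> 2 * r * ch r <= 4 * sh r + r ^ 2 * sh r.
Proof.
  intros Hr. enough (0 <= 4 * sh r + r * r * sh r - 2 * (r * ch r)) by nra.
  apply (nonneg_of_derive (fun t => 4 * sh t + t * t * sh t - 2 * (t * ch t)) (fun t => t * sh t + t ^ 2 * ch t / 2)); auto.
  - rewrite sh_0; ring.
  - intros t. apply is_derive_eq1 with (4 * (ch t / 2) + ((1 * t + t * 1) * sh t + t * t * (ch t / 2)) - 2 * (1 * ch t + t * (sh t / 2))); [field|].
    apply is_derive_minus1; [apply is_derive_plus1|].
    + apply is_derive_scal1, is_derive_sh.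
    + apply (is_derive_mult1 (fun t => t * t)); [|apply is_derive_sh].
      apply (is_derive_mult1 (fun t => t) (fun t => t)); apply (@is_derive_id R_AbsRing).
    + apply is_derive_scal1, (is_derive_mult1 (fun t => t)); [apply (@is_derive_id R_AbsRing)|apply is_derive_ch].
  - intros t [Ht _]. pose proof (sh_ge t Ht). pose proof (ch_ge_2 t). nra.
Qed.

(* [sigma] is [1 + r/2] plus the even part [r * th r], which is quadratically small. *)
Definition th (r : R) : R := ch r / (2 * sh r) - / r.

Lemma exp_neg_ratio r : 0 < r -> 1 - exp (- r) <> 0 /\ 0 < sh r /\ / (1 - exp (- r)) = exp (r / 2) / sh r.
Proof.
  intros Hr. assert (Hs := sh_ge r (Rlt_le _ _ Hr)).
  assert (E : exp (r / 2) * (1 - exp (- r)) = sh r).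
  { unfold sh. rewrite Rmult_minus_distr_l, <- exp_plus, Rmult_1_r. do 2 f_equal. field. }
  assert (N : 1 - exp (- r) <> 0) by (intros N; rewrite N, Rmult_0_r in E; lra).
  repeat split; auto; [lra|]. rewrite <- E. field. split; auto.
  pose proof (exp_pos (r / 2)); lra.
Qed.

Lemma sigma_pos r : 0 < r -> Defs.sigma r = 1 + r / 2 + r * th r.
Proof.
  intros Hr. destruct (exp_neg_ratio r Hr) as (N & Hs & E).
  unfold Defs.sigma, Rdiv at 1. rewrite E. unfold th, ch. 
  replace (exp (r / 2)) with (exp (- r / 2) + sh r) by (unfold sh; ring). field. lra.
Qed.

Lemma sigma_neg r : 0 < r -> Defs.sigma (- r) = 1 - r / 2 + r * th r.
Proof.
  intros Hr. destruct (exp_neg_ratio r Hr) as (N & Hs & E).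
  assert (F : Defs.sigma (- r) = Defs.sigma r - r).
  { unfold Defs.sigma. rewrite Ropp_involutive.
    replace (exp r) with (/ exp (- r)) by (rewrite exp_Ropp, Rinv_inv; reflexivity).
    pose proof (exp_pos (- r)). field. repeat split; auto; try lra. }
  rewrite F, sigma_pos by auto. lra.
Qed.

(** The bound r/4 yields powers of h, while 1/2 keeps the weights 1/2 + th and 1/2 - th between 0
    and 1 for every mesh size. *)
Lemma th_bounds r : 0 < r -> 0 <= th r <= r / 4 /\ th r <= / 2.
Proof.
  intros Hr. destruct (exp_neg_ratio r Hr) as (N & Hs & E).
  assert (A := sh_le_ch r (Rlt_le _ _ Hr)). assert (B := ch_le_sh r (Rlt_le _ _ Hr)).
  assert (D : th r = (r * ch r - 2 * sh r) / (2 * r * sh r)) by (unfold th; field; lra).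
  assert (Hp : 0 < 2 * r * sh r) by nra.
  split; [split|].
  - rewrite D. apply Rmult_le_pos; [lra|left; now apply Rinv_0_lt_compat].
  - rewrite D. apply Rmult_le_reg_r with (2 * r * sh r); auto.
    unfold Rdiv. rewrite Rmult_assoc, Rinv_l by lra. nra.
  - rewrite D. apply Rmult_le_reg_r with (2 * r * sh r); auto.
    unfold Rdiv. rewrite Rmult_assoc, Rinv_l by lra.
    assert (r * (ch r - sh r) <= 2 * sh r); [|lra].
    replace (ch r - sh r) with (2 * exp (- r / 2)) by (unfold ch, sh; ring).
    assert (G : r * exp (- r / 2) <= sh r); [|lra].
    assert (G1 : exp (- r / 2) <= 1).
    { rewrite <- exp_0. left; apply exp_increasing; lra. }
    pose proof (sh_ge r (Rlt_le _ _ Hr)). pose proof (exp_pos (- r / 2)). nra.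
Qed.

(** The derivative of [th] is 1/t^2 - 1/sh(t)^2, which lies between 0 and 1/4 by [sh_ge] and
    [sh_le_ch]. It makes the difference of [th] on two adjacent edges of second order in h. *)
Lemma th_lipschitz r s : 0 < r -> 0 < s -> Rabs (th r - th s) <= Rabs (r - s) / 4.
Proof.
  intros Hr Hs.
  set (df := fun t => (sh t / 2 * (2 * sh t) - ch t * (2 * (ch t / 2))) / (2 * sh t) ^ 2 - - (1) / t ^ 2).
  assert (Hd : forall t, 0 < t -> is_derive th t (df t)).
  { intros t Ht. destruct (exp_neg_ratio t Ht) as (_ & Hsh & _).
    unfold th, df. apply is_derive_minus1.
    - apply (is_derive_div ch (fun t => 2 * sh t)); [apply is_derive_ch| |lra].
      apply is_derive_scal1, is_derive_sh.
    - apply (is_derive_inv (fun t => t)); [apply (@is_derive_id R_AbsRing)|lra]. }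
  assert (Hb : forall t, 0 < t -> Rabs (df t) <= / 4).
  { intros t Ht. destruct (exp_neg_ratio t Ht) as (_ & Hsh & _).
    assert (E : df t = / t ^ 2 - / sh t ^ 2).
    { unfold df.
      replace (sh t / 2 * (2 * sh t) - ch t * (2 * (ch t / 2))) with (sh t ^ 2 - ch t ^ 2) by field.
      rewrite ch_sq. field. split; lra. }
    assert (A := sh_le_ch t (Rlt_le _ _ Ht)). assert (B := sh_ge t (Rlt_le _ _ Ht)).
    assert (C := ch_sq t). assert (C' := ch_ge_2 t).
    rewrite E. apply Rabs_le. split.
    - assert (/ sh t ^ 2 <= / t ^ 2); [|lra]. apply Rinv_le_contravar; nra.
    - assert (F : (2 * sh t) ^ 2 <= (t * ch t) ^ 2) by (apply pow_incr; lra).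
      apply Rmult_le_reg_r with (t ^ 2 * sh t ^ 2); [apply Rmult_lt_0_compat; nra|].
      replace ((/ t ^ 2 - / sh t ^ 2) * (t ^ 2 * sh t ^ 2)) with (sh t ^ 2 - t ^ 2) by (field; lra).
      replace ((t * ch t) ^ 2) with (t ^ 2 * (sh t ^ 2 + 4)) in F by (rewrite <- C; ring). lra. }
  destruct (MVT_gen th s r df) as [c [Hc Hm]].
  - intros x Hx. apply Hd. eapply Rlt_trans; [|apply Hx]. now apply Rmin_glb_lt.
  - intros x Hx. apply derivable_continuous_pt. exists (df x). apply is_derive_Reals, Hd.
    eapply Rlt_le_trans; [|apply Hx]. now apply Rmin_glb_lt.
  - rewrite Hm, Rabs_mult. specialize (Hb c).
    assert (0 < c) by (eapply Rlt_le_trans; [|apply Hc]; now apply Rmin_glb_lt).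
    pose proof (Rabs_pos (r - s)). specialize (Hb H). nra.
Qed.

(** By the next two lemmas the three schemes differ only in this factor in front of [th], so they
    can be treated together. *)
Definition scheme_sign (s : scheme) : R := match s with S1 => 1 | S2 => -1 | S3 => 0 end.

Lemma Qminus_th s h r : 0 < r -> Qminus s h r = h * (/ 2 + scheme_sign s * th r).
Proof.
  intros Hr. destruct s; simpl; rewrite ?sigma_pos, ?sigma_neg by auto; field; lra.
Qed.
Lemma Qplus_th s h r : 0 < r -> Qplus s h r = h * (/ 2 - scheme_sign s * th r).
Proof.
  intros Hr. destruct s; simpl; rewrite ?sigma_pos, ?sigma_neg by auto; field; lra.
Qed.

(** * Discrete energy estimate and maximum principle *)

Fixpoint fsum (f : nat -> R) (n : nat) : R :=
  match n with O => 0 | S m => fsum f m + f m end.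

Lemma fsum_ext f g n : (forall k, (k < n)%nat -> f k = g k) -> fsum f n = fsum g n.
Proof. induction n; simpl; intros H; auto. rewrite IHn, H; auto. Qed.
Lemma fsum_plus f g n : fsum (fun k => f k + g k) n = fsum f n + fsum g n.
Proof. induction n; simpl; [ring|]. rewrite IHn; ring. Qed.
Lemma fsum_scal c f n : fsum (fun k => c * f k) n = c * fsum f n.
Proof. induction n; simpl; [ring|]. rewrite IHn; ring. Qed.
Lemma fsum_const c n : fsum (fun _ => c) n = INR n * c.
Proof. induction n; [simpl; ring|]. rewrite S_INR. simpl. rewrite IHn. ring. Qed.
Lemma fsum_le f g n : (forall k, (k < n)%nat -> f k <= g k) -> fsum f n <= fsum g n.
Proof. induction n; simpl; intros H; [lra|]. apply Rplus_le_compat; auto. Qed.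
Lemma fsum_ge0 f n : (forall k, (k < n)%nat -> 0 <= f k) -> 0 <= fsum f n.
Proof.
  intros H. replace 0 with (fsum (fun _ => 0) n) by (rewrite fsum_const; ring). now apply fsum_le.
Qed.
Lemma fsum_shift f n : fsum f (S n) = f 0%nat + fsum (fun k => f (S k)) n.
Proof. induction n; [simpl; ring|]. change (fsum f (S (S n))) with (fsum f (S n) + f (S n)). rewrite IHn. simpl. ring. Qed.
Lemma fsum_swap f n m : fsum (fun k => fsum (fun l => f k l) m) n = fsum (fun l => fsum (fun k => f k l) n) m.
Proof.
  induction n; simpl.
  - rewrite fsum_const. ring.
  - rewrite IHn, <- fsum_plus. now apply fsum_ext.
Qed.
Lemma fsum_mono_n f n m : (forall k, 0 <= f k) -> (n <= m)%nat -> fsum f n <= fsum f m.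
Proof. intros H Hle. induction Hle; simpl; [lra|]. specialize (H m). lra. Qed.
Lemma fsum_telescope a n : fsum (fun k => a (S k) - a k) n = a n - a 0%nat.
Proof. induction n; simpl; [ring|]. rewrite IHn; ring. Qed.
Lemma fsum_sq_le f n : fsum f n ^ 2 <= INR n * fsum (fun k => f k ^ 2) n.
Proof.
  induction n; [simpl; lra|]. rewrite S_INR.
  change (fsum f (S n)) with (fsum f n + f n).
  change (fsum (fun k => f k ^ 2) (S n)) with (fsum (fun k => f k ^ 2) n + f n ^ 2).
  set (s := fsum f n) in *. set (q := fsum (fun k => f k ^ 2) n) in *.
  destruct n as [|n'].
  - unfold s, q in *. simpl in *. nra.
  - assert (0 < INR (S n')) by (apply lt_0_INR; lia).
    set (m := INR (S n')) in *.
    assert (2 * s * f (S n') <= q + m * f (S n') ^ 2); [|lra].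
    apply Rmult_le_reg_l with m; auto.
    pose proof (pow2_ge_0 (s - m * f (S n'))). nra.
Qed.

Lemma summation_by_parts a b n : b 0%nat = 0 -> b (S n) = 0 ->
  fsum (fun k => (a (S (S k)) - 2 * a (S k) + a k) * b (S k)) n =
  - fsum (fun k => (a (S k) - a k) * (b (S k) - b k)) (S n).
Proof.
  intros H0 H1.
  assert (G : forall n, fsum (fun k => (a (S (S k)) - 2 * a (S k) + a k) * b (S k)) n
     + fsum (fun k => (a (S k) - a k) * (b (S k) - b k)) (S n) =
     (a (S n) - a n) * b (S n) - (a 1%nat - a 0%nat) * b 0%nat).
  { clear. induction n; [simpl; ring|]. simpl fsum in *.
    set (s := fsum (fun k => (a (S (S k)) - 2 * a (S k) + a k) * b (S k)) n) in *.
    set (t := fsum (fun k => (a (S k) - a k) * (b (S k) - b k)) n) in *. lra. }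
  specialize (G n). rewrite H0, H1 in G. lra.
Qed.

Definition fsum2 (f : nat -> nat -> R) (n m : nat) : R := fsum (fun k => fsum (fun l => f k l) m) n.

Lemma fsum2_ext f g n m : (forall k l, (k < n)%nat -> (l < m)%nat -> f k l = g k l) -> fsum2 f n m = fsum2 g n m.
Proof. intros H. apply fsum_ext; intros; apply fsum_ext; auto. Qed.
Lemma fsum2_le f g n m : (forall k l, (k < n)%nat -> (l < m)%nat -> f k l <= g k l) -> fsum2 f n m <= fsum2 g n m.
Proof. intros H. apply fsum_le; intros; apply fsum_le; auto. Qed.
Lemma fsum2_plus f g n m : fsum2 (fun k l => f k l + g k l) n m = fsum2 f n m + fsum2 g n m.
Proof. unfold fsum2. rewrite <- fsum_plus. apply fsum_ext; intros; apply fsum_plus. Qed.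
Lemma fsum2_scal c f n m : fsum2 (fun k l => c * f k l) n m = c * fsum2 f n m.
Proof. unfold fsum2. rewrite <- fsum_scal. apply fsum_ext; intros; apply fsum_scal. Qed.
Lemma fsum2_const c n m : fsum2 (fun _ _ => c) n m = INR n * INR m * c.
Proof. unfold fsum2. rewrite fsum_const, fsum_const. ring. Qed.
Lemma fsum2_swap f n m : fsum2 f n m = fsum2 (fun l k => f k l) m n.
Proof. apply fsum_swap. Qed.
Lemma fsum2_ge0 f n m : (forall k l, 0 <= f k l) -> 0 <= fsum2 f n m.
Proof. intros H. apply fsum_ge0; intros; apply fsum_ge0; auto. Qed.

(** [n] counts the interior nodes of a grid line, so N = S n. The free index is not bounded by S n;
    for this reason the final proof cuts the error off outside the grid. *)
Definition grid_zero (n : nat) (z : nat -> nat -> R) : Prop :=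
  forall i j, (i = 0 \/ i = S n \/ j = 0 \/ j = S n)%nat -> z i j = 0.

(** Differences are not divided by powers of h. In [X2] and [Y2] the indices k, l stand for the
    interior node (k+1, l+1). *)
Definition X2 (z : nat -> nat -> R) k l := z (S (S k)) (S l) - 2 * z (S k) (S l) + z k (S l).
Definition Y2 (z : nat -> nat -> R) k l := z (S k) (S (S l)) - 2 * z (S k) (S l) + z (S k) l.
Definition DX (z : nat -> nat -> R) k l := z (S k) (S l) - z k (S l).
Definition DY (z : nat -> nat -> R) k l := z (S k) (S l) - z (S k) l.
Definition DXY (z : nat -> nat -> R) k l := z (S k) (S l) - z k (S l) - z (S k) l + z k l.

Definition GX z n := fsum2 (fun k l => DX z k l ^ 2) (S n) n.
Definition GY z n := fsum2 (fun k l => DY z k l ^ 2) n (S n).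

(** Discrete counterpart of the equality of the integrals of z_xx z_yy and z_xy^2: summation by
    parts in x and then in y, without boundary terms because z vanishes there. *)
Lemma sum_X2_Y2 z n : grid_zero n z ->
  fsum2 (fun k l => X2 z k l * Y2 z k l) n n = fsum2 (fun k l => DXY z k l ^ 2) (S n) (S n).
Proof.
  intros Hz. rewrite fsum2_swap. unfold fsum2.
  rewrite (fsum_ext _ (fun l => - fsum (fun k => DX z k l * (DX z k (S l) - 2 * DX z k l + (z (S k) l - z k l))) (S n))).
  - rewrite (fsum_ext _ (fun l => (-1) * fsum (fun k => DX z k l * (DX z k (S l) - 2 * DX z k l + (z (S k) l - z k l))) (S n)))
      by (intros; ring).
    rewrite fsum_scal, fsum_swap, <- fsum_scal. apply fsum_ext. intros k Hk.
    assert (Q := summation_by_parts (fun m => z (S k) m - z k m) (fun m => z (S k) m - z k m) n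
      ltac:(cbv beta; rewrite !Hz by auto; ring) ltac:(cbv beta; rewrite !Hz by auto; ring)).
    cbv beta in Q.
    rewrite (fsum_ext _ (fun l => (z (S k) (S (S l)) - z k (S (S l)) - 2 * (z (S k) (S l) - z k (S l))
      + (z (S k) l - z k l)) * (z (S k) (S l) - z k (S l)))) by (intros; unfold DX; ring).
    rewrite Q, (fsum_ext (fun l => DXY z k l ^ 2) (fun l => (z (S k) (S l) - z k (S l) - (z (S k) l - z k l)) *
        (z (S k) (S l) - z k (S l) - (z (S k) l - z k l)))) by (intros; unfold DXY; ring).
    ring.
  - intros l Hl.
    assert (Q := summation_by_parts (fun i => z i (S l)) (fun i => z i (S (S l)) - 2 * z i (S l) + z i l) n
      ltac:(cbv beta; rewrite !Hz by auto; ring) ltac:(cbv beta; rewrite !Hz by auto; ring)).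
    cbv beta in Q. unfold X2, Y2. rewrite Q.
    f_equal. apply fsum_ext. intros; unfold DX. ring.
Qed.

Lemma sum_z_X2 z n : grid_zero n z -> fsum2 (fun k l => z (S k) (S l) * X2 z k l) n n = - GX z n.
Proof.
  intros Hz. unfold GX. rewrite fsum2_swap, (fsum2_swap _ (S n)). unfold fsum2.
  replace (- fsum (fun l => fsum (fun k => DX z k l ^ 2) (S n)) n)
    with ((-1) * fsum (fun l => fsum (fun k => DX z k l ^ 2) (S n)) n) by ring.
  rewrite <- fsum_scal. apply fsum_ext. intros l Hl.
  assert (Q := summation_by_parts (fun i => z i (S l)) (fun i => z i (S l)) n
      ltac:(apply Hz; auto) ltac:(apply Hz; auto)).
  cbv beta in Q.
  rewrite (fsum_ext _ (fun k => (z (S (S k)) (S l) - 2 * z (S k) (S l) + z k (S l)) * z (S k) (S l)))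
    by (intros; unfold X2; ring).
  rewrite Q.
  replace (-1 * fsum (fun k => DX z k l ^ 2) (S n)) with (- fsum (fun k => DX z k l ^ 2) (S n)) by ring.
  f_equal. apply fsum_ext. intros; unfold DX. ring.
Qed.

Definition gridT (z : nat -> nat -> R) : nat -> nat -> R := fun i j => z j i.
Lemma grid_zero_T n z : grid_zero n z -> grid_zero n (gridT z).
Proof. intros H i j Hij. apply H. tauto. Qed.

Lemma sum_z_Y2 z n : grid_zero n z -> fsum2 (fun k l => z (S k) (S l) * Y2 z k l) n n = - GY z n.
Proof.
  intros Hz. pose proof (sum_z_X2 (gridT z) n (grid_zero_T n z Hz)) as E.
  rewrite fsum2_swap. unfold GX in E. rewrite (fsum2_swap _ (S n)) in E. exact E.
Qed.

Lemma poincare z n : grid_zero n z ->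
  fsum2 (fun k l => z (S k) (S l) ^ 2) n n <= INR (S n) ^ 2 * GX z n.
Proof.
  intros Hz. unfold GX. rewrite fsum2_swap, (fsum2_swap _ (S n)). unfold fsum2. rewrite <- fsum_scal.
  apply fsum_le. intros l Hl.
  assert (HN : 0 <= INR (S n)) by apply pos_INR.
  assert (Hp : 0 <= fsum (fun k => DX z k l ^ 2) (S n)) by (apply fsum_ge0; intros; apply pow2_ge_0).
  apply Rle_trans with (fsum (fun _ => INR (S n) * fsum (fun k => DX z k l ^ 2) (S n)) n).
  - apply fsum_le. intros k Hk.
    replace (z (S k) (S l)) with (fsum (fun m => DX z m l) (S k)).
    + eapply Rle_trans; [apply fsum_sq_le|]. apply Rmult_le_compat.
      * apply pos_INR.
      * apply fsum_ge0; intros; apply pow2_ge_0.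
      * apply le_INR; lia.
      * apply fsum_mono_n; [intros; apply pow2_ge_0|lia].
    + unfold DX. rewrite (fsum_telescope (fun i => z i (S l))), (Hz 0%nat) by auto. ring.
  - rewrite fsum_const. assert (INR n <= INR (S n)) by (apply le_INR; lia).
    assert (0 <= INR (S n) * fsum (fun k => DX z k l ^ 2) (S n)) by (apply Rmult_le_pos; auto). nra.
Qed.

(** z is the double sum, from the corner, of its mixed differences; Cauchy-Schwarz is applied in
    each variable. In this way a discrete H2 bound becomes a maximum bound. *)
Lemma sup_le_DXY z n i j : grid_zero n z -> (i <= S n)%nat -> (j <= S n)%nat ->
  z i j ^ 2 <= INR (S n) ^ 2 * fsum2 (fun k l => DXY z k l ^ 2) (S n) (S n).
Proof.
  intros Hz Hi Hj.
  assert (E : z i j = fsum (fun k => fsum (fun l => DXY z k l) j) i).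
  { rewrite (fsum_ext _ (fun k => z (S k) j - z k j)).
    - rewrite (fsum_telescope (fun m => z m j)), (Hz 0%nat) by auto. ring.
    - intros k _. rewrite (fsum_ext _ (fun l => z (S k) (S l) - z k (S l) - (z (S k) l - z k l))) by (intros; unfold DXY; ring).
      rewrite (fsum_telescope (fun m => z (S k) m - z k m)), (Hz (S k) 0%nat), (Hz k 0%nat) by auto. ring. }
  assert (HN : 0 <= INR (S n)) by apply pos_INR.
  assert (P : forall k j, 0 <= fsum (fun l => DXY z k l ^ 2) j) by (intros; apply fsum_ge0; intros; apply pow2_ge_0).
  rewrite E. eapply Rle_trans; [apply fsum_sq_le|].
  apply Rle_trans with (INR (S n) * fsum (fun k => INR (S n) * fsum (fun l => DXY z k l ^ 2) (S n)) (S n)).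
  - apply Rmult_le_compat; [apply pos_INR|apply fsum_ge0; intros; apply pow2_ge_0|apply le_INR; lia|].
    eapply Rle_trans; [|apply fsum_mono_n; [|exact Hi]; intros; apply Rmult_le_pos; auto].
    apply fsum_le. intros k Hk. eapply Rle_trans; [apply fsum_sq_le|].
    apply Rmult_le_compat; [apply pos_INR|auto|apply le_INR; lia|].
    apply fsum_mono_n; auto. intros; apply pow2_ge_0.
  - rewrite fsum_scal. unfold fsum2. right. ring.
Qed.

(** * Five-point stencils, maximum principle and stability *)

Record stencil := { cW : nat -> nat -> R; cE : nat -> nat -> R; cS : nat -> nat -> R; cN : nat -> nat -> R; c0 : nat -> nat -> R }.

(* Evaluated at the interior node [(k+1, l+1)]. *)
Definition apply_stencil (A : stencil) (z : nat -> nat -> R) (k l : nat) : R :=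
  cW A k l * (z (S k) (S l) - z k (S l)) + cE A k l * (z (S k) (S l) - z (S (S k)) (S l))
  + cS A k l * (z (S k) (S l) - z (S k) l) + cN A k l * (z (S k) (S l) - z (S k) (S (S l)))
  + c0 A k l * z (S k) (S l).

(** [apply_stencil] is written with differences from the centre, so nonnegative coefficients already
    mean nonpositive off-diagonal entries and weak diagonal dominance. *)
Definition monotone_stencil (A : stencil) (n : nat) : Prop :=
  forall k l, (k < n)%nat -> (l < n)%nat ->
    0 <= cW A k l /\ 0 <= cE A k l /\ 0 <= cS A k l /\ 0 <= cN A k l /\ 0 <= c0 A k l.

Lemma finite_max f n : exists m, (m <= n)%nat /\ forall k, (k <= n)%nat -> f k <= f m.
Proof.
  induction n as [|n [m [Hm IH]]].
  - exists 0%nat. split; auto. intros k Hk. replace k with 0%nat by lia. lra.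
  - destruct (Rle_dec (f m) (f (S n))).
    + exists (S n). split; auto. intros k Hk. destruct (Nat.eq_dec k (S n)) as [->|]; [lra|].
      specialize (IH k ltac:(lia)). lra.
    + exists m. split; [lia|]. intros k Hk. destruct (Nat.eq_dec k (S n)) as [->|]; [lra|].
      apply IH. lia.
Qed.

Lemma grid_max (f : nat -> nat -> R) n : exists i j, (i <= n)%nat /\ (j <= n)%nat /\
  forall k l, (k <= n)%nat -> (l <= n)%nat -> f k l <= f i j.
Proof.
  assert (H : forall k, exists m, (m <= n)%nat /\ forall l, (l <= n)%nat -> f k l <= f k m)
    by (intros; apply finite_max).
  (* The maximisers of the rows are collected in a function by induction on the number of rows,
     without an axiom of choice. *)
  assert (G : exists g, forall k, (k <= n)%nat -> (g k <= n)%nat /\ forall l, (l <= n)%nat -> f k l <= f k (g k)).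
  { clear -H. assert (G : forall p, exists g, forall k, (k <= p)%nat -> (g k <= n)%nat /\ forall l, (l <= n)%nat -> f k l <= f k (g k)).
    { induction p as [|p [g Hg]].
      - destruct (H 0%nat) as [m Hm]. exists (fun _ => m). intros k Hk. replace k with 0%nat by lia. exact Hm.
      - destruct (H (S p)) as [m Hm]. exists (fun k => if Nat.eq_dec k (S p) then m else g k).
        intros k Hk. destruct (Nat.eq_dec k (S p)) as [->|]; [exact Hm|]. apply Hg. lia. }
    apply G. }
  destruct G as [g Hg].
  destruct (finite_max (fun k => f k (g k)) n) as [m [Hm Hmax]].
  exists m, (g m). destruct (Hg m Hm) as [Hgm _]. repeat split; auto.
  intros k l Hk Hl. eapply Rle_trans; [now apply (Hg k Hk)|]. now apply Hmax.
Qed.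

(** With a strict sign no connectedness argument is needed: at a positive interior maximum every
    term of the stencil is nonnegative. *)
Lemma discrete_max_principle A n v : monotone_stencil A n ->
  (forall i j, (i <= S n)%nat -> (j <= S n)%nat -> (i = 0 \/ i = S n \/ j = 0 \/ j = S n)%nat -> v i j <= 0) ->
  (forall k l, (k < n)%nat -> (l < n)%nat -> apply_stencil A v k l < 0) ->
  forall i j, (i <= S n)%nat -> (j <= S n)%nat -> v i j <= 0.
Proof.
  intros HA Hb Hv.
  destruct (grid_max v (S n)) as (a & b & Ha & Hb' & Hmax).
  assert (M : v a b <= 0).
  { destruct (Rle_dec (v a b) 0) as [|np]; auto.
    destruct (Nat.eq_dec a 0); [now apply Hb; auto|]. destruct (Nat.eq_dec a (S n)); [now apply Hb; auto|].
    destruct (Nat.eq_dec b 0); [now apply Hb; auto|]. destruct (Nat.eq_dec b (S n)); [now apply Hb; auto|].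
    exfalso. destruct a as [|k]; [lia|]. destruct b as [|l]; [lia|].
    specialize (Hv k l ltac:(lia) ltac:(lia)). destruct (HA k l ltac:(lia) ltac:(lia)) as (H1 & H2 & H3 & H4 & H5).
    unfold apply_stencil in Hv.
    assert (0 <= cW A k l * (v (S k) (S l) - v k (S l))) by (apply Rmult_le_pos; auto; specialize (Hmax k (S l) ltac:(lia) ltac:(lia)); lra).
    assert (0 <= cE A k l * (v (S k) (S l) - v (S (S k)) (S l))) by (apply Rmult_le_pos; auto; specialize (Hmax (S (S k)) (S l) ltac:(lia) ltac:(lia)); lra).
    assert (0 <= cS A k l * (v (S k) (S l) - v (S k) l)) by (apply Rmult_le_pos; auto; specialize (Hmax (S k) l ltac:(lia) ltac:(lia)); lra).
    assert (0 <= cN A k l * (v (S k) (S l) - v (S k) (S (S l)))) by (apply Rmult_le_pos; auto; specialize (Hmax (S k) (S (S l)) ltac:(lia) ltac:(lia)); lra).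
    assert (0 <= c0 A k l * v (S k) (S l)) by (apply Rmult_le_pos; auto; lra). lra. }
  intros i j Hi Hj. specialize (Hmax i j Hi Hj). lra.
Qed.

Lemma apply_stencil_lin A a b z w k l :
  apply_stencil A (fun i j => a * z i j + b * w i j) k l = a * apply_stencil A z k l + b * apply_stencil A w k l.
Proof. unfold apply_stencil. ring. Qed.

(** Applied to r - M X and - r - M X; the strict inequality [c < M * kappa] supplies the strict
    sign. *)
Lemma max_principle_barrier A n kappa c M r (X : nat -> nat -> R) : monotone_stencil A n ->
  (forall i j, (i <= S n)%nat -> (j <= S n)%nat -> 0 <= X i j <= 1) ->
  (forall k l, (k < n)%nat -> (l < n)%nat -> kappa <= apply_stencil A X k l) ->
  0 < kappa -> 0 <= c -> c < M * kappa -> grid_zero n r ->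
  (forall k l, (k < n)%nat -> (l < n)%nat -> Rabs (apply_stencil A r k l) <= c) ->
  forall i j, (i <= S n)%nat -> (j <= S n)%nat -> Rabs (r i j) <= M.
Proof.
  intros HA HX HAX Hk Hc HM Hr Hres.
  assert (HM0 : 0 < M) by nra.
  assert (G : forall s, s = 1 \/ s = -1 -> forall i j, (i <= S n)%nat -> (j <= S n)%nat -> s * r i j + - M * X i j <= 0).
  { intros s Hs. apply (discrete_max_principle A n (fun i j => s * r i j + - M * X i j) HA).
    - intros i j Hi Hj Hij. rewrite (Hr i j Hij). destruct (HX i j Hi Hj). nra.
    - intros k l Hkn Hln. rewrite apply_stencil_lin.
      specialize (HAX k l Hkn Hln). specialize (Hres k l Hkn Hln). apply Rabs_le_between in Hres.
      assert (M * kappa <= M * apply_stencil A X k l) by (apply Rmult_le_compat_l; lra).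
      destruct Hs as [-> | ->]; lra. }
  intros i j Hi Hj. destruct (HX i j Hi Hj).
  assert (G1 := G 1 ltac:(auto) i j Hi Hj). assert (G2 := G (-1) ltac:(auto) i j Hi Hj).
  assert (M * X i j <= M * 1) by (apply Rmult_le_compat_l; lra).
  apply Rabs_le. lra.
Qed.

Definition mask (n : nat) (r : nat -> nat -> R) (i j : nat) : R :=
  match i, j with S k, S l => if (Nat.ltb k n && Nat.ltb l n)%bool then r k l else 0 | _, _ => 0 end.

Lemma mask_zero n r : grid_zero n (mask n r).
Proof.
  intros i j H. unfold mask. destruct i as [|k]; auto. destruct j as [|l]; auto.
  destruct (Nat.ltb_spec k n); destruct (Nat.ltb_spec l n); simpl; auto. lia.
Qed.
Lemma mask_in n r k l : (k < n)%nat -> (l < n)%nat -> mask n r (S k) (S l) = r k l.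
Proof.
  intros Hk Hl. unfold mask. apply Nat.ltb_lt in Hk. apply Nat.ltb_lt in Hl. now rewrite Hk, Hl.
Qed.
Lemma mask_bound n r m : 0 <= m -> (forall k l, (k < n)%nat -> (l < n)%nat -> Rabs (r k l) <= m) ->
  forall i j, Rabs (mask n r i j) <= m.
Proof.
  intros Hm H i j. unfold mask. destruct i as [|k]; [rewrite Rabs_R0; auto|]. destruct j as [|l]; [rewrite Rabs_R0; auto|].
  destruct (Nat.ltb_spec k n); destruct (Nat.ltb_spec l n); simpl; rewrite ?Rabs_R0; auto.
Qed.

Lemma grid_bound (f : nat -> nat -> R) n : exists M, 0 <= M /\ forall k l, (k < n)%nat -> (l < n)%nat -> Rabs (f k l) <= M.
Proof.
  destruct (grid_max (fun k l => Rabs (f k l)) n) as (i & j & _ & _ & H).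
  exists (Rabs (f i j)). split; [apply Rabs_pos|]. intros; apply H; lia.
Qed.

(* Richardson iteration: the damping makes [I - omega (A + lam)] a contraction in the maximum norm. *)
Lemma approximate_solution A n lam T delta : monotone_stencil A n -> 0 < lam -> 0 < delta ->
  exists z, grid_zero n z /\ forall k l, (k < n)%nat -> (l < n)%nat ->
    Rabs (T k l - (apply_stencil A z k l + lam * z (S k) (S l))) <= delta.
Proof.
  intros HA Hl Hd.
  destruct (grid_bound T n) as (MT & HMT & BT).
  destruct (grid_bound (fun k l => cW A k l + cE A k l + cS A k l + cN A k l + c0 A k l) n) as (D & HD & BD).
  (* [D] bounds the diagonal of [A], so the iteration matrix has nonnegative entries and row sums at
     most [1 - om * lam]. *)
  set (om := / (D + lam)).
  assert (Hom : 0 < om) by (apply Rinv_0_lt_compat; lra).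
  assert (Hod : om * (D + lam) = 1) by (apply Rinv_l; lra).
  assert (Hth : 0 <= 1 - om * lam < 1) by nra.
  assert (It : forall m, exists z, grid_zero n z /\ forall k l, (k < n)%nat -> (l < n)%nat ->
    Rabs (T k l - (apply_stencil A z k l + lam * z (S k) (S l))) <= (1 - om * lam) ^ m * MT).
  { induction m as [|m [z [Hz IH]]].
    - exists (fun _ _ => 0). split; [intros i j _; auto|]. intros k l Hk Hl0.
      unfold apply_stencil. match goal with |- Rabs ?x <= _ => replace x with (T k l) by ring end.
      simpl. rewrite Rmult_1_l. auto.
    - set (rho := mask n (fun k l => T k l - (apply_stencil A z k l + lam * z (S k) (S l)))).
      set (q := (1 - om * lam) ^ m * MT) in *.
      assert (Hq : 0 <= q) by (apply Rmult_le_pos; auto; apply pow_le; lra).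
      assert (Hr : forall i j, Rabs (rho i j) <= q) by (apply mask_bound; auto).
      exists (fun i j => 1 * z i j + om * rho i j). split.
      + intros i j Hij. unfold rho. rewrite (Hz i j Hij), (mask_zero n _ i j Hij). ring.
      + intros k l Hk Hl0. rewrite apply_stencil_lin.
        assert (E : T k l - (apply_stencil A z k l + lam * z (S k) (S l)) = rho (S k) (S l)) by (symmetry; now apply mask_in).
        replace (T k l - _) with (rho (S k) (S l) - om * (apply_stencil A rho k l + lam * rho (S k) (S l))) by (rewrite <- E at 1; ring).
        destruct (HA k l Hk Hl0) as (p1 & p2 & p3 & p4 & p5). specialize (BD k l Hk Hl0).
        rewrite Rabs_right in BD by lra.
        set (d := 1 - om * (lam + (cW A k l + cE A k l + cS A k l + cN A k l + c0 A k l))).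
        assert (Hd0 : 0 <= d) by (unfold d; nra).
        replace (rho (S k) (S l) - _) with (d * rho (S k) (S l) + om * (cW A k l * rho k (S l) + cE A k l * rho (S (S k)) (S l)
           + cS A k l * rho (S k) l + cN A k l * rho (S k) (S (S l)))) by (unfold d, apply_stencil; ring).
        assert (P : forall c x, 0 <= c -> Rabs x <= q -> - (c * q) <= c * x <= c * q).
        { intros c x Hc Hx. apply Rabs_le_between in Hx. nra. }
        pose proof (P _ _ Hd0 (Hr (S k) (S l))). pose proof (P _ _ p1 (Hr k (S l))). pose proof (P _ _ p2 (Hr (S (S k)) (S l))).
        pose proof (P _ _ p3 (Hr (S k) l)). pose proof (P _ _ p4 (Hr (S k) (S (S l)))).
        set (s := cW A k l * rho k (S l) + cE A k l * rho (S (S k)) (S l) + cS A k l * rho (S k) l + cN A k l * rho (S k) (S (S l))) in *.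
        set (C := cW A k l + cE A k l + cS A k l + cN A k l) in *.
        assert (Hs : Rabs s <= C * q) by (apply Rabs_le; unfold s, C; lra).
        assert (HC : 0 <= C * q) by (apply Rmult_le_pos; unfold C; lra).
        apply Rabs_le_between in Hs.
        assert (om * s <= om * (C * q)) by (apply Rmult_le_compat_l; lra).
        assert (om * - (C * q) <= om * s) by (apply Rmult_le_compat_l; lra).
        assert (F : d * q + om * (C * q) <= (1 - om * lam) * q).
        { replace ((1 - om * lam) * q) with (d * q + om * (C * q) + om * c0 A k l * q) by (unfold d, C; ring).
          assert (0 <= om * c0 A k l * q) by (apply Rmult_le_pos; auto; apply Rmult_le_pos; lra). lra. }
        replace ((1 - om * lam) ^ S m * MT) with ((1 - om * lam) * q) by (unfold q; simpl; ring).
        apply Rabs_le. lra. }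
  destruct (pow_lt_1_zero (1 - om * lam)) with (y := delta / (MT + 1)) as [m Hm].
  - rewrite Rabs_right; lra.
  - apply Rdiv_lt_0_compat; lra.
  - destruct (It m) as [z [Hz Hb]]. exists z. split; auto. intros k l Hk Hl0.
    eapply Rle_trans; [now apply Hb|].
    specialize (Hm m ltac:(lia)). rewrite Rabs_right in Hm by (apply Rle_ge, pow_le; lra).
    apply Rle_trans with (delta / (MT + 1) * (MT + 1)); [|right; field; lra].
    apply Rmult_le_compat; try lra. apply pow_le; lra.
Qed.

(* [A] is [- eps Laplace_h] plus difference quotients with coefficients bounded by [B]. *)
Definition near_laplacian (A : stencil) (n : nat) (eps B h : R) : Prop :=
  forall k l, (k < n)%nat -> (l < n)%nat ->
    Rabs (cW A k l - eps / h ^ 2) <= B / h /\ Rabs (cE A k l - eps / h ^ 2) <= B / h /\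
    Rabs (cS A k l - eps / h ^ 2) <= B / h /\ Rabs (cN A k l - eps / h ^ 2) <= B / h /\ Rabs (c0 A k l) <= B.

Lemma sq_sum6 a b c d e f : (a + b + c + d + e + f) ^ 2 <= 6 * (a ^ 2 + b ^ 2 + c ^ 2 + d ^ 2 + e ^ 2 + f ^ 2).
Proof.
  pose proof (pow2_ge_0 (a - b)). pose proof (pow2_ge_0 (a - c)). pose proof (pow2_ge_0 (a - d)). pose proof (pow2_ge_0 (a - e)).
  pose proof (pow2_ge_0 (a - f)). pose proof (pow2_ge_0 (b - c)). pose proof (pow2_ge_0 (b - d)). pose proof (pow2_ge_0 (b - e)).
  pose proof (pow2_ge_0 (b - f)). pose proof (pow2_ge_0 (c - d)). pose proof (pow2_ge_0 (c - e)). pose proof (pow2_ge_0 (c - f)).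
  pose proof (pow2_ge_0 (d - e)). pose proof (pow2_ge_0 (d - f)). pose proof (pow2_ge_0 (e - f)). lra.
Qed.

Lemma sq_mult_le w B d : Rabs w <= B -> (w * d) ^ 2 <= B ^ 2 * d ^ 2.
Proof.
  intros H. rewrite Rpow_mult_distr. apply Rmult_le_compat_r; [apply pow2_ge_0|].
  rewrite <- (pow2_abs w). apply pow_incr. split; auto using Rabs_pos.
Qed.

(* Test [(A + lam) z = T] with [- Laplace_h z]. *)
Lemma discrete_energy A n eps B h lam z T : 0 < eps -> 0 <= B -> h = / INR (S n) ->
  near_laplacian A n eps B h -> 9 * B ^ 2 / eps <= lam -> grid_zero n z ->
  (forall k l, (k < n)%nat -> (l < n)%nat -> T k l = apply_stencil A z k l + lam * z (S k) (S l)) ->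
  forall i j, (i <= S n)%nat -> (j <= S n)%nat ->
  z i j ^ 2 <= 3 / eps ^ 2 * (h ^ 2 * fsum2 (fun k l => T k l ^ 2) n n).
Proof.
  intros Heps HB Hh HA Hlam Hz HT i j Hi Hj.
  assert (HN : 0 < INR (S n)) by (apply lt_0_INR; lia).
  assert (hp : 0 < h) by (rewrite Hh; now apply Rinv_0_lt_compat).
  assert (HNh : INR (S n) * h = 1) by (rewrite Hh; field; lra).
  set (Z := fun k l => X2 z k l + Y2 z k l).
  set (G := GX z n + GY z n).
  assert (GXp : 0 <= GX z n) by (apply fsum2_ge0; intros; apply pow2_ge_0).
  assert (GYp : 0 <= GY z n) by (apply fsum2_ge0; intros; apply pow2_ge_0).
  assert (ZZ : fsum2 (fun k l => z (S k) (S l) * Z k l) n n = - G).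
  { unfold Z, G. rewrite (fsum2_ext _ (fun k l => z (S k) (S l) * X2 z k l + z (S k) (S l) * Y2 z k l)) by (intros; ring).
    rewrite fsum2_plus, sum_z_X2, sum_z_Y2 by auto. ring. }
  (* The equation times h^2 and the undivided Laplacian [Z]. After summation the term with [lam]
     becomes h^2 lam G by [ZZ], hence of favourable sign. *)
  assert (PT : forall k l, (k < n)%nat -> (l < n)%nat ->
    eps * Z k l ^ 2 + (- (h ^ 2 * lam)) * (z (S k) (S l) * Z k l) <= eps / 2 * Z k l ^ 2 +
     / (2 * eps) * (6 * ((h * B) ^ 2 * (DX z k l ^ 2 + DX z (S k) l ^ 2 + DY z k l ^ 2 + DY z k (S l) ^ 2)
        + (h ^ 2 * B) ^ 2 * z (S k) (S l) ^ 2 + h ^ 4 * T k l ^ 2))).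
  { intros k l Hk Hl. destruct (HA k l Hk Hl) as (a1 & a2 & a3 & a4 & a5). specialize (HT k l Hk Hl).
    set (w1 := h ^ 2 * (cW A k l - eps / h ^ 2)). set (w2 := h ^ 2 * (cE A k l - eps / h ^ 2)).
    set (w3 := h ^ 2 * (cS A k l - eps / h ^ 2)). set (w4 := h ^ 2 * (cN A k l - eps / h ^ 2)).
    assert (W : forall x, Rabs x <= B / h -> Rabs (h ^ 2 * x) <= h * B).
    { intros x Hx. rewrite Rabs_mult, (Rabs_right (h ^ 2)) by nra.
      replace (h * B) with (h ^ 2 * (B / h)) by (field; lra). apply Rmult_le_compat_l; auto. nra. }
    set (S6 := w1 * DX z k l + (- w2) * DX z (S k) l + w3 * DY z k l + (- w4) * DY z k (S l)
      + (h ^ 2 * c0 A k l) * z (S k) (S l) + (- (h ^ 2)) * T k l).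
    assert (E : eps * Z k l - h ^ 2 * lam * z (S k) (S l) = S6).
    { unfold S6, w1, w2, w3, w4, Z. rewrite HT. unfold apply_stencil, X2, Y2, DX, DY. field. lra. }
    assert (S6b : S6 ^ 2 <= 6 * ((h * B) ^ 2 * (DX z k l ^ 2 + DX z (S k) l ^ 2 + DY z k l ^ 2 + DY z k (S l) ^ 2)
        + (h ^ 2 * B) ^ 2 * z (S k) (S l) ^ 2 + h ^ 4 * T k l ^ 2)).
    { unfold S6. eapply Rle_trans; [apply sq_sum6|].
      pose proof (sq_mult_le w1 (h * B) (DX z k l) (W _ a1)).
      pose proof (sq_mult_le (- w2) (h * B) (DX z (S k) l) ltac:(rewrite Rabs_Ropp; exact (W _ a2))).
      pose proof (sq_mult_le w3 (h * B) (DY z k l) (W _ a3)).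
      pose proof (sq_mult_le (- w4) (h * B) (DY z k (S l)) ltac:(rewrite Rabs_Ropp; exact (W _ a4))).
      assert (Q5 : Rabs (h ^ 2 * c0 A k l) <= h ^ 2 * B).
      { rewrite Rabs_mult, (Rabs_right (h ^ 2)) by nra. apply Rmult_le_compat_l; auto; nra. }
      pose proof (sq_mult_le (h ^ 2 * c0 A k l) (h ^ 2 * B) (z (S k) (S l)) Q5).
      replace ((- h ^ 2 * T k l) ^ 2) with (h ^ 4 * T k l ^ 2) by ring. lra. }
    replace (eps * Z k l ^ 2 + - (h ^ 2 * lam) * (z (S k) (S l) * Z k l))
      with (Z k l * (eps * Z k l - h ^ 2 * lam * z (S k) (S l))) by ring.
    rewrite E.
    assert (Y : Z k l * S6 <= eps / 2 * Z k l ^ 2 + / (2 * eps) * S6 ^ 2).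
    { assert (0 <= / (2 * eps) * (eps * Z k l - S6) ^ 2).
      { apply Rmult_le_pos; [left; apply Rinv_0_lt_compat; lra|apply pow2_ge_0]. }
      replace (/ (2 * eps) * (eps * Z k l - S6) ^ 2) with (eps / 2 * Z k l ^ 2 + / (2 * eps) * S6 ^ 2 - Z k l * S6) in H by (field; lra).
      lra. }
    eapply Rle_trans; [exact Y|]. apply Rplus_le_compat_l, Rmult_le_compat_l; auto.
    left; apply Rinv_0_lt_compat; lra. }
  set (SZ := fsum2 (fun k l => Z k l ^ 2) n n). set (ST := fsum2 (fun k l => T k l ^ 2) n n).
  assert (G1 : fsum2 (fun k l => DX z k l ^ 2) n n <= GX z n).
  { unfold GX, fsum2. apply fsum_mono_n; [intros; apply fsum_ge0; intros; apply pow2_ge_0|lia]. }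
  assert (G2 : fsum2 (fun k l => DX z (S k) l ^ 2) n n <= GX z n).
  { unfold GX, fsum2. rewrite (fsum_shift (fun k => fsum (fun l => DX z k l ^ 2) n)).
    assert (0 <= fsum (fun l => DX z 0 l ^ 2) n) by (apply fsum_ge0; intros; apply pow2_ge_0). lra. }
  assert (G3 : fsum2 (fun k l => DY z k l ^ 2) n n <= GY z n).
  { unfold GY, fsum2. apply fsum_le; intros. apply fsum_mono_n; [intros; apply pow2_ge_0|lia]. }
  assert (G4 : fsum2 (fun k l => DY z k (S l) ^ 2) n n <= GY z n).
  { unfold GY, fsum2. apply fsum_le; intros. rewrite (fsum_shift (fun l => DY z k l ^ 2)).
    pose proof (pow2_ge_0 (DY z k 0)). lra. }
  assert (PZ := poincare z n Hz).
  set (Sz := fsum2 (fun k l => z (S k) (S l) ^ 2) n n) in *.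
  assert (PS := fsum2_le _ _ n n PT).
  rewrite !fsum2_plus, !fsum2_scal in PS. rewrite !fsum2_plus, !fsum2_scal in PS. rewrite !fsum2_plus in PS.
  fold SZ ST Sz in PS. rewrite ZZ in PS.
  assert (P1 : h ^ 2 * Sz <= GX z n).
  { apply Rle_trans with (h ^ 2 * (INR (S n) ^ 2 * GX z n)).
    - apply Rmult_le_compat_l; auto; nra.
    - right. replace (h ^ 2 * (INR (S n) ^ 2 * GX z n)) with ((INR (S n) * h) ^ 2 * GX z n) by ring. rewrite HNh. ring. }
  assert (P2 : (h ^ 2 * B) ^ 2 * Sz <= (h * B) ^ 2 * G).
  { replace ((h ^ 2 * B) ^ 2 * Sz) with ((h * B) ^ 2 * (h ^ 2 * Sz)) by ring.
    apply Rmult_le_compat_l; [apply pow2_ge_0|]. unfold G; lra. }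
  assert (P3 : (h * B) ^ 2 * (fsum2 (fun k l => DX z k l ^ 2) n n + fsum2 (fun k l => DX z (S k) l ^ 2) n n
     + fsum2 (fun k l => DY z k l ^ 2) n n + fsum2 (fun k l => DY z k (S l) ^ 2) n n) <= (h * B) ^ 2 * (2 * G)).
  { apply Rmult_le_compat_l; [apply pow2_ge_0|]. unfold G; lra. }
  assert (Ge : 0 <= G) by (unfold G; lra).
  (* This fixes the threshold 9 B^2 / eps for [lam]: two copies of G come from the first-order terms
     and a third from the zero-order term by [poincare], and 6 times 3 over 2 is 9. *)
  assert (P4 : / (2 * eps) * (6 * ((h * B) ^ 2 * (3 * G))) <= h ^ 2 * lam * G).
  { replace (/ (2 * eps) * (6 * ((h * B) ^ 2 * (3 * G)))) with (h ^ 2 * (9 * B ^ 2 / eps) * G) by (field; lra).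
    apply Rmult_le_compat_r; auto. apply Rmult_le_compat_l; auto; nra. }
  assert (ie : 0 < / (2 * eps)) by (apply Rinv_0_lt_compat; lra).
  assert (P5 : eps / 2 * SZ <= / (2 * eps) * (6 * (h ^ 4 * ST))).
  { match type of PS with _ <= _ + / (2 * eps) * ?X => assert (PX : X <= 6 * ((h * B) ^ 2 * (3 * G)) + 6 * (h ^ 4 * ST)) by lra;
      assert (PX' : / (2 * eps) * X <= / (2 * eps) * (6 * ((h * B) ^ 2 * (3 * G)) + 6 * (h ^ 4 * ST))) by (apply Rmult_le_compat_l; lra) end.
    lra. }
  assert (P6 : SZ <= 6 / eps ^ 2 * (h ^ 4 * ST)).
  { apply Rmult_le_reg_l with (eps / 2); [lra|]. eapply Rle_trans; [exact P5|]. right. field. lra. }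
  assert (P7 : 2 * fsum2 (fun k l => DXY z k l ^ 2) (S n) (S n) <= SZ).
  { rewrite <- sum_X2_Y2 by auto. rewrite <- fsum2_scal. apply fsum2_le. intros k l _ _.
    unfold Z. pose proof (pow2_ge_0 (X2 z k l)). pose proof (pow2_ge_0 (Y2 z k l)). nra. }
  eapply Rle_trans; [now apply (sup_le_DXY z n)|].
  apply Rle_trans with (INR (S n) ^ 2 * (3 / eps ^ 2 * (h ^ 4 * ST))).
  - apply Rmult_le_compat_l; [apply pow2_ge_0|]. lra.
  - right. replace (INR (S n) ^ 2 * (3 / eps ^ 2 * (h ^ 4 * ST))) with ((INR (S n) * h) ^ 2 * (3 / eps ^ 2 * (h ^ 2 * ST))) by (field; lra).
    rewrite HNh. ring.
Qed.

(** The shifted equation needs to be solved only up to [tau]: its residual is small in the maximum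
    norm and joins [lam * z] as data for the maximum principle. *)
Lemma discrete_stability eps0 kappa B : 0 < eps0 -> 0 < kappa -> 0 <= B -> exists C, 0 <= C /\
  forall n A eps h X e tau, eps0 <= eps -> h = / INR (S n) ->
  monotone_stencil A n -> near_laplacian A n eps B h ->
  (forall i j, (i <= S n)%nat -> (j <= S n)%nat -> 0 <= X i j <= 1) ->
  (forall k l, (k < n)%nat -> (l < n)%nat -> kappa <= apply_stencil A X k l) ->
  grid_zero n e -> 0 < tau -> h ^ 2 * fsum2 (fun k l => apply_stencil A e k l ^ 2) n n <= tau ^ 2 ->
  forall i j, (i <= S n)%nat -> (j <= S n)%nat -> Rabs (e i j) <= C * tau.
Proof.
  intros He0 Hk HB.
  (* The [+ 1] keeps [lam] positive when [B = 0]. *)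
  set (lam := 9 * B ^ 2 / eps0 + 1).
  assert (Hl : 0 < lam).
  { assert (0 <= 9 * B ^ 2 / eps0); [|unfold lam; lra]. apply Rmult_le_pos; [nra|left; now apply Rinv_0_lt_compat]. }
  (* 4/eps0 bounds z. In the fraction the first 1 stands for the residual, the middle term for
     [lam * z], and the last 1 makes the barrier inequality strict. *)
  exists (4 / eps0 + (1 + lam * (4 / eps0) + 1) / kappa).
  assert (p4 : 0 < 4 / eps0) by (apply Rdiv_lt_0_compat; lra).
  assert (pl : 0 < lam * (4 / eps0)) by nra.
  split. { assert (0 < (1 + lam * (4 / eps0) + 1) / kappa) by (apply Rdiv_lt_0_compat; lra). lra. }
  intros n A eps h X e tau Heps Hh HA HnA HX HAX Hez Htau HT i j Hi Hj.
  assert (HN : 1 <= INR (S n)) by (apply (le_INR 1); lia).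
  assert (hp : 0 < h <= 1).
  { rewrite Hh. split; [apply Rinv_0_lt_compat; lra|]. rewrite <- Rinv_1. apply Rinv_le_contravar; lra. }
  destruct (approximate_solution A n lam (fun k l => apply_stencil A e k l) tau HA Hl Htau) as (z & Hz & Hzr).
  set (T' := fun k l => apply_stencil A z k l + lam * z (S k) (S l)).
  assert (ST : h ^ 2 * fsum2 (fun k l => T' k l ^ 2) n n <= 4 * tau ^ 2).
  { apply Rle_trans with (h ^ 2 * fsum2 (fun k l => 2 * apply_stencil A e k l ^ 2 + 2 * tau ^ 2) n n).
    - apply Rmult_le_compat_l; [nra|]. apply fsum2_le. intros k l Hkn Hln.
      specialize (Hzr k l Hkn Hln). fold (T' k l) in Hzr. apply Rabs_le_between in Hzr.
      set (a := apply_stencil A e k l) in *. assert ((a - T' k l) ^ 2 <= tau ^ 2) by nra.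
      pose proof (pow2_ge_0 (a + (a - T' k l))). nra.
    - rewrite fsum2_plus, fsum2_scal, fsum2_const.
      assert (hn : h * INR n <= 1).
      { rewrite Hh. apply Rmult_le_reg_l with (INR (S n)); [lra|].
        replace (INR (S n) * (/ INR (S n) * INR n)) with (INR n) by (field; lra). rewrite S_INR in *; lra. }
      assert (0 <= h * INR n) by (apply Rmult_le_pos; [lra|apply pos_INR]).
      replace (h ^ 2 * (2 * fsum2 (fun k l => apply_stencil A e k l ^ 2) n n + INR n * INR n * (2 * tau ^ 2)))
       with (2 * (h ^ 2 * fsum2 (fun k l => apply_stencil A e k l ^ 2) n n) + (h * INR n) ^ 2 * (2 * tau ^ 2)) by ring.
      assert ((h * INR n) ^ 2 <= 1) by nra.
      assert ((h * INR n) ^ 2 * (2 * tau ^ 2) <= 1 * (2 * tau ^ 2)) by (apply Rmult_le_compat_r; nra). lra. }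
  assert (Hlam : 9 * B ^ 2 / eps <= lam).
  { assert (9 * B ^ 2 / eps <= 9 * B ^ 2 / eps0); [|unfold lam; lra].
    apply Rmult_le_compat_l; [nra|]. apply Rinv_le_contravar; lra. }
  (* The energy estimate yields 12 tau^2 / eps0^2, enlarged to 16 to have a square. *)
  assert (Bz : forall i j, (i <= S n)%nat -> (j <= S n)%nat -> Rabs (z i j) <= 4 / eps0 * tau).
  { intros a b Ha Hb.
    assert (Q := discrete_energy A n eps B h lam z T' ltac:(lra) HB Hh HnA Hlam Hz ltac:(auto) a b Ha Hb).
    assert (Q2 : z a b ^ 2 <= (4 / eps0 * tau) ^ 2).
    { eapply Rle_trans; [exact Q|]. apply Rle_trans with (3 / eps0 ^ 2 * (4 * tau ^ 2)).
      - apply Rmult_le_compat; [left; apply Rdiv_lt_0_compat; nra| |  |exact ST].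
        + apply Rmult_le_pos; [nra|apply fsum2_ge0; intros; apply pow2_ge_0].
        + apply Rmult_le_compat_l; [lra|]. apply Rinv_le_contravar; nra.
      - replace ((4 / eps0 * tau) ^ 2) with (16 * (/ eps0 ^ 2 * tau ^ 2)) by (field; lra).
        replace (3 / eps0 ^ 2 * (4 * tau ^ 2)) with (12 * (/ eps0 ^ 2 * tau ^ 2)) by (field; lra).
        assert (0 <= / eps0 ^ 2 * tau ^ 2) by (apply Rmult_le_pos; [left; apply Rinv_0_lt_compat; nra|nra]). lra. }
    rewrite <- (pow2_abs (z a b)) in Q2. apply Rsqr_incr_0_var; [unfold Rsqr; lra|]. apply Rmult_le_pos; lra. }
  set (r := fun i j => 1 * e i j + (-1) * z i j).
  assert (Hr : grid_zero n r).
  { intros a b Hab. unfold r. rewrite (Hez a b Hab), (Hz a b Hab). ring. }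
  assert (Br := max_principle_barrier A n kappa (tau + lam * (4 / eps0 * tau)) ((1 + lam * (4 / eps0) + 1) / kappa * tau) r X HA HX HAX Hk).
  assert (Q : Rabs (r i j) <= (1 + lam * (4 / eps0) + 1) / kappa * tau).
  { apply Br; auto.
    - nra.
    - replace ((1 + lam * (4 / eps0) + 1) / kappa * tau * kappa) with ((1 + lam * (4 / eps0) + 1) * tau) by (field; lra). nra.
    - intros k l Hkn Hln. unfold r. rewrite apply_stencil_lin.
      replace (1 * apply_stencil A e k l + -1 * apply_stencil A z k l) with
        (apply_stencil A e k l - T' k l + lam * z (S k) (S l)) by (unfold T'; ring).
      eapply Rle_trans; [apply Rabs_triang|]. apply Rplus_le_compat; [now apply Hzr|].
      rewrite Rabs_mult, (Rabs_right lam) by lra. apply Rmult_le_compat_l; [lra|]. apply Bz; lia. }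
  replace (e i j) with (r i j + z i j) by (unfold r; ring).
  eapply Rle_trans; [apply Rabs_triang|]. specialize (Bz i j Hi Hj). lra.
Qed.

(** * Averages against hat kernels *)

Definition deriv_on (g g' : R -> R) : Prop := forall x, 0 < x < 1 -> is_derive g x (g' x).

Lemma is_derive_affine g x c s l : is_derive g (x + c * s) l -> is_derive (fun s => g (x + c * s)) s (c * l).
Proof.
  intros H. apply (is_derive_comp g (fun s => x + c * s)); auto.
  apply is_derive_eq1 with (0 + c * 1); [ring|].
  apply (is_derive_plus1 (fun _ => x) (fun s => c * s)); [apply (@is_derive_const R_AbsRing)|].
  apply is_derive_scal1. apply (@is_derive_id R_AbsRing).
Qed.

Lemma cont1_affine g x c : cont1 g -> cont1 (fun s => g (x + c * s)).
Proof. intros H. apply (cont1_comp g); ct. Qed.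

Lemma increment_bound f f' a b B : a <= b -> cont1 f -> cont1 f' -> (forall t, a < t < b -> is_derive f t (f' t)) ->
  (forall t, a < t < b -> Rabs (f' t) <= B) -> Rabs (f b - f a) <= B * (b - a).
Proof.
  intros Hab Hc Hc' Hd HB.
  rewrite <- (RInt_derive_open f f' a b); auto.
  eapply Rle_trans; [apply RInt_abs_le1; auto|].
  rewrite (Rmult_comm B), <- (RInt_const1 B a b). apply RInt_le1; auto using cont1_abs, cont1_const.
Qed.

(** Takes the place of the maximum of g in a Taylor remainder; such integrals can later be summed
    over the patches into an L2 norm. *)
Definition J (g : R -> R) (x h : R) : R := RInt (fun t => Rabs (g t)) (x - h) (x + h).

Lemma J_ge0 g x h : 0 <= h -> cont1 g -> 0 <= J g x h.
Proof. intros Hh Hg. apply RInt_ge01; [lra|ct|intros; apply Rabs_pos]. Qed.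

Lemma RInt_abs_sub_le g a b c d : cont1 g -> a <= c <= d -> d <= b ->
  RInt (fun t => Rabs (g t)) c d <= RInt (fun t => Rabs (g t)) a b.
Proof.
  intros Hg H1 H2. rewrite <- (RInt_Chasles1 _ a c b), <- (RInt_Chasles1 _ c d b) by ct.
  assert (0 <= RInt (fun t => Rabs (g t)) a c) by (apply RInt_ge01; [lra|ct|intros; apply Rabs_pos]).
  assert (0 <= RInt (fun t => Rabs (g t)) d b) by (apply RInt_ge01; [lra|ct|intros; apply Rabs_pos]). lra.
Qed.

Lemma derivative_increment_J g g' x h a b : cont1 g -> cont1 g' -> deriv_on g g' ->
  0 <= x - h -> x + h <= 1 -> x - h <= a <= b -> b <= x + h -> Rabs (g b - g a) <= J g' x h.
Proof.
  intros Hg Hg' Hd H0 H1 Ha Hb.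
  rewrite <- (RInt_derive_open g g' a b); auto; try lra; [|intros; apply Hd; lra].
  eapply Rle_trans; [apply RInt_abs_le1; auto; lra|]. now apply RInt_abs_sub_le.
Qed.

Section OneD.
Variables (g g' g'' : R -> R) (x h : R).
Hypotheses (Hg : cont1 g) (Hg' : cont1 g') (Hg'' : cont1 g'') (D1 : deriv_on g g') (D2 : deriv_on g' g'')
  (Hh : 0 < h) (H0 : 0 <= x - h) (H1 : x + h <= 1).

Let dp s : 0 < s < 1 -> is_derive (fun s => g (x + h * s)) s (h * g' (x + h * s)).
Proof. intros Hs. apply is_derive_affine, D1. nra. Qed.
Let dm s : 0 < s < 1 -> is_derive (fun s => g (x + - h * s)) s (- h * g' (x + - h * s)).
Proof. intros Hs. apply is_derive_affine, D1. nra. Qed.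

(** The derivative in s is h times an increment of g' within the patch, hence at most h times the
    integral of the modulus of g''. *)
Lemma second_difference_J s : 0 <= s <= 1 ->
  Rabs (g (x + h * s) + g (x + - h * s) - 2 * g x) <= h * J g'' x h.
Proof.
  intros Hs.
  set (phi := fun s => g (x + h * s) + g (x + - h * s)).
  assert (cp : cont1 phi) by (apply cont1_plus; now apply cont1_affine).
  assert (cp' : cont1 (fun s => h * g' (x + h * s) + - h * g' (x + - h * s))).
  { apply cont1_plus; apply cont1_mult; ct; now apply cont1_affine. }
  assert (B := increment_bound phi _ 0 s (h * J g'' x h) (proj1 Hs) cp cp').
  unfold phi in B at 2 3. rewrite !Rmult_0_r, !Rplus_0_r in B.
  replace (g (x + h * s) + g (x + - h * s) - 2 * g x) with (g (x + h * s) + g (x + - h * s) - (g x + g x)) by ring.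
  eapply Rle_trans; [apply B|].
  - intros t Ht. apply is_derive_plus1; [apply dp | apply dm]; lra.
  - intros t Ht. replace (h * g' (x + h * t) + - h * g' (x + - h * t)) with (h * (g' (x + h * t) - g' (x + - h * t))) by ring.
    rewrite Rabs_mult, Rabs_right by lra. apply Rmult_le_compat_l; [lra|].
    apply derivative_increment_J; auto; nra.
  - assert (0 <= h * J g'' x h) by (apply Rmult_le_pos; [lra|apply J_ge0; auto; lra]). nra.
Qed.
End OneD.

(* Average against the hat kernel of half-width [h] centred at [x]. *)
Definition M (g : R -> R) (x h : R) : R := RInt (fun s => (1 - s) * (g (x + h * s) + g (x + - h * s))) 0 1.

Lemma cont1_M_integrand g x h : cont1 g -> cont1 (fun s => (1 - s) * (g (x + h * s) + g (x + - h * s))).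
Proof. intros H. apply cont1_mult; ct; now apply cont1_affine. Qed.

Lemma M_plus f g x h : cont1 f -> cont1 g -> M (fun t => f t + g t) x h = M f x h + M g x h.
Proof.
  intros Hf Hg. unfold M. rewrite <- RInt_plus1 by (now apply cont1_M_integrand).
  apply RInt_ext; intros; eqR; ring.
Qed.
Lemma M_scal c f x h : cont1 f -> M (fun t => c * f t) x h = c * M f x h.
Proof.
  intros Hf. unfold M. rewrite <- RInt_scal1 by (now apply cont1_M_integrand).
  apply RInt_ext; intros; eqR; ring.
Qed.
Lemma M_const c x h : M (fun _ => c) x h = c.
Proof.
  unfold M. rewrite (RInt_derive_open (fun s => c * (2 * s - s ^ 2))); ct; try lra.
  replace ((1 - x0) * (c + c)) with (c * (2 * 1 - (INR 2 * 1 * x0 ^ 1))) by (simpl; ring).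
  apply is_derive_scal1, is_derive_minus1; [apply is_derive_scal1, (@is_derive_id R_AbsRing)|].
  apply (is_derive_pow (fun s => s) 2). apply (@is_derive_id R_AbsRing).
Qed.
Lemma M_ext f g x h : 0 < h -> (forall t, x - h <= t <= x + h -> f t = g t) -> M f x h = M g x h.
Proof.
  intros Hh E. apply RInt_ext. rewrite Rmin_left, Rmax_right by lra. intros s Hs. rewrite !E by nra. reflexivity.
Qed.
Lemma M_minus f g x h : cont1 f -> cont1 g -> M (fun t => f t - g t) x h = M f x h - M g x h.
Proof.
  intros Hf Hg. unfold M. rewrite <- RInt_minus1 by (now apply cont1_M_integrand).
  apply RInt_ext; intros; eqR; ring.
Qed.
Lemma M_abs_le f F x h : 0 < h -> cont1 f -> cont1 F -> (forall t, x - h <= t <= x + h -> Rabs (f t) <= F t) ->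
  Rabs (M f x h) <= M F x h.
Proof.
  intros Hh Hf HF H. unfold M. eapply Rle_trans; [apply RInt_abs_le1; [lra|now apply cont1_M_integrand]|].
  apply RInt_le1; [lra|apply cont1_abs; now apply cont1_M_integrand|now apply cont1_M_integrand|].
  intros s Hs. rewrite Rabs_mult, Rabs_right by lra. apply Rmult_le_compat_l; [lra|].
  eapply Rle_trans; [apply Rabs_triang|]. apply Rplus_le_compat; apply H; nra.
Qed.

Lemma RInt_affine F x c : cont1 F -> c * RInt (fun s => F (x + c * s)) 0 1 = RInt F x (x + c).
Proof.
  intros HF. rewrite <- RInt_scal1 by now apply cont1_affine.
  assert (Q := RInt_comp_lin F c x 0 1 (ex_RInt_cont1 F _ _ HF)).
  replace (c * 0 + x) with x in Q by ring. replace (c * 1 + x) with (x + c) in Q by ring.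
  rewrite <- Q. apply RInt_ext. intros s _. rewrite (Rplus_comm (c * s)). reflexivity.
Qed.

Lemma M_le_J f F x h : 0 < h -> cont1 f -> cont1 F -> (forall t, x - h <= t <= x + h -> Rabs (f t) <= F t) ->
  Rabs (M f x h) <= / h * RInt F (x - h) (x + h).
Proof.
  intros Hh Hf HF H.
  assert (P : forall t, x - h <= t <= x + h -> 0 <= F t) by (intros t Ht; pose proof (Rabs_pos (f t)); specialize (H t Ht); lra).
  eapply Rle_trans; [apply (M_abs_le f F); auto|]. unfold M.
  apply Rle_trans with (RInt (fun s => F (x + h * s) + F (x + - h * s)) 0 1).
  - apply RInt_le1; [lra|now apply cont1_M_integrand|apply cont1_plus; now apply cont1_affine|].
    intros s Hs. assert (0 <= F (x + h * s)) by (apply P; nra). assert (0 <= F (x + - h * s)) by (apply P; nra). nra.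
  - rewrite RInt_plus1 by now apply cont1_affine.
    assert (E1 := RInt_affine F x h HF). assert (E2 := RInt_affine F x (- h) HF).
    assert (Q := RInt_Chasles1 F (x - h) x (x - h) HF). rewrite RInt_point in Q. unfold zero in Q; simpl in Q.
    replace (x + - h) with (x - h) in E2 by ring.
    rewrite <- (RInt_Chasles1 F (x - h) x (x + h)), <- E1 by auto.
    replace (RInt F (x - h) x) with (h * RInt (fun s => F (x + - h * s)) 0 1) by lra.
    right. field. lra.
Qed.

Section OneD2.
Variables (g g' g'' : R -> R) (x h : R).
Hypotheses (Hg : cont1 g) (Hg' : cont1 g') (Hg'' : cont1 g'') (D1 : deriv_on g g') (D2 : deriv_on g' g'')
  (Hh : 0 < h) (H0 : 0 <= x - h) (H1 : x + h <= 1).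

(** The hat is the Peano kernel of the second difference quotient. [F] is the explicit primitive of
    the integrand found by integrating by parts. *)
Lemma M_second_derivative : M g'' x h = (g (x + h) + g (x - h) - 2 * g x) / h ^ 2.
Proof.
  set (F := fun s => / h * ((1 - s) * (g' (x + h * s) - g' (x + - h * s))) + / h ^ 2 * (g (x + h * s) + g (x + - h * s))).
  unfold M. rewrite (RInt_derive_open F).
  - unfold F. rewrite !Rmult_0_r, !Rmult_1_r, !Rplus_0_r. replace (x + - h) with (x - h) by ring. field. lra.
  - lra.
  - unfold F. apply cont1_plus; apply cont1_mult; ct; now apply cont1_affine.
  - now apply cont1_M_integrand.
  - intros s Hs. unfold F.
    apply is_derive_eq1 with (/ h * ((0 - 1) * (g' (x + h * s) - g' (x + - h * s)) + (1 - s) * (h * g'' (x + h * s) - - h * g'' (x + - h * s)))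
       + / h ^ 2 * (h * g' (x + h * s) + - h * g' (x + - h * s))); [field; lra|].
    apply is_derive_plus1; apply is_derive_scal1.
    + apply (is_derive_mult1 (fun s => 1 - s) (fun s => g' (x + h * s) - g' (x + - h * s))).
      * apply is_derive_minus1; [apply (@is_derive_const R_AbsRing)|apply (@is_derive_id R_AbsRing)].
      * apply is_derive_minus1; apply is_derive_affine, D2; nra.
    + apply is_derive_plus1; apply is_derive_affine, D1; nra.
Qed.

Lemma M_error_J : Rabs (M g x h - g x) <= h * J g'' x h.
Proof.
  rewrite <- (M_const (g x) x h), <- M_minus by ct.
  unfold M. eapply Rle_trans; [apply RInt_abs_le1; [lra|apply (cont1_M_integrand (fun t => g t - g x)); ct]|].
  apply Rle_trans with (RInt (fun _ => h * J g'' x h) 0 1); [|rewrite RInt_const1; lra].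
  apply RInt_le1; [lra| |ct|].
  - apply cont1_abs, (cont1_M_integrand (fun t => g t - g x)). ct.
  - intros s Hs. rewrite Rabs_mult, Rabs_right by lra.
    replace (g (x + h * s) - g x + (g (x + - h * s) - g x)) with (g (x + h * s) + g (x + - h * s) - 2 * g x) by ring.
    assert (B := second_difference_J g g' g'' x h Hg Hg' Hg'' D1 D2 Hh H0 H1 s ltac:(lra)).
    pose proof (Rabs_pos (g (x + h * s) + g (x + - h * s) - 2 * g x)). nra.
Qed.
End OneD2.

Lemma centered_difference_J g g1 g2 g3 x h : cont1 g -> cont1 g1 -> cont1 g2 -> cont1 g3 ->
  deriv_on g g1 -> deriv_on g1 g2 -> deriv_on g2 g3 -> 0 < h -> 0 <= x - h -> x + h <= 1 ->
  Rabs ((g (x + h) - g (x - h)) / (2 * h) - g1 x) <= h * J g3 x h.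
Proof.
  intros Hg Hg1 Hg2 Hg3 D1 D2 D3 Hh H0 H1.
  set (psi := fun s => g (x + h * s) - g (x + - h * s) - 2 * h * g1 x * s).
  assert (B := increment_bound psi (fun s => h * g1 (x + h * s) - - h * g1 (x + - h * s) - 2 * h * g1 x * 1) 0 1 (h * (h * J g3 x h)) Rle_0_1).
  unfold psi in B at 3 4. rewrite !Rmult_0_r, !Rmult_1_r, !Rplus_0_r in B.
  replace (x + - h) with (x - h) in B by ring.
  replace ((g (x + h) - g (x - h)) / (2 * h) - g1 x) with
    (/ (2 * h) * (g (x + h) - g (x - h) - 2 * h * g1 x - (g x - g x - 0))) by (field; lra).
  assert (ih : 0 < / (2 * h)) by (apply Rinv_0_lt_compat; lra).
  assert (Jp := J_ge0 g3 x h ltac:(lra) Hg3).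
  rewrite Rabs_mult, (Rabs_right (/ (2 * h))) by lra.
  apply Rle_trans with (/ (2 * h) * (h * (h * J g3 x h) * (1 - 0))).
  - apply Rmult_le_compat_l; [lra|]. apply B.
    + apply cont1_minus; [apply cont1_minus; now apply cont1_affine|ct].
    + apply cont1_minus; [apply cont1_minus; apply cont1_mult; ct; now apply cont1_affine|ct].
    + intros t Ht. apply is_derive_eq1 with (h * g1 (x + h * t) - - h * g1 (x + - h * t) - 2 * h * g1 x * 1); [ring|].
      apply is_derive_minus1; [apply is_derive_minus1; apply is_derive_affine, D1; nra|].
      apply is_derive_scal1, (@is_derive_id R_AbsRing).
    + intros t Ht.
      replace (h * g1 (x + h * t) - - h * g1 (x + - h * t) - 2 * h * g1 x) with
        (h * (g1 (x + h * t) + g1 (x + - h * t) - 2 * g1 x)) by ring.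
      rewrite Rabs_mult, (Rabs_right h) by lra. apply Rmult_le_compat_l; [lra|].
      apply (second_difference_J g1 g2 g3); auto. lra.
  - replace (/ (2 * h) * (h * (h * J g3 x h) * (1 - 0))) with (/ 2 * (h * J g3 x h)) by (field; lra).
    assert (0 <= h * J g3 x h) by (apply Rmult_le_pos; lra). lra.
Qed.

Lemma increment_abs g g' B a b : cont1 g -> cont1 g' -> deriv_on g g' -> (forall t, 0 < t < 1 -> Rabs (g' t) <= B) ->
  0 <= a <= 1 -> 0 <= b <= 1 -> Rabs (g b - g a) <= B * Rabs (b - a).
Proof.
  intros Hg Hg' Hd HB Ha Hb. destruct (Rle_dec a b).
  - rewrite (Rabs_right (b - a)) by lra. apply (increment_bound g g'); auto; intros; [apply Hd|apply HB]; lra.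
  - rewrite Rabs_minus_sym, (Rabs_left (b - a)) by lra. replace (- (b - a)) with (a - b) by ring.
    apply (increment_bound g g'); auto; try lra; intros; [apply Hd|apply HB]; lra.
Qed.

Lemma taylor_1 g g1 g2 K x t : cont1 g -> cont1 g1 -> cont1 g2 -> deriv_on g g1 -> deriv_on g1 g2 ->
  (forall t, 0 < t < 1 -> Rabs (g2 t) <= K) -> 0 <= x <= 1 -> 0 <= t <= 1 ->
  Rabs (g t - g x - (t - x) * g1 x) <= K * (t - x) ^ 2.
Proof.
  intros Hg Hg1 Hg2 D1 D2 HK Hx Ht.
  set (r := fun s => g s - s * g1 x).
  assert (cr : cont1 r) by (unfold r; ct).
  assert (dr : forall s, 0 < s < 1 -> is_derive r s (g1 s - g1 x)).
  { intros s Hs. apply is_derive_minus1; [now apply D1|].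
    apply is_derive_eq1 with (1 * g1 x); [ring|]. apply is_derive_scalr1, (@is_derive_id R_AbsRing). }
  assert (cr' : cont1 (fun s => g1 s - g1 x)) by ct.
  replace (g t - g x - (t - x) * g1 x) with (r t - r x) by (unfold r; ring).
  assert (L : forall s, 0 <= s <= 1 -> Rabs (g1 s - g1 x) <= K * Rabs (s - x)) by (intros; apply (increment_abs g1 g2); auto).
  assert (K0 : 0 <= K) by (specialize (HK (1/2) ltac:(lra)); pose proof (Rabs_pos (g2 (1/2))); lra).
  rewrite <- (pow2_abs (t - x)).
  destruct (Rle_dec x t).
  - rewrite (Rabs_right (t - x)) by lra. replace (K * (t - x) ^ 2) with (K * (t - x) * (t - x)) by ring.
    apply (increment_bound r (fun s => g1 s - g1 x)); auto; intros s Hs; [apply dr; lra|].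
    eapply Rle_trans; [apply L; lra|]. rewrite Rabs_right by lra. apply Rmult_le_compat_l; lra.
  - rewrite Rabs_minus_sym, (Rabs_left (t - x)) by lra. replace (K * (- (t - x)) ^ 2) with (K * (x - t) * (x - t)) by ring.
    apply (increment_bound r (fun s => g1 s - g1 x)); auto; try lra; intros s Hs; [apply dr; lra|].
    eapply Rle_trans; [apply L; lra|]. rewrite Rabs_left by lra. apply Rmult_le_compat_l; lra.
Qed.

Definition MM (g : R -> R -> R) (x y h : R) : R := M (fun t => M (fun s => g s t) x h) y h.
Definition JJ (g : R -> R -> R) (x y h : R) : R := RInt (fun t => J (fun s => g s t) x h) (y - h) (y + h).

Lemma cont2_affine g x y a b : cont2 g -> cont2 (fun s t => g (x + a * s) (y + b * t)).
Proof.
  intros Hg. apply (cont2_comp g); auto.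
  - apply (cont2_fst (fun s => x + a * s)). ct.
  - apply (cont2_snd (fun t => y + b * t)). ct.
Qed.

Lemma cont1_M g x h : cont2 g -> cont1 (fun t => M (fun s => g s t) x h).
Proof.
  intros Hg. unfold M.
  apply (cont1_RInt_param (fun t s => (1 - s) * (g (x + h * s) t + g (x + - h * s) t))); [lra|].
  assert (c : forall a, cont2 (fun t s => g (x + a * s) t)).
  { intros a. apply (cont2_comp g); auto; [apply (cont2_snd (fun s => x + a * s))|apply (cont2_fst (fun t => t))]; ct. }
  apply cont2_mult; [apply (cont2_snd (fun s => 1 - s)); ct|]. apply cont2_plus; apply c.
Qed.

Lemma cont1_J g x h : 0 <= h -> cont2 g -> cont1 (fun t => J (fun s => g s t) x h).
Proof.
  intros Hh Hg. unfold J. apply (cont1_RInt_param (fun t s => Rabs (g s t))); [lra|]. apply cont2_abs. now apply cont2_swap.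
Qed.

(** Sum over the reflections of a point of the patch about both axes through its centre. Folding the
    double average in this way lets odd terms cancel pointwise. *)
Definition four (g : R -> R -> R) x y a b : R :=
  g (x + a) (y + b) + g (x - a) (y + b) + (g (x + a) (y - b) + g (x - a) (y - b)).

Lemma MM_four g x y h : cont2 g ->
  MM g x y h = RInt (fun t => RInt (fun s => (1 - t) * ((1 - s) * four g x y (h * s) (h * t))) 0 1) 0 1.
Proof.
  intros Hg. unfold MM, M at 1. apply RInt_ext. intros t _.
  assert (c : forall b, cont1 (fun s => (1 - s) * (g (x + h * s) b + g (x + - h * s) b))).
  { intros b. apply (cont1_M_integrand (fun s => g s b)). ct. }
  unfold M. rewrite <- RInt_plus1, <- RInt_scal1 by (first [apply c | apply cont1_plus; apply c]).
  apply RInt_ext. intros s _. unfold four.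
  replace (x + - h * s) with (x - h * s) by ring. replace (y + - h * t) with (y - h * t) by ring. eqR. ring.
Qed.

Lemma cont2_four g x y h : cont2 g -> cont2 (fun t s => (1 - t) * ((1 - s) * four g x y (h * s) (h * t))).
Proof.
  intros Hg. apply cont2_mult; [apply (cont2_fst (fun t => 1 - t)); ct|].
  apply cont2_mult; [apply (cont2_snd (fun t => 1 - t)); ct|].
  unfold four.
  assert (c : forall a b, cont2 (fun t s => g (x + a * s) (y + b * t))).
  { intros a b. apply (cont2_swap (fun s t => g (x + a * s) (y + b * t))). now apply cont2_affine. }
  apply cont2_ext with (fun t s => g (x + h * s) (y + h * t) + g (x + - h * s) (y + h * t)
     + (g (x + h * s) (y + - h * t) + g (x + - h * s) (y + - h * t))).
  - intros t s. replace (x + - h * s) with (x - h * s) by ring. replace (y + - h * t) with (y - h * t) by ring. reflexivity.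
  - repeat apply cont2_plus; apply c.
Qed.

Lemma MM_swap g x y h : cont2 g -> MM (fun s t => g t s) y x h = MM g x y h.
Proof.
  intros Hg. rewrite !MM_four by (auto using cont2_swap).
  rewrite (RInt_fubini (fun t s => (1 - t) * ((1 - s) * four g x y (h * s) (h * t)))) by (try lra; now apply cont2_four).
  apply RInt_ext; intros s _. apply RInt_ext; intros t _. unfold four. eqR. ring.
Qed.

Lemma JJ_swap g x y h : 0 <= h -> cont2 g -> JJ (fun s t => g t s) y x h = JJ g x y h.
Proof.
  intros Hh Hg. unfold JJ, J. apply (RInt_fubini (fun t s => Rabs (g t s))); try lra. now apply cont2_abs.
Qed.

Lemma MM_four_bound g x y h B : 0 < h -> cont2 g ->
  (forall a b, 0 <= a <= h -> 0 <= b <= h -> Rabs (four g x y a b) <= B) -> Rabs (MM g x y h) <= B.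
Proof.
  intros Hh Hg H. rewrite MM_four by auto.
  assert (B0 : 0 <= B) by (specialize (H 0 0 ltac:(lra) ltac:(lra)); pose proof (Rabs_pos (four g x y 0 0)); lra).
  assert (c := cont2_four g x y h Hg).
  assert (cc : cont1 (fun t => RInt (fun s => (1 - t) * ((1 - s) * four g x y (h * s) (h * t))) 0 1)).
  { apply (cont1_RInt_param (fun t s => (1 - t) * ((1 - s) * four g x y (h * s) (h * t)))); auto; lra. }
  replace B with ((1 - 0) * B) by ring. rewrite <- (RInt_const1 B 0 1).
  eapply Rle_trans; [apply RInt_abs_le1; auto; lra|]. apply RInt_le1; [lra|now apply cont1_abs|ct|].
  intros t Ht. replace B with ((1 - 0) * B) by ring. rewrite <- (RInt_const1 B 0 1).
  assert (c' : cont1 (fun s => (1 - t) * ((1 - s) * four g x y (h * s) (h * t)))).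
  { apply (cont1_y (fun t s => (1 - t) * ((1 - s) * four g x y (h * s) (h * t)))). exact c. }
  eapply Rle_trans; [apply RInt_abs_le1; auto; lra|]. apply RInt_le1; [lra|now apply cont1_abs|ct|].
  intros s Hs. rewrite !Rabs_mult, (Rabs_right (1 - t)), (Rabs_right (1 - s)) by lra.
  specialize (H (h * s) (h * t) ltac:(nra) ltac:(nra)).
  pose proof (Rabs_pos (four g x y (h * s) (h * t))).
  assert ((1 - s) * Rabs (four g x y (h * s) (h * t)) <= 1 * B) by (apply Rmult_le_compat; lra).
  assert (0 <= (1 - s) * Rabs (four g x y (h * s) (h * t))) by (apply Rmult_le_pos; lra).
  assert ((1 - t) * ((1 - s) * Rabs (four g x y (h * s) (h * t))) <= 1 * B) by (apply Rmult_le_compat; lra). lra.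
Qed.

Lemma MM_plus f g x y h : cont2 f -> cont2 g -> MM (fun a b => f a b + g a b) x y h = MM f x y h + MM g x y h.
Proof.
  intros Hf Hg. unfold MM. rewrite <- M_plus by (now apply cont1_M). apply RInt_ext. intros. rewrite !M_plus by ct. reflexivity.
Qed.
Lemma MM_minus f g x y h : cont2 f -> cont2 g -> MM (fun a b => f a b - g a b) x y h = MM f x y h - MM g x y h.
Proof.
  intros Hf Hg. unfold MM. rewrite <- M_minus by (now apply cont1_M). apply RInt_ext. intros. rewrite !M_minus by ct. reflexivity.
Qed.
Lemma MM_scal c f x y h : cont2 f -> MM (fun a b => c * f a b) x y h = c * MM f x y h.
Proof.
  intros Hf. unfold MM. rewrite <- M_scal by (now apply cont1_M). apply RInt_ext. intros. rewrite !M_scal by ct. reflexivity.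
Qed.
Lemma MM_const c x y h : MM (fun _ _ => c) x y h = c.
Proof.
  unfold MM. transitivity (M (fun _ => c) y h); [|apply M_const]. apply RInt_ext. intros. rewrite !M_const. reflexivity.
Qed.
Lemma MM_ext f g x y h : (forall a b, f a b = g a b) -> MM f x y h = MM g x y h.
Proof. intros E. unfold MM, M. apply RInt_ext; intros. do 2 f_equal; apply RInt_ext; intros; now rewrite !E. Qed.

Lemma taylor_2d P K x y a b : fam 2 P -> (forall i j x y, (i + j <= 2)%nat -> Rabs (P i j x y) <= K) ->
  0 <= x <= 1 -> 0 <= y <= 1 -> 0 <= x + a <= 1 -> 0 <= y + b <= 1 ->
  Rabs (P 0%nat 0%nat (x + a) (y + b) - P 0%nat 0%nat x y - a * P 1%nat 0%nat x y - b * P 0%nat 1%nat x y)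
    <= K * (a ^ 2 + Rabs a * Rabs b + b ^ 2).
Proof.
  intros (Hc & Hx & Hy) HK H1 H2 H3 H4.
  assert (T1 := taylor_1 (fun t => P 0%nat 0%nat t (y + b)) (fun t => P 1%nat 0%nat t (y + b)) (fun t => P 2%nat 0%nat t (y + b)) K x (x + a)
     ltac:(ct; apply Hc) ltac:(ct; apply Hc) ltac:(ct; apply Hc) ltac:(intros t Ht; apply Hx; auto; lia) ltac:(intros t Ht; apply Hx; auto; lia)
     ltac:(intros; apply HK; lia) H1 H3).
  assert (T2 := taylor_1 (fun t => P 0%nat 0%nat x t) (fun t => P 0%nat 1%nat x t) (fun t => P 0%nat 2%nat x t) K y (y + b)
     ltac:(ct; apply Hc) ltac:(ct; apply Hc) ltac:(ct; apply Hc) ltac:(intros t Ht; apply Hy; auto; lia) ltac:(intros t Ht; apply Hy; auto; lia)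
     ltac:(intros; apply HK; lia) H2 H4).
  assert (T3 := increment_abs (fun t => P 1%nat 0%nat x t) (fun t => P 1%nat 1%nat x t) K y (y + b)
     ltac:(ct; apply Hc) ltac:(ct; apply Hc) ltac:(intros t Ht; apply Hy; auto; lia) ltac:(intros; apply HK; lia) H2 H4).
  cbv beta in *. replace (x + a - x) with a in * by ring. replace (y + b - y) with b in * by ring.
  replace (P 0%nat 0%nat (x + a) (y + b) - P 0%nat 0%nat x y - a * P 1%nat 0%nat x y - b * P 0%nat 1%nat x y) with
   ((P 0%nat 0%nat (x + a) (y + b) - P 0%nat 0%nat x (y + b) - a * P 1%nat 0%nat x (y + b))
    + a * (P 1%nat 0%nat x (y + b) - P 1%nat 0%nat x y) + (P 0%nat 0%nat x (y + b) - P 0%nat 0%nat x y - b * P 0%nat 1%nat x y)) by ring.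
  eapply Rle_trans; [apply Rabs_triang|]. eapply Rle_trans; [apply Rplus_le_compat_r, Rabs_triang|].
  rewrite (Rabs_mult a).
  assert (Rabs a * Rabs (P 1%nat 0%nat x (y + b) - P 1%nat 0%nat x y) <= Rabs a * (K * Rabs b)) by (apply Rmult_le_compat_l; auto using Rabs_pos).
  lra.
Qed.

(* The linear part of [P - P(x,y)] is odd, so it cancels against the symmetric kernel. *)
Lemma MM_product P K v V L x y h : fam 2 P -> (forall i j x y, (i + j <= 2)%nat -> Rabs (P i j x y) <= K) ->
  cont2 v -> 0 < h -> 0 <= x - h -> x + h <= 1 -> 0 <= y - h -> y + h <= 1 ->
  (forall a b, Rabs a <= h -> Rabs b <= h -> Rabs (v (x + a) (y + b)) <= V) ->
  (forall a b, Rabs a <= h -> Rabs b <= h -> Rabs (v (x + a) (y + b) - v x y) <= L * h) ->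
  Rabs (MM (fun a b => (P 0%nat 0%nat a b - P 0%nat 0%nat x y) * v a b) x y h) <= K * (12 * V + 8 * L) * h ^ 2.
Proof.
  intros HP HK Hv Hh X0 X1 Y0 Y1 HV HL.
  apply MM_four_bound; auto. { destruct HP as (Hc & _). ct. apply Hc. }
  intros a b Ha Hb. unfold four.
  set (p := P 0%nat 0%nat x y). set (p1 := P 1%nat 0%nat x y). set (p2 := P 0%nat 1%nat x y). set (v0 := v x y).
  assert (K0 : 0 <= K) by (specialize (HK 0%nat 0%nat x y ltac:(lia)); pose proof (Rabs_pos (P 0%nat 0%nat x y)); lra).
  assert (k1 : Rabs p1 <= K) by (apply HK; lia). assert (k2 : Rabs p2 <= K) by (apply HK; lia).
  assert (one : forall a b, Rabs a <= h -> Rabs b <= h ->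
    Rabs ((P 0%nat 0%nat (x + a) (y + b) - p) * v (x + a) (y + b) - (a * p1 + b * p2) * v0) <= K * (3 * V + 2 * L) * h ^ 2).
  { clear a b Ha Hb. intros a b Ha Hb.
    assert (Ha' := Ha). assert (Hb' := Hb). apply Rabs_le_between in Ha'. apply Rabs_le_between in Hb'.
    assert (T := taylor_2d P K x y a b HP HK ltac:(lra) ltac:(lra) ltac:(lra) ltac:(lra)).
    fold p p1 p2 in T. specialize (HV a b Ha Hb). specialize (HL a b Ha Hb). fold v0 in HL.
    set (vv := v (x + a) (y + b)) in *. set (E := P 0%nat 0%nat (x + a) (y + b) - p - a * p1 - b * p2) in *.
    replace ((P 0%nat 0%nat (x + a) (y + b) - p) * vv - (a * p1 + b * p2) * v0) with (E * vv + (a * p1 + b * p2) * (vv - v0)) by (unfold E; ring).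
    eapply Rle_trans; [apply Rabs_triang|]. rewrite !Rabs_mult.
    pose proof (Rabs_pos a). pose proof (Rabs_pos b).
    assert (TE : Rabs E <= K * (3 * h ^ 2)).
    { eapply Rle_trans; [exact T|]. apply Rmult_le_compat_l; auto. rewrite <- (pow2_abs a), <- (pow2_abs b). nra. }
    assert (Tl : Rabs (a * p1 + b * p2) <= 2 * K * h).
    { eapply Rle_trans; [apply Rabs_triang|]. rewrite !Rabs_mult.
      assert (Rabs a * Rabs p1 <= h * K) by (apply Rmult_le_compat; auto using Rabs_pos).
      assert (Rabs b * Rabs p2 <= h * K) by (apply Rmult_le_compat; auto using Rabs_pos). lra. }
    assert (Rabs E * Rabs vv <= K * (3 * h ^ 2) * V) by (apply Rmult_le_compat; auto using Rabs_pos).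
    assert (Rabs (a * p1 + b * p2) * Rabs (vv - v0) <= 2 * K * h * (L * h)) by (apply Rmult_le_compat; auto using Rabs_pos).
    nra. }
  assert (o1 := one a b ltac:(rewrite Rabs_right; lra) ltac:(rewrite Rabs_right; lra)).
  assert (o2 := one (- a) b ltac:(rewrite Rabs_Ropp, Rabs_right; lra) ltac:(rewrite Rabs_right; lra)).
  assert (o3 := one a (- b) ltac:(rewrite Rabs_right; lra) ltac:(rewrite Rabs_Ropp, Rabs_right; lra)).
  assert (o4 := one (- a) (- b) ltac:(rewrite Rabs_Ropp, Rabs_right; lra) ltac:(rewrite Rabs_Ropp, Rabs_right; lra)).
  replace (x + - a) with (x - a) in * by ring. replace (y + - b) with (y - b) in * by ring.
  apply Rabs_le_between in o1. apply Rabs_le_between in o2. apply Rabs_le_between in o3. apply Rabs_le_between in o4.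
  apply Rabs_le. lra.
Qed.

Section Consistency.
Variables (u : nat -> nat -> R -> R -> R) (x y h : R).
Hypotheses (Hu : fam 4 u) (Hh : 0 < h) (X0 : 0 <= x - h) (X1 : x + h <= 1) (Y0 : 0 <= y - h) (Y1 : y + h <= 1).

Let cu i j : cont2 (u i j). Proof. apply Hu. Qed.
Let ux i j t : (i + j < 4)%nat -> deriv_on (fun s => u i j s t) (fun s => u (S i) j s t).
Proof. intros Hij s Hs. now apply Hu. Qed.
Let uy i j s : (i + j < 4)%nat -> deriv_on (fun t => u i j s t) (fun t => u i (S j) s t).
Proof. intros Hij t Ht. now apply Hu. Qed.
Ltac cc := ct; try apply cu.

Lemma JJ_bound_J phi (g : R -> R -> R) c : 0 <= c -> cont1 phi -> cont2 g ->
  (forall t, y - h <= t <= y + h -> Rabs (phi t) <= c * J (fun s => g s t) x h) -> J phi y h <= c * JJ g x y h.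
Proof.
  intros Hc Hphi Hg H. unfold J at 1, JJ.
  assert (cJ : cont1 (fun t => J (fun s => g s t) x h)) by (apply cont1_J; auto; lra).
  rewrite <- RInt_scal1 by auto. apply RInt_le1; [lra|ct|ct|]. intros t Ht. apply H. lra.
Qed.

Lemma JJ_ge0 g : cont2 g -> 0 <= JJ g x y h.
Proof.
  intros Hg. apply RInt_ge01; [lra|apply cont1_J; auto; lra|]. intros; apply J_ge0; [lra|ct].
Qed.

(** The average in x is exactly the second difference; only the average in y leaves an error, and it
    involves u_xxyy alone. As the patch has area 4 h^2, [JJ] is of second order. *)
Lemma average_dxx :
  Rabs (MM (u 2%nat 0%nat) x y h - (u 0%nat 0%nat (x + h) y + u 0%nat 0%nat (x - h) y - 2 * u 0%nat 0%nat x y) / h ^ 2)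
    <= JJ (u 2%nat 2%nat) x y h.
Proof.
  set (phi := fun j t => / h ^ 2 * (u 0%nat j (x + h) t + u 0%nat j (x - h) t - 2 * u 0%nat j x t)).
  assert (cphi : forall j, cont1 (phi j)) by (intros; unfold phi; cc).
  assert (dphi : forall j, (j < 4)%nat -> deriv_on (phi j) (phi (S j))).
  { intros j Hj t Ht. unfold phi. apply is_derive_scal1, is_derive_minus1; [apply is_derive_plus1|apply is_derive_scal1]; apply uy; auto. }
  assert (E : MM (u 2%nat 0%nat) x y h = M (phi 0%nat) y h).
  { unfold MM. apply M_ext; auto. intros t _.
    rewrite (M_second_derivative (fun s => u 0%nat 0%nat s t) (fun s => u 1%nat 0%nat s t)); cc; try (apply ux; lia).
    unfold phi. field. lra. }
  rewrite E. replace ((u 0%nat 0%nat (x + h) y + u 0%nat 0%nat (x - h) y - 2 * u 0%nat 0%nat x y) / h ^ 2) with (phi 0%nat y)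
    by (unfold phi; field; lra).
  eapply Rle_trans; [apply (M_error_J (phi 0%nat) (phi 1%nat) (phi 2%nat)); auto; apply dphi; lia|].
  assert (B : J (phi 2%nat) y h <= / h * JJ (u 2%nat 2%nat) x y h).
  { assert (0 < / h) by now apply Rinv_0_lt_compat.
    apply JJ_bound_J; auto; [lra|]. intros t _. unfold phi.
    assert (Q := second_difference_J (fun s => u 0%nat 2%nat s t) (fun s => u 1%nat 2%nat s t) (fun s => u 2%nat 2%nat s t) x h
      ltac:(cc) ltac:(cc) ltac:(cc) ltac:(apply ux; lia) ltac:(apply ux; lia) Hh X0 X1 1 ltac:(lra)).
    cbv beta in Q. rewrite !Rmult_1_r in Q. replace (x + - h) with (x - h) in Q by ring.
    rewrite Rabs_mult, (Rabs_right (/ h ^ 2)) by (apply Rle_ge; left; apply Rinv_0_lt_compat; nra).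
    apply Rle_trans with (/ h ^ 2 * (h * J (fun s => u 2%nat 2%nat s t) x h)).
    - apply Rmult_le_compat_l; auto. left; apply Rinv_0_lt_compat; nra.
    - right. field. lra. }
  apply Rle_trans with (h * (/ h * JJ (u 2%nat 2%nat) x y h)); [apply Rmult_le_compat_l; lra|]. right. field. lra.
Qed.

(** Here the average in x is not exact: the averaged u_x and the centred difference are each
    compared with u_x, at the cost of h [J] of u_xxx, whence the factor 2. The average in y costs
    u_xyy. *)
Lemma average_dx :
  Rabs (MM (u 1%nat 0%nat) x y h - (u 0%nat 0%nat (x + h) y - u 0%nat 0%nat (x - h) y) / (2 * h))
    <= 2 * JJ (u 3%nat 0%nat) x y h + JJ (u 1%nat 2%nat) x y h.
Proof.
  set (phi := fun j t => / (2 * h) * (u 0%nat j (x + h) t - u 0%nat j (x - h) t)).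
  assert (cphi : forall j, cont1 (phi j)) by (intros; unfold phi; cc).
  assert (dphi : forall j, (j < 4)%nat -> deriv_on (phi j) (phi (S j))).
  { intros j Hj t Ht. unfold phi. apply is_derive_scal1, is_derive_minus1; apply uy; auto. }
  assert (ih : 0 < / h) by now apply Rinv_0_lt_compat.
  assert (ih2 : 0 < / (2 * h)) by (apply Rinv_0_lt_compat; lra).
  assert (cM : cont1 (fun t => M (fun s => u 1%nat 0%nat s t) x h)) by (apply cont1_M; auto).
  assert (cJ : cont1 (fun t => J (fun s => u 3%nat 0%nat s t) x h)) by (apply cont1_J; auto; lra).
  assert (A1 : Rabs (MM (u 1%nat 0%nat) x y h - M (phi 0%nat) y h) <= 2 * JJ (u 3%nat 0%nat) x y h).
  { unfold MM. rewrite <- M_minus by auto.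
    eapply Rle_trans; [apply (M_le_J _ (fun t => 2 * h * J (fun s => u 3%nat 0%nat s t) x h)); [auto|ct; auto|ct|]|].
    - intros t _. assert (Q1 := M_error_J (fun s => u 1%nat 0%nat s t) (fun s => u 2%nat 0%nat s t) (fun s => u 3%nat 0%nat s t) x h
        ltac:(cc) ltac:(cc) ltac:(cc) ltac:(apply ux; lia) ltac:(apply ux; lia) Hh X0 X1).
      assert (Q2 := centered_difference_J (fun s => u 0%nat 0%nat s t) (fun s => u 1%nat 0%nat s t) (fun s => u 2%nat 0%nat s t) (fun s => u 3%nat 0%nat s t) x h
        ltac:(cc) ltac:(cc) ltac:(cc) ltac:(cc) ltac:(apply ux; lia) ltac:(apply ux; lia) ltac:(apply ux; lia) Hh X0 X1).
      cbv beta in Q1, Q2.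
      replace ((u 0%nat 0%nat (x + h) t - u 0%nat 0%nat (x - h) t) / (2 * h)) with (phi 0%nat t) in Q2 by (unfold phi; field; lra).
      apply Rabs_le_between in Q1. apply Rabs_le_between in Q2. apply Rabs_le. lra.
    - rewrite RInt_scal1 by auto. unfold JJ. right. field. lra. }
  assert (A2 : Rabs (M (phi 0%nat) y h - phi 0%nat y) <= JJ (u 1%nat 2%nat) x y h).
  { eapply Rle_trans; [apply (M_error_J (phi 0%nat) (phi 1%nat) (phi 2%nat)); auto; apply dphi; lia|].
    assert (B : J (phi 2%nat) y h <= / (2 * h) * JJ (u 1%nat 2%nat) x y h).
    { apply JJ_bound_J; auto; [lra|]. intros t _. unfold phi.
      rewrite Rabs_mult, (Rabs_right (/ (2 * h))) by lra. apply Rmult_le_compat_l; [lra|].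
      apply (derivative_increment_J (fun s => u 0%nat 2%nat s t) (fun s => u 1%nat 2%nat s t)); cc; try lra. apply ux; lia. }
    assert (0 <= JJ (u 1%nat 2%nat) x y h) by (apply JJ_ge0; auto).
    apply Rle_trans with (h * (/ (2 * h) * JJ (u 1%nat 2%nat) x y h)); [apply Rmult_le_compat_l; lra|].
    replace (h * (/ (2 * h) * JJ (u 1%nat 2%nat) x y h)) with (/ 2 * JJ (u 1%nat 2%nat) x y h) by (field; lra). lra. }
  replace ((u 0%nat 0%nat (x + h) y - u 0%nat 0%nat (x - h) y) / (2 * h)) with (phi 0%nat y) by (unfold phi; field; lra).
  apply Rabs_le_between in A1. apply Rabs_le_between in A2. apply Rabs_le. lra.
Qed.
End Consistency.

(** * From patch integrals to L2 norms on the square *)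

Lemma RInt_cauchy_schwarz F a b : a <= b -> cont1 F -> RInt F a b ^ 2 <= (b - a) * RInt (fun t => F t ^ 2) a b.
Proof.
  intros Hab HF. destruct (Req_dec a b) as [<-|ne].
  - rewrite !RInt_point. unfold zero; simpl. lra.
  - set (m := RInt F a b / (b - a)).
    assert (Q : 0 <= RInt (fun t => (F t - m) ^ 2) a b) by (apply RInt_ge01; [lra|ct|intros; apply pow2_ge_0]).
    rewrite (RInt_ext _ (fun t => F t ^ 2 - 2 * m * F t + m ^ 2)) in Q by (intros; eqR; ring).
    rewrite RInt_plus1, RInt_minus1, RInt_scal1, RInt_const1 in Q by ct.
    assert (E : RInt F a b = m * (b - a)) by (unfold m, Rdiv; rewrite Rmult_assoc, Rinv_l, Rmult_1_r by lra; reflexivity).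
    rewrite E in *. set (q := RInt (fun t => F t ^ 2) a b) in *.
    assert (0 <= (b - a) * (q - 2 * m * (m * (b - a)) + (b - a) * m ^ 2)) by (apply Rmult_le_pos; lra). lra.
Qed.

Lemma fsum_RInt F h m : cont1 F -> fsum (fun l => RInt F (INR l * h) (INR (S l) * h)) m = RInt F 0 (INR m * h).
Proof.
  intros HF. induction m as [|m IH].
  - simpl. rewrite Rmult_0_l, RInt_point. reflexivity.
  - change (fsum (fun l => RInt F (INR l * h) (INR (S l) * h)) (S m)) with
      (fsum (fun l => RInt F (INR l * h) (INR (S l) * h)) m + RInt F (INR m * h) (INR (S m) * h)).
    rewrite IH. now apply RInt_Chasles1.
Qed.

(** The patches of neighbouring nodes overlap, and each cell is covered at most twice. *)
Lemma fsum_patches F n h : h = / INR (S n) -> cont1 F -> (forall t, 0 <= F t) ->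
  fsum (fun l => RInt F (INR (S l) * h - h) (INR (S l) * h + h)) n <= 2 * RInt F 0 1.
Proof.
  intros Hh HF HF0.
  assert (HN : 0 < INR (S n)) by (apply lt_0_INR; lia).
  assert (hp : 0 < h) by (rewrite Hh; now apply Rinv_0_lt_compat).
  set (c := fun l => RInt F (INR l * h) (INR (S l) * h)).
  assert (c0 : forall l, 0 <= c l) by (intros l; apply RInt_ge01; auto; rewrite S_INR; lra).
  assert (E : fsum c (S n) = RInt F 0 1).
  { unfold c. rewrite fsum_RInt by auto. f_equal. rewrite Hh. field. lra. }
  rewrite (fsum_ext _ (fun l => c l + c (S l))).
  - rewrite fsum_plus. assert (fsum c n <= fsum c (S n)) by (simpl; specialize (c0 n); lra).
    assert (fsum (fun l => c (S l)) n <= fsum c (S n)) by (rewrite fsum_shift; specialize (c0 0%nat); lra). lra.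
  - intros l _. unfold c. rewrite (RInt_Chasles1 F (INR l * h) (INR (S l) * h) (INR (S (S l)) * h)) by auto.
    f_equal; rewrite !S_INR; ring.
Qed.

Lemma cont1_fsum (G : nat -> R -> R) n : (forall k, cont1 (G k)) -> cont1 (fun t => fsum (fun k => G k t) n).
Proof. intros HG. induction n; simpl; [ct|]. apply cont1_plus; auto. Qed.

Lemma RInt_fsum (G : nat -> R -> R) n a b : (forall k, cont1 (G k)) ->
  fsum (fun k => RInt (G k) a b) n = RInt (fun t => fsum (fun k => G k t) n) a b.
Proof.
  intros HG. induction n; simpl.
  - rewrite RInt_const1. ring.
  - rewrite IHn, RInt_plus1; auto. now apply cont1_fsum.
Qed.

(** Cauchy-Schwarz contributes the area 4 h^2 of a patch, and a cell lies in at most four patches;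
    together 16 h^2. *)
Lemma sum_JJ_sq g n h : h = / INR (S n) -> cont2 g ->
  fsum2 (fun k l => JJ g (INR (S k) * h) (INR (S l) * h) h ^ 2) n n <= 16 * h ^ 2 * I2 (fun x y => g x y ^ 2).
Proof.
  intros Hh Hg.
  assert (HN : 0 < INR (S n)) by (apply lt_0_INR; lia).
  assert (hp : 0 < h) by (rewrite Hh; now apply Rinv_0_lt_compat).
  assert (cg : cont2 (fun t s => g s t ^ 2)) by (apply (cont2_swap (fun s t => g s t ^ 2)); ct).
  set (G := fun k t => RInt (fun s => g s t ^ 2) (INR (S k) * h - h) (INR (S k) * h + h)).
  assert (cG : forall k, cont1 (G k)) by (intros k; apply (cont1_RInt_param (fun t s => g s t ^ 2)); auto; lra).
  assert (G0 : forall k t, 0 <= G k t) by (intros; apply RInt_ge01; [lra|ct|intros; apply pow2_ge_0]).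
  assert (P : forall k l, JJ g (INR (S k) * h) (INR (S l) * h) h ^ 2 <= 4 * h ^ 2 * RInt (G k) (INR (S l) * h - h) (INR (S l) * h + h)).
  { intros k l. set (x := INR (S k) * h). set (y := INR (S l) * h).
    assert (cJ : cont1 (fun t => J (fun s => g s t) x h)) by (apply cont1_J; auto; lra).
    unfold JJ. eapply Rle_trans; [apply RInt_cauchy_schwarz; [lra|auto]|].
    replace (y + h - (y - h)) with (2 * h) by ring.
    replace (4 * h ^ 2 * RInt (G k) (y - h) (y + h)) with (2 * h * (2 * h * RInt (G k) (y - h) (y + h))) by ring.
    apply Rmult_le_compat_l; [lra|]. rewrite <- RInt_scal1 by auto.
    apply RInt_le1; [lra|ct|ct; auto|]. intros t _.
    unfold J. eapply Rle_trans; [apply RInt_cauchy_schwarz; [lra|ct]|].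
    replace (x + h - (x - h)) with (2 * h) by ring. apply Rmult_le_compat_l; [lra|].
    right. apply RInt_ext. intros s _. apply pow2_abs. }
  eapply Rle_trans; [apply (fsum2_le _ (fun k l => 4 * h ^ 2 * RInt (G k) (INR (S l) * h - h) (INR (S l) * h + h))); auto|].
  rewrite fsum2_scal.
  replace (16 * h ^ 2 * I2 (fun x y => g x y ^ 2)) with (4 * h ^ 2 * (4 * I2 (fun x y => g x y ^ 2))) by ring.
  apply Rmult_le_compat_l; [nra|]. unfold fsum2.
  apply Rle_trans with (fsum (fun k => 2 * RInt (G k) 0 1) n).
  - apply fsum_le. intros k _. apply fsum_patches; auto.
  - rewrite fsum_scal, RInt_fsum by auto.
    assert (Q : RInt (fun t => fsum (fun k => G k t) n) 0 1 <= 2 * I2 (fun x y => g x y ^ 2)); [|lra].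
    rewrite I2_swap by ct. rewrite <- RInt_scal1 by (apply (cont1_inner (fun t s => g s t ^ 2)); auto).
    apply RInt_le1; [lra|now apply cont1_fsum| |].
    + apply cont1_mult; [ct|]. apply (cont1_inner (fun t s => g s t ^ 2)); auto.
    + intros t _. unfold G. apply (fsum_patches (fun s => g s t ^ 2)); auto; [ct|]. intros; apply pow2_ge_0.
Qed.

(** * Extension to the plane and the continuous maximum principle *)

Definition cl (t : R) : R := Rmax 0 (Rmin 1 t).

Lemma cl_in t : 0 <= cl t <= 1.
Proof. unfold cl, Rmax, Rmin. destruct (Rle_dec 1 t); destruct (Rle_dec 0 _); lra. Qed.
Lemma cl_id t : 0 <= t <= 1 -> cl t = t.
Proof. intros H. unfold cl, Rmax, Rmin. destruct (Rle_dec 1 t); destruct (Rle_dec 0 _); lra. Qed.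
Lemma cl_lipschitz s t : Rabs (cl s - cl t) <= Rabs (s - t).
Proof.
  unfold cl, Rmax, Rmin. destruct (Rle_dec 1 t); destruct (Rle_dec 1 s); repeat destruct (Rle_dec 0 _);
  unfold Rabs; repeat destruct (Rcase_abs _); lra.
Qed.

(* Clamping extends the derivatives to the whole plane, so that continuity holds everywhere. *)
Definition clamp (k : nat) (D : nat -> nat -> R -> R -> R) : nat -> nat -> R -> R -> R :=
  fun i j x y => if Nat.leb (i + j) k then D i j (cl x) (cl y) else 0.

Lemma clamp_in k D i j x y : (i + j <= k)%nat -> in_closed x y -> clamp k D i j x y = D i j x y.
Proof.
  intros H [Hx Hy]. unfold clamp. apply Nat.leb_le in H. rewrite H, !cl_id; auto.
Qed.
Lemma clamp_cl k D i j x y : clamp k D i j x y = clamp k D i j (cl x) (cl y).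
Proof. unfold clamp. rewrite !(cl_id (cl _)) by apply cl_in. reflexivity. Qed.

(** The derivative is given only in the open square. Its integrated form passes to the limit on the
    edges y = 0 and y = 1 by continuity and is differentiated back there. *)
Lemma pdx_closed (G G' : R -> R -> R) : cont2 G -> cont2 G' ->
  (forall x y, 0 < x < 1 -> 0 < y < 1 -> is_derive (fun t => G t y) x (G' x y)) ->
  forall x y, 0 < x < 1 -> 0 <= y <= 1 -> is_derive (fun t => G t y) x (G' x y).
Proof.
  intros HG HG' Hd x y Hx Hy.
  set (x0 := x / 2).
  assert (E : forall b, x0 <= b < 1 -> G b y = G x0 y + RInt (fun t => G' t y) x0 b).
  { intros b Hb.
    apply (cont1_eq_closed (fun y => G b y) (fun y => G x0 y + RInt (fun t => G' t y) x0 b)); auto.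
    - ct.
    - apply cont1_plus; [ct|]. apply (cont1_RInt_param (fun y t => G' t y)); [lra|now apply cont2_swap].
    - clear y Hy. intros y Hy. rewrite (RInt_derive_open (fun t => G t y) (fun t => G' t y)); ct; try lra.
      apply Hd; unfold x0 in *; lra. }
  apply is_derive_ext_loc with (fun b => G x0 y + RInt (fun t => G' t y) x0 b).
  - assert (Hm : 0 < Rmin (x / 2) (1 - x)) by (apply Rmin_pos; lra).
    exists (mkposreal _ Hm). intros b Hb. symmetry. apply E.
    change (Rabs (b - x) < Rmin (x / 2) (1 - x)) in Hb.
    pose proof (Rmin_l (x / 2) (1 - x)). pose proof (Rmin_r (x / 2) (1 - x)).
    apply Rabs_lt_between' in Hb. unfold x0. lra.
  - apply is_derive_eq1 with (0 + G' x y); [ring|].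
    apply (is_derive_plus1 (fun _ => G x0 y)); [apply (@is_derive_const R_AbsRing)|].
    apply (is_derive_RInt1 (fun t => G' t y)). ct.
Qed.

Lemma clamp_cont2 k gamma D i j : holder_family k gamma D -> cont2 (clamp k D i j).
Proof.
  intros (_ & Hc & _). unfold clamp. destruct (Nat.leb_spec (i + j) k) as [Hij|]; [|ct].
  intros x y e.
  destruct (Hc i j Hij (cl x) (cl y) (conj (cl_in x) (cl_in y)) e (cond_pos e)) as [d [Hd H]].
  exists (mkposreal d Hd). intros u v Hu Hv. simpl in *.
  apply H.
  - split; apply cl_in.
  - eapply Rle_lt_trans; [apply cl_lipschitz|auto].
  - eapply Rle_lt_trans; [apply cl_lipschitz|auto].
Qed.

Lemma is_derive_cl (g : R -> R) x l : 0 < x < 1 -> is_derive g x l -> is_derive (fun t => g (cl t)) x l.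
Proof.
  intros Hx Hg. apply is_derive_ext_loc with g; auto.
  apply locally_unit_interval; auto. intros u Hu. rewrite cl_id; auto; lra.
Qed.

Lemma clamp_fam k gamma D : holder_family k gamma D -> fam k (clamp k D).
Proof.
  intros H. assert (c := fun i j => clamp_cont2 k gamma D i j H). destruct H as (Hd & _ & _).
  assert (E : forall i j x y, (i + j < k)%nat -> clamp k D i j x y = D i j (cl x) (cl y)).
  { intros i j x y Hij. unfold clamp. assert (Nat.leb (i + j) k = true) as -> by (apply Nat.leb_le; lia). reflexivity. }
  assert (E1 : forall i j x y, (i + j < k)%nat -> clamp k D (S i) j x y = D (S i) j (cl x) (cl y)).
  { intros i j x y Hij. unfold clamp. assert (Nat.leb (S i + j) k = true) as -> by (apply Nat.leb_le; lia). reflexivity. }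
  assert (E2 : forall i j x y, (i + j < k)%nat -> clamp k D i (S j) x y = D i (S j) (cl x) (cl y)).
  { intros i j x y Hij. unfold clamp. assert (Nat.leb (i + S j) k = true) as -> by (apply Nat.leb_le; lia). reflexivity. }
  split; [exact c|split].
  - intros i j Hij x y Hx.
    apply is_derive_ext with (fun t => clamp k D i j t (cl y)).
    { intros t. rewrite !E, (cl_id (cl y)) by (auto using cl_in). reflexivity. }
    replace (clamp k D (S i) j x y) with (clamp k D (S i) j x (cl y)) by (rewrite !E1, (cl_id (cl y)) by (auto using cl_in); reflexivity).
    apply (pdx_closed (clamp k D i j) (clamp k D (S i) j)); auto using cl_in.
    clear x y Hx. intros x y Hx Hy. rewrite E1, (cl_id x), (cl_id y) by (auto; lra).
    apply is_derive_ext with (fun t => D i j (cl t) y). { intros t. rewrite E, (cl_id y) by (auto; lra). reflexivity. }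
    apply (is_derive_cl (fun t => D i j t y)); auto. apply Hd; auto. split; auto.
  - intros i j Hij x y Hy.
    apply is_derive_ext with (fun t => clamp k D i j (cl x) t).
    { intros t. rewrite !E, (cl_id (cl x)) by (auto using cl_in). reflexivity. }
    replace (clamp k D i (S j) x y) with (clamp k D i (S j) (cl x) y) by (rewrite !E2, (cl_id (cl x)) by (auto using cl_in); reflexivity).
    apply (pdx_closed (fun y x => clamp k D i j x y) (fun y x => clamp k D i (S j) x y)); auto using cl_in, cont2_swap.
    clear x y Hy. intros y x Hy Hx. rewrite E2, (cl_id x), (cl_id y) by (auto; lra).
    apply is_derive_ext with (fun t => D i j x (cl t)). { intros t. rewrite E, (cl_id x) by (auto; lra). reflexivity. }
    apply (is_derive_cl (fun t => D i j x t)); auto. apply Hd; auto. split; auto.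
Qed.

Lemma fam_le k m D : (m <= k)%nat -> fam k D -> fam m D.
Proof. intros H (H1 & H2 & H3). split; [auto|split; intros; [apply H2|apply H3]; lia]. Qed.

Lemma fam_scal k c D : fam k D -> fam k (fun i j x y => c * D i j x y).
Proof.
  intros (H1 & H2 & H3). split; [|split].
  - intros. apply cont2_mult; [apply cont2_const|]. apply (cont2_ext (D i j)); auto.
  - intros i j Hij x y Hx. apply (is_derive_scal1 (fun t => D i j t y)). now apply H2.
  - intros i j Hij x y Hy. apply (is_derive_scal1 (fun t => D i j x t)). now apply H3.
Qed.

(** The maximum over the square is found by maximising in one variable at a time. Written as a least
    upper bound, the inner maximum is a function of x without choosing maximisers. *)
Definition sup_y (g : R -> R -> R) (x : R) : R := real (Lub_Rbar (fun r => exists y, 0 <= y <= 1 /\ r = g x y)).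

Lemma sup_y_spec g x : cont2 g -> exists y, 0 <= y <= 1 /\ sup_y g x = g x y /\ forall y', 0 <= y' <= 1 -> g x y' <= sup_y g x.
Proof.
  intros Hg. destruct (continuity_ab_maj (fun y => g x y) 0 1 Rle_0_1 (fun c _ => cont1_y g x Hg c)) as (m & Hm & Hm').
  exists m. assert (E : sup_y g x = g x m).
  { unfold sup_y. rewrite (is_lub_Rbar_unique _ (Finite (g x m))); auto. split.
    - intros r (y & Hy & ->). simpl. now apply Hm.
    - intros b Hb. apply Hb. eauto. }
  rewrite E. auto.
Qed.

Lemma sup_y_cont g : cont2 g -> cont1 (sup_y g).
Proof.
  intros Hg x e He.
  assert (He2 : 0 < e / 2) by lra.
  destruct (uniform_continuity_2d_1d' g 0 1 x (fun y _ => Hg x y) (mkposreal _ He2)) as [d Hd]. simpl in Hd.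
  exists d. split; [apply cond_pos|]. intros u [_ Hu]. simpl in *. unfold R_dist in *.
  assert (P := cond_pos d). assert (Hu' := Hu). apply Rabs_lt_between' in Hu'.
  assert (K : forall y, 0 <= y <= 1 -> Rabs (g u y - g x y) < e / 2).
  { intros y Hy. apply (Hd y x y u); try lra. rewrite Rminus_diag, Rabs_R0; lra. }
  destruct (sup_y_spec g x Hg) as (y1 & Hy1 & E1 & B1). destruct (sup_y_spec g u Hg) as (y2 & Hy2 & E2 & B2).
  assert (K1 := K y1 Hy1). assert (K2 := K y2 Hy2). specialize (B1 y2 Hy2). specialize (B2 y1 Hy1).
  apply Rabs_lt_between in K1. apply Rabs_lt_between in K2.
  apply Rabs_lt_between. lra.
Qed.

Lemma max_square g : cont2 g -> exists x y, in_closed x y /\ forall x' y', in_closed x' y' -> g x' y' <= g x y.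
Proof.
  intros Hg. destruct (continuity_ab_maj (sup_y g) 0 1 Rle_0_1 (fun c _ => sup_y_cont g Hg c)) as (x & Hx & Hx').
  destruct (sup_y_spec g x Hg) as (y & Hy & E & B). exists x, y. split; [split; auto|].
  intros x' y' [H1 H2]. destruct (sup_y_spec g x' Hg) as (z & _ & _ & B').
  specialize (B' y' H2). specialize (Hx x' H1). lra.
Qed.

Lemma bounded_square g : cont2 g -> exists K, 0 <= K /\ forall x y, in_closed x y -> Rabs (g x y) <= K.
Proof.
  intros Hg. destruct (max_square (fun x y => Rabs (g x y)) (cont2_abs g Hg)) as (x & y & _ & H).
  exists (Rabs (g x y)). split; [apply Rabs_pos|auto].
Qed.

Lemma fam_bounded k gamma D m : holder_family k gamma D -> exists K, 1 <= K /\
  forall i j x y, (i + j <= m)%nat -> Rabs (clamp k D i j x y) <= K.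
Proof.
  intros H.
  assert (B : forall i j, exists K, 0 <= K /\ forall x y, Rabs (clamp k D i j x y) <= K).
  { intros i j. destruct (bounded_square _ (clamp_cont2 k gamma D i j H)) as (K & HK & HB).
    exists K. split; auto. intros x y. rewrite clamp_cl. apply HB. split; apply cl_in. }
  assert (B1 : forall p i, exists K, 0 <= K /\ forall j x y, (j <= p)%nat -> Rabs (clamp k D i j x y) <= K).
  { induction p as [|p IH]; intros i.
    - destruct (B i 0%nat) as (K & HK & HB). exists K. split; auto. intros j x y Hj. replace j with 0%nat by lia. auto.
    - destruct (IH i) as (K & HK & HB). destruct (B i (S p)) as (K' & HK' & HB'). exists (K + K'). split; [lra|].
      intros j x y Hj. destruct (Nat.eq_dec j (S p)) as [->|].
      + specialize (HB' x y). lra.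
      + specialize (HB j x y ltac:(lia)). lra. }
  assert (B2 : forall p, exists K, 0 <= K /\ forall i j x y, (i <= p)%nat -> (j <= m)%nat -> Rabs (clamp k D i j x y) <= K).
  { induction p as [|p IH].
    - destruct (B1 m 0%nat) as (K & HK & HB). exists K. split; auto. intros i j x y Hi Hj. replace i with 0%nat by lia. auto.
    - destruct IH as (K & HK & HB). destruct (B1 m (S p)) as (K' & HK' & HB'). exists (K + K'). split; [lra|].
      intros i j x y Hi Hj. destruct (Nat.eq_dec i (S p)) as [->|].
      + specialize (HB' j x y Hj). lra.
      + specialize (HB i j x y ltac:(lia) Hj). lra. }
  destruct (B2 m) as (K & HK & HB). exists (K + 1). split; [lra|]. intros i j x y Hij.
  specialize (HB i j x y ltac:(lia) ltac:(lia)). lra.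
Qed.

Lemma positive_near g x0 : cont1 g -> 0 < g x0 -> exists d, 0 < d /\ forall t, Rabs (t - x0) < d -> 0 < g t.
Proof.
  intros Hg H0. destruct (Hg x0 (g x0) H0) as (d & Hd & H). exists d. split; auto. intros t Ht.
  destruct (Req_dec t x0) as [->|ne]; auto.
  specialize (H t). simpl in H. unfold R_dist in H.
  assert (Q : Rabs (g t - g x0) < g x0) by (apply H; split; [split; [exact I|auto]|auto]).
  apply Rabs_lt_between in Q. lra.
Qed.

Lemma derivative_at_max g g' x0 : cont1 g -> cont1 g' -> deriv_on g g' -> 0 < x0 < 1 ->
  (forall t, 0 <= t <= 1 -> g t <= g x0) -> g' x0 <= 0.
Proof.
  intros Hg Hg' Hd Hx Hm. destruct (Rle_dec (g' x0) 0) as [|np]; auto. exfalso.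
  destruct (positive_near g' x0 Hg' ltac:(lra)) as (d & Hd0 & Hp).
  set (e := Rmin (d / 2) ((1 - x0) / 2)).
  assert (e0 : 0 < e) by (apply Rmin_pos; lra). assert (e <= d / 2) by apply Rmin_l. assert (e <= (1 - x0) / 2) by apply Rmin_r.
  destruct (MVT_gen g x0 (x0 + e) g') as (c & Hc & E).
  - rewrite Rmin_left, Rmax_right by lra. intros; apply Hd; lra.
  - intros; apply Hg.
  - rewrite Rmin_left, Rmax_right in Hc by lra.
    specialize (Hp c ltac:(rewrite Rabs_right; lra)). specialize (Hm (x0 + e) ltac:(lra)).
    assert (0 < g' c * (x0 + e - x0)) by (apply Rmult_lt_0_compat; lra). lra.
Qed.

Lemma derivative_zero_at_max g g' x0 : cont1 g -> cont1 g' -> deriv_on g g' -> 0 < x0 < 1 ->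
  (forall t, 0 <= t <= 1 -> g t <= g x0) -> g' x0 = 0.
Proof.
  intros Hg Hg' Hd Hx Hm. apply Rle_antisym; [now apply (derivative_at_max g g')|].
  assert (Q : - g' (1 - (1 - x0)) <= 0).
  { apply (derivative_at_max (fun t => g (1 - t)) (fun t => - g' (1 - t)) (1 - x0)).
    - apply (cont1_comp g); ct.
    - apply cont1_opp, (cont1_comp g'); ct.
    - intros t Ht. apply is_derive_eq1 with ((0 - 1) * g' (1 - t)); [ring|].
      apply (is_derive_comp g (fun t => 1 - t)); [apply Hd; lra|].
      apply is_derive_minus1; [apply (@is_derive_const R_AbsRing)|apply (@is_derive_id R_AbsRing)].
    - lra.
    - intros t Ht. replace (1 - (1 - x0)) with x0 by ring. apply Hm. lra. }
  replace (1 - (1 - x0)) with x0 in Q by ring. lra.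
Qed.

Lemma second_derivative_at_max g g1 g2 x0 : cont1 g -> cont1 g1 -> cont1 g2 -> deriv_on g g1 -> deriv_on g1 g2 ->
  0 < x0 < 1 -> (forall t, 0 <= t <= 1 -> g t <= g x0) -> g2 x0 <= 0.
Proof.
  intros Hg Hg1 Hg2 D1 D2 Hx Hm. destruct (Rle_dec (g2 x0) 0) as [|np]; auto. exfalso.
  assert (Z := derivative_zero_at_max g g1 x0 Hg Hg1 D1 Hx Hm).
  destruct (positive_near g2 x0 Hg2 ltac:(lra)) as (d & Hd0 & Hp).
  set (e := Rmin (d / 2) ((1 - x0) / 2)).
  assert (e0 : 0 < e) by (apply Rmin_pos; lra). assert (e <= d / 2) by apply Rmin_l. assert (e <= (1 - x0) / 2) by apply Rmin_r.
  assert (P1 : forall t, x0 < t <= x0 + e -> 0 < g1 t).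
  { intros t Ht. destruct (MVT_gen g1 x0 t g2) as (c & Hc & E).
    - rewrite Rmin_left, Rmax_right by lra. intros; apply D2; lra.
    - intros; apply Hg1.
    - rewrite Rmin_left, Rmax_right in Hc by lra. specialize (Hp c ltac:(rewrite Rabs_right; lra)).
      assert (0 < g2 c * (t - x0)) by (apply Rmult_lt_0_compat; lra). lra. }
  assert (Q : 0 < RInt g1 (x0 + e / 2) (x0 + e)).
  { apply RInt_gt_0; [lra|intros; apply P1; lra|]. intros; now apply cont1_continuous. }
  assert (Q' : 0 <= RInt g1 x0 (x0 + e / 2)) by (apply RInt_ge01; auto; [lra|intros; left; apply P1; lra]).
  assert (E := RInt_derive_open g g1 x0 (x0 + e) ltac:(lra) Hg Hg1 ltac:(intros; apply D1; lra)).
  rewrite <- (RInt_Chasles1 g1 x0 (x0 + e / 2)) in E by auto. specialize (Hm (x0 + e) ltac:(lra)). lra.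
Qed.

(** At a positive interior maximum of s u - M x one has s u_x = M, s u_y = 0 and a nonpositive
    Laplacian, whereas the equation makes the Laplacian of s u at least P M - s S, which is
    positive. The sign s covers both bounds. *)
Lemma continuous_max_principle u P Q R S M s : fam 2 u -> s = 1 \/ s = -1 -> 0 < M ->
  (forall x y, in_open x y -> u 2%nat 0%nat x y + u 0%nat 2%nat x y =
     P x y * u 1%nat 0%nat x y + Q x y * u 0%nat 1%nat x y + R x y * u 0%nat 0%nat x y - S x y) ->
  (forall x y, in_open x y -> 0 <= R x y /\ Rabs (S x y) < P x y * M) ->
  (forall x y, on_boundary x y -> u 0%nat 0%nat x y = 0) ->
  forall x y, in_closed x y -> s * u 0%nat 0%nat x y <= M.
Proof.
  intros (Hc & Hx & Hy) Hs HM Hpde HR Hb.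
  set (v := fun x y => s * u 0%nat 0%nat x y - M * x).
  assert (cv : cont2 v).
  { apply cont2_minus; [apply cont2_mult; [ct|apply Hc]|]. apply cont2_mult; [ct|]. apply (cont2_fst (fun x => x)); ct. }
  destruct (max_square v cv) as (x0 & y0 & [X0 Y0] & Hmax).
  assert (V : v x0 y0 <= 0).
  { destruct (Rle_dec (v x0 y0) 0) as [|np]; auto. exfalso.
    assert (NB : ~ on_boundary x0 y0).
    { intros B. apply np. unfold v. rewrite (Hb _ _ B). nra. }
    assert (IO : in_open x0 y0).
    { assert (x0 <> 0 /\ x0 <> 1 /\ y0 <> 0 /\ y0 <> 1) as (n1 & n2 & n3 & n4).
      { repeat split; intros ->; apply NB; split; try (split; lra); auto. }
      split; lra. }
    destruct IO as [IX IY].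
    assert (cu : forall i j, cont1 (fun x => u i j x y0)) by (intros; apply cont1_x, Hc).
    assert (cu' : forall i j, cont1 (fun y => u i j x0 y)) by (intros; apply cont1_y, Hc).
    assert (dx0 : deriv_on (fun x => v x y0) (fun x => s * u 1%nat 0%nat x y0 - M * 1)).
    { intros t Ht. apply is_derive_minus1; apply is_derive_scal1; [apply Hx; auto; lia|apply (@is_derive_id R_AbsRing)]. }
    assert (dx1 : deriv_on (fun x => s * u 1%nat 0%nat x y0 - M * 1) (fun x => s * u 2%nat 0%nat x y0)).
    { intros t Ht. apply is_derive_eq1 with (s * u 2%nat 0%nat t y0 - 0); [ring|].
      apply is_derive_minus1; [apply is_derive_scal1; apply Hx; auto; lia|apply (@is_derive_const R_AbsRing)]. }
    assert (dy0 : deriv_on (fun y => v x0 y) (fun y => s * u 0%nat 1%nat x0 y)).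
    { intros t Ht. apply is_derive_eq1 with (s * u 0%nat 1%nat x0 t - 0); [ring|].
      apply is_derive_minus1; [apply is_derive_scal1; apply Hy; auto; lia|apply (@is_derive_const R_AbsRing)]. }
    assert (dy1 : deriv_on (fun y => s * u 0%nat 1%nat x0 y) (fun y => s * u 0%nat 2%nat x0 y)).
    { intros t Ht. apply is_derive_scal1; apply Hy; auto; lia. }
    assert (mx : forall t, 0 <= t <= 1 -> v t y0 <= v x0 y0) by (intros; apply Hmax; split; auto).
    assert (my : forall t, 0 <= t <= 1 -> v x0 t <= v x0 y0) by (intros; apply Hmax; split; auto).
    assert (E1 := derivative_zero_at_max (fun x => v x y0) (fun x => s * u 1%nat 0%nat x y0 - M * 1) x0 (cont1_x v y0 cv) ltac:(ct; auto) dx0 IX mx).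
    assert (E2 := derivative_zero_at_max (fun y => v x0 y) (fun y => s * u 0%nat 1%nat x0 y) y0 (cont1_y v x0 cv) ltac:(ct; auto) dy0 IY my).
    assert (F1 := second_derivative_at_max (fun x => v x y0) (fun x => s * u 1%nat 0%nat x y0 - M * 1) (fun x => s * u 2%nat 0%nat x y0) x0 (cont1_x v y0 cv) ltac:(ct; auto) ltac:(ct; auto) dx0 dx1 IX mx).
    assert (F2 := second_derivative_at_max (fun y => v x0 y) (fun y => s * u 0%nat 1%nat x0 y) (fun y => s * u 0%nat 2%nat x0 y) y0 (cont1_y v x0 cv) ltac:(ct; auto) ltac:(ct; auto) dy0 dy1 IY my).
    cbv beta in *.
    specialize (Hpde x0 y0 (conj IX IY)). destruct (HR x0 y0 (conj IX IY)) as [R0 S0]. apply Rabs_lt_between in S0.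
    assert (G : s * (u 2%nat 0%nat x0 y0 + u 0%nat 2%nat x0 y0) = P x0 y0 * (s * u 1%nat 0%nat x0 y0) + Q x0 y0 * (s * u 0%nat 1%nat x0 y0)
       + R x0 y0 * (s * u 0%nat 0%nat x0 y0) - s * S x0 y0) by (rewrite Hpde; ring).
    rewrite E2 in G. replace (s * u 1%nat 0%nat x0 y0) with M in G by lra.
    assert (Su : 0 <= s * u 0%nat 0%nat x0 y0) by (unfold v in np; nra).
    assert (0 <= R x0 y0 * (s * u 0%nat 0%nat x0 y0)) by (apply Rmult_le_pos; auto).
    destruct Hs as [-> | ->]; lra. }
  intros x y Hxy. specialize (Hmax x y Hxy). destruct Hxy as [[? ?] _]. unfold v in *. nra.
Qed.

(** * The scheme on a uniform mesh *)

Lemma sigma_gt_0 t : t <> 0 -> 0 < Defs.sigma t.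
Proof.
  intros Ht. unfold Defs.sigma. destruct (Rlt_dec 0 t).
  - assert (exp (- t) < 1) by (rewrite <- exp_0; apply exp_increasing; lra). apply Rdiv_lt_0_compat; lra.
  - assert (1 < exp (- t)) by (rewrite <- exp_0; apply exp_increasing; lra).
    replace (t / (1 - exp (- t))) with (- t / (exp (- t) - 1)) by (field; lra). apply Rdiv_lt_0_compat; lra.
Qed.

Lemma Rabs_mult_le a b A B : Rabs a <= A -> Rabs b <= B -> Rabs (a * b) <= A * B.
Proof. intros. rewrite Rabs_mult. apply Rmult_le_compat; auto using Rabs_pos. Qed.
Lemma Rabs_plus_le a b A B : Rabs a <= A -> Rabs b <= B -> Rabs (a + b) <= A + B.
Proof. intros. eapply Rle_trans; [apply Rabs_triang|]. lra. Qed.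
Lemma Rabs_minus_le a b A B : Rabs a <= A -> Rabs b <= B -> Rabs (a - b) <= A + B.
Proof. intros. unfold Rminus. apply Rabs_plus_le; auto. now rewrite Rabs_Ropp. Qed.

Definition rho_edge (eps h a b : R) : R := (a + b) / 2 * h / eps.

(* [am, a0, ap] are the values of a convection coefficient at three consecutive nodes of a grid line. *)
Record edge_data (eps0 eps alpha K h am a0 ap : R) : Prop := {
  ed_eps0 : 0 < eps0; ed_eps : eps0 <= eps <= 1; ed_h : 0 < h <= 1; ed_alpha : 0 < alpha; ed_K : 1 <= K;
  ed_am : alpha <= am <= K; ed_a0 : alpha <= a0 <= K; ed_ap : alpha <= ap <= K;
  ed_d1 : Rabs (a0 - am) <= K * h; ed_d2 : Rabs (ap - a0) <= K * h; ed_dd : Rabs (ap - 2 * a0 + am) <= 2 * K * h ^ 2 }.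

Section Direction.
Variables (eps0 eps alpha K h am a0 ap : R) (s : scheme).
Hypothesis (HD : edge_data eps0 eps alpha K h am a0 ap).

Let L := K / eps0.
Let r1 := rho_edge eps h am a0.
Let r2 := rho_edge eps h a0 ap.
(** This is the central weight Q^C divided by the mesh size. *)
Let q := 1 + scheme_sign s * (th r1 - th r2).

Let eps0_le : eps0 <= 1. Proof. destruct HD. lra. Qed.
Lemma L_ge_K : K <= L.
Proof.
  destruct HD. unfold L. apply Rmult_le_reg_r with eps0; auto. unfold Rdiv. rewrite Rmult_assoc, Rinv_l by lra.
  assert (eps0 <= 1) by lra. nra.
Qed.
Let L1 : 1 <= L. Proof. pose proof L_ge_K. destruct HD. lra. Qed.
Let eps_pos : 0 < eps. Proof. destruct HD; lra. Qed.

Let scale_le x B : 0 <= x <= B * h -> 0 <= B -> x * h / eps <= B / eps0 * h ^ 2.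
Proof.
  intros Hx HB. destruct HD. replace (B / eps0 * h ^ 2) with (B * h * h * / eps0) by (field; lra).
  unfold Rdiv. apply Rmult_le_compat; [nra|left; now apply Rinv_0_lt_compat| nra|apply Rinv_le_contravar; lra].
Qed.

(** The coefficient varies by O(h) between the two edges and rho carries another factor h. The
    resulting h^2 makes [q] differ from 1 only at second order, for each scheme. *)
Lemma rho_edge_bounds : 0 < r1 <= L * h /\ 0 < r2 <= L * h /\ Rabs (r1 - r2) <= L * h ^ 2.
Proof.
  destruct HD. assert (G : forall a b, alpha <= a <= K -> alpha <= b <= K -> 0 < rho_edge eps h a b <= L * h).
  { intros a b Ha Hb. unfold rho_edge, L. split.
    - apply Rdiv_lt_0_compat; auto. nra.
    - replace (K / eps0 * h) with (K * h * / eps0) by (field; lra).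
      unfold Rdiv. apply Rmult_le_compat; [nra|left; now apply Rinv_0_lt_compat|nra|apply Rinv_le_contravar; lra]. }
  split; [now apply G|split; [now apply G|]].
  unfold r1, r2, rho_edge.
  replace ((am + a0) / 2 * h / eps - (a0 + ap) / 2 * h / eps) with (- ((a0 - am + (ap - a0)) / 2 * h / eps)) by (field; lra).
  rewrite Rabs_Ropp. unfold Rdiv at 1. rewrite !Rabs_mult, (Rabs_right h), (Rabs_right (/ eps)) by
    (try lra; apply Rle_ge; left; now apply Rinv_0_lt_compat).
  assert (Q : Rabs ((a0 - am + (ap - a0)) / 2) <= K * h).
  { unfold Rdiv. rewrite Rabs_mult, (Rabs_right (/ 2)) by lra.
    pose proof (Rabs_plus_le _ _ _ _ ed_d3 ed_d4). lra. }
  apply (scale_le _ K); [|lra]. split; [apply Rabs_pos|auto].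
Qed.

Lemma th_edge_bounds : 0 <= th r1 <= L * h / 4 /\ th r1 <= / 2 /\ 0 <= th r2 <= L * h / 4 /\ th r2 <= / 2
  /\ Rabs (th r1 - th r2) <= L * h ^ 2 / 4.
Proof.
  destruct rho_edge_bounds as (H1 & H2 & H3).
  destruct (th_bounds r1 (proj1 H1)) as [T1 T1']. destruct (th_bounds r2 (proj1 H2)) as [T2 T2'].
  pose proof (th_lipschitz r1 r2 (proj1 H1) (proj1 H2)). repeat split; lra.
Qed.

Lemma q_bounds : Rabs (q - 1) <= L * h ^ 2 / 4 /\ / 2 <= q <= 3 / 2.
Proof.
  destruct th_edge_bounds as (T1 & T1' & T2 & T2' & T3). unfold q.
  replace (1 + scheme_sign s * (th r1 - th r2) - 1) with (scheme_sign s * (th r1 - th r2)) by ring.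
  assert (S : Rabs (scheme_sign s) <= 1).
  { destruct s; simpl; [rewrite Rabs_right|rewrite Rabs_left|rewrite Rabs_R0]; lra. }
  split.
  - pose proof (Rabs_mult_le _ _ _ _ S T3). lra.
  - assert (T4 : Rabs (th r1 - th r2) <= / 2) by (apply Rabs_le; lra).
    pose proof (Rabs_mult_le _ _ _ _ S T4) as T5. apply Rabs_le_between in T5. lra.
Qed.

(** The last bound, together with [sigma (- r2) <= 1], gives the lower bound of L^N on the barrier
    x. *)
Lemma sigma_edge_bounds : 0 < Defs.sigma r1 /\ 0 < Defs.sigma (- r2) <= 1 /\
  Rabs (Defs.sigma r1 - 1) <= L * h /\ Rabs (Defs.sigma (- r2) - 1) <= L * h /\ r1 / 2 <= Defs.sigma r1 - 1.
Proof.
  destruct th_edge_bounds as (T1 & T1' & T2 & T2' & T3). destruct rho_edge_bounds as (H1 & H2 & H3).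
  assert (P2 := sigma_gt_0 (- r2) ltac:(lra)).
  rewrite sigma_pos, sigma_neg in * by lra.
  assert (0 <= r1 * th r1 <= r1 * / 2) by (split; [apply Rmult_le_pos; lra|apply Rmult_le_compat_l; lra]).
  assert (0 <= r2 * th r2 <= r2 * / 2) by (split; [apply Rmult_le_pos; lra|apply Rmult_le_compat_l; lra]).
  repeat split; try lra; apply Rabs_le; lra.
Qed.

Variables (um u0 up C : R).
Hypotheses (HC : 0 <= C) (Hd1 : Rabs (u0 - um) <= C * h) (Hd2 : Rabs (up - u0) <= C * h)
  (Hdd : Rabs (up + um - 2 * u0) <= 2 * C * h ^ 2).

Definition lx : R := eps / h * (Defs.sigma r1 * (u0 - um) / h - Defs.sigma (- r2) * (up - u0) / h).

(** In sigma = 1 + r/2 + r th the 1 gives the second difference and the odd part r/2 gives a0 times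
    the central difference, up to differences of the coefficient. The even part leaves terms in
    which two factors of order h, or a difference of [th] of order h^2, appear. No derivative of u
    beyond the second is needed. *)
Lemma lx_expand : Rabs (lx + eps * ((up + um - 2 * u0) / h ^ 2) - a0 * ((up - um) / (2 * h))) <= 2 * K * L * C * h ^ 2.
Proof.
  destruct th_edge_bounds as (T1 & T1' & T2 & T2' & T3). destruct rho_edge_bounds as (H1 & H2 & H3).
  assert (LK := L_ge_K). destruct HD. unfold lx. rewrite sigma_pos, sigma_neg by lra.
  set (A1 := (am + a0) / 2). set (A2 := (a0 + ap) / 2).
  set (d1 := (u0 - um) / h). set (d2 := (up - u0) / h).
  assert (B1 : Rabs d1 <= C).
  { unfold d1, Rdiv. rewrite Rabs_mult, (Rabs_right (/ h)) by (apply Rle_ge; left; apply Rinv_0_lt_compat; lra).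
    apply Rmult_le_reg_r with h; [lra|]. rewrite Rmult_assoc, Rinv_l by lra. lra. }
  assert (B2 : Rabs (d2 - d1) <= 2 * C * h).
  { replace (d2 - d1) with ((up + um - 2 * u0) * / h) by (unfold d1, d2; field; lra).
    rewrite Rabs_mult, (Rabs_right (/ h)) by (apply Rle_ge; left; apply Rinv_0_lt_compat; lra).
    apply Rmult_le_reg_r with h; [lra|]. rewrite Rmult_assoc, Rinv_l by lra. lra. }
  assert (E : eps / h * ((1 + r1 / 2 + r1 * th r1) * (u0 - um) / h - (1 - r2 / 2 + r2 * th r2) * (up - u0) / h)
      + eps * ((up + um - 2 * u0) / h ^ 2) - a0 * ((up - um) / (2 * h)) =
     / 4 * ((ap - 2 * a0 + am) * d1 + (ap - a0) * (d2 - d1)) +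
     ((A1 - A2) * (th r1 * d1) + A2 * ((th r1 - th r2) * d1) - A2 * (th r2 * (d2 - d1)))).
  { generalize (th r1) (th r2). intros t1 t2. unfold r1, r2, rho_edge, A1, A2, d1, d2. field. lra. }
  rewrite E.
  assert (F1 : Rabs ((ap - 2 * a0 + am) * d1 + (ap - a0) * (d2 - d1)) <= 2 * K * h ^ 2 * C + K * h * (2 * C * h)).
  { apply Rabs_plus_le; apply Rabs_mult_le; auto. }
  assert (FA : Rabs (A1 - A2) <= K * h).
  { replace (A1 - A2) with (- / 2 * ((a0 - am) + (ap - a0))) by (unfold A1, A2; field).
    rewrite Rabs_mult, (Rabs_left (- / 2)) by lra. pose proof (Rabs_plus_le _ _ _ _ ed_d3 ed_d4). lra. }
  assert (FA2 : Rabs A2 <= K) by (unfold A2; rewrite Rabs_right; lra).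
  assert (t1 : Rabs (th r1) <= L * h / 4) by (rewrite Rabs_right; lra).
  assert (t2 : Rabs (th r2) <= L * h / 4) by (rewrite Rabs_right; lra).
  assert (F2 : Rabs ((A1 - A2) * (th r1 * d1) + A2 * ((th r1 - th r2) * d1) - A2 * (th r2 * (d2 - d1)))
    <= K * h * (L * h / 4 * C) + K * (L * h ^ 2 / 4 * C) + K * (L * h / 4 * (2 * C * h))).
  { apply Rabs_minus_le; [apply Rabs_plus_le|]; repeat (apply Rabs_mult_le; auto). }
  assert (F3 := Rabs_mult_le (/ 4) _ (/ 4) _ ltac:(rewrite Rabs_right; lra) F1).
  eapply Rle_trans; [apply (Rabs_plus_le _ _ _ _ F3 F2)|].
  assert (0 <= K * C * h ^ 2) by (apply Rmult_le_pos; [apply Rmult_le_pos; lra|apply pow2_ge_0]).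
  assert (1 * (K * C * h ^ 2) <= L * (K * C * h ^ 2)) by (apply Rmult_le_compat_r; auto). lra.
Qed.

Lemma lx_bound : Rabs lx <= 5 * K * L * C.
Proof.
  assert (E := lx_expand). assert (LK := L_ge_K). destruct HD.
  assert (F1 : Rabs (eps * ((up + um - 2 * u0) / h ^ 2)) <= 1 * (2 * C)).
  { apply Rabs_mult_le; [rewrite Rabs_right; lra|]. unfold Rdiv. rewrite Rabs_mult, (Rabs_right (/ h ^ 2)).
    - apply Rmult_le_reg_r with (h ^ 2); [nra|]. rewrite Rmult_assoc, Rinv_l by nra. lra.
    - apply Rle_ge; left; apply Rinv_0_lt_compat; nra. }
  assert (F2 : Rabs (a0 * ((up - um) / (2 * h))) <= K * C).
  { apply Rabs_mult_le; [rewrite Rabs_right; lra|].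
    replace (up - um) with ((up - u0) + (u0 - um)) by ring. unfold Rdiv.
    rewrite Rabs_mult, (Rabs_right (/ (2 * h))) by (apply Rle_ge; left; apply Rinv_0_lt_compat; lra).
    apply Rmult_le_reg_r with (2 * h); [lra|]. rewrite Rmult_assoc, Rinv_l by lra.
    pose proof (Rabs_plus_le _ _ _ _ Hd2 Hd1). lra. }
  replace lx with ((lx + eps * ((up + um - 2 * u0) / h ^ 2) - a0 * ((up - um) / (2 * h)))
    - eps * ((up + um - 2 * u0) / h ^ 2) + a0 * ((up - um) / (2 * h))) by ring.
  eapply Rle_trans; [apply Rabs_plus_le; [apply Rabs_minus_le|]; eassumption|].
  assert (0 <= K * C) by nra. assert (h ^ 2 <= 1) by nra.
  assert (1 * (K * C) <= L * (K * C)) by (apply Rmult_le_compat_r; auto).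
  assert (C <= K * C) by nra.
  assert (2 * K * L * C * h ^ 2 <= 2 * K * L * C * 1) by (apply Rmult_le_compat_l; [nra|auto]). lra.
Qed.
End Direction.

(** One sequence [x] serves both coordinates, since for large N the two meshes coincide. *)
Section Uniform.
Variables (eps0 eps alpha1 alpha2 K h : R) (a1 a2 b f : R -> R -> R) (x : nat -> R) (s : scheme) (n : nat).
Hypotheses (Hx : forall i, x i = INR i * h)
  (Hn : h = / INR (S n))
  (D1 : forall k l, (k < n)%nat -> (l < n)%nat ->
     edge_data eps0 eps alpha1 K h (a1 (x k) (x (S l))) (a1 (x (S k)) (x (S l))) (a1 (x (S (S k))) (x (S l))))
  (D2 : forall k l, (k < n)%nat -> (l < n)%nat ->
     edge_data eps0 eps alpha2 K h (a2 (x (S k)) (x l)) (a2 (x (S k)) (x (S l))) (a2 (x (S k)) (x (S (S l)))))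
  (Hb : forall k l, (k < n)%nat -> (l < n)%nat -> 0 <= b (x (S k)) (x (S l)) <= K).

Let L := K / eps0.
Let x1 k l := rho_edge eps h (a1 (x k) (x (S l))) (a1 (x (S k)) (x (S l))).
Let x2 k l := rho_edge eps h (a1 (x (S k)) (x (S l))) (a1 (x (S (S k))) (x (S l))).
Let y1 k l := rho_edge eps h (a2 (x (S k)) (x l)) (a2 (x (S k)) (x (S l))).
Let y2 k l := rho_edge eps h (a2 (x (S k)) (x (S l))) (a2 (x (S k)) (x (S (S l)))).
Let c := scheme_sign s.
Let qx k l := 1 + c * (th (x1 k l) - th (x2 k l)).
Let qy k l := 1 + c * (th (y1 k l) - th (y2 k l)).

Definition scheme_stencil : stencil :=
  {| cW := fun k l => qy k l * (eps / h ^ 2) * Defs.sigma (x1 k l);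
     cE := fun k l => qy k l * (eps / h ^ 2) * Defs.sigma (- x2 k l);
     cS := fun k l => qx k l * (eps / h ^ 2) * Defs.sigma (y1 k l);
     cN := fun k l => qx k l * (eps / h ^ 2) * Defs.sigma (- y2 k l);
     c0 := fun k l => b (x (S k)) (x (S l)) * (qx k l * qy k l) |}.

Let hpos : 0 < h. Proof. rewrite Hn. apply Rinv_0_lt_compat, lt_0_INR. lia. Qed.
Let step i : x (S i) - x i = h. Proof. rewrite !Hx, S_INR. ring. Qed.
Let nat1 k : (S k - 1 = k)%nat. Proof. lia. Qed.
Let nat2 k : (S k + 1 = S (S k))%nat. Proof. lia. Qed.

Let hx1 k : hx x (S k) = h. Proof. unfold hx. rewrite nat1. apply step. Qed.
Let hbar1 k : hbar x (S k) = h. Proof. unfold hbar. rewrite nat2, !hx1. field. Qed.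
Let ky1 k : ky x (S k) = h. Proof. unfold ky. rewrite nat1. apply step. Qed.
Let kbar1 k : kbar x (S k) = h. Proof. unfold kbar. rewrite nat2, !ky1. field. Qed.

Let rx1 k l : rho1 eps a1 x x (S k) (S l) = x1 k l.
Proof. unfold rho1, x1, rho_edge. rewrite hx1, nat1. reflexivity. Qed.
Let rx2 k l : rho1 eps a1 x x (S k + 1) (S l) = x2 k l.
Proof. rewrite nat2. unfold rho1, x2, rho_edge. rewrite hx1, nat1. reflexivity. Qed.
Let ry1 k l : rho2 eps a2 x x (S k) (S l) = y1 k l.
Proof. unfold rho2, y1, rho_edge. rewrite ky1, nat1. reflexivity. Qed.
Let ry2 k l : rho2 eps a2 x x (S k) (S l + 1) = y2 k l.
Proof. rewrite nat2. unfold rho2, y2, rho_edge. rewrite ky1, nat1. reflexivity. Qed.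

Section Node.
Variables (k l : nat).
Hypotheses (Hk : (k < n)%nat) (Hl : (l < n)%nat).

Let px1 : 0 < x1 k l. Proof. apply (rho_edge_bounds _ _ _ _ _ _ _ _ (D1 k l Hk Hl)). Qed.
Let px2 : 0 < x2 k l. Proof. apply (rho_edge_bounds _ _ _ _ _ _ _ _ (D1 k l Hk Hl)). Qed.
Let py1 : 0 < y1 k l. Proof. apply (rho_edge_bounds _ _ _ _ _ _ _ _ (D2 k l Hk Hl)). Qed.
Let py2 : 0 < y2 k l. Proof. apply (rho_edge_bounds _ _ _ _ _ _ _ _ (D2 k l Hk Hl)). Qed.

Let Qmx1 : Qmx eps a1 x x s (S k) (S l) = h * (/ 2 + c * th (x1 k l)).
Proof. unfold Qmx. rewrite rx1, hx1. now apply Qminus_th. Qed.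
Let Qpx1 : Qpx eps a1 x x s (S k) (S l) = h * (/ 2 - c * th (x2 k l)).
Proof. unfold Qpx. rewrite rx2, nat2, hx1. now apply Qplus_th. Qed.
Let Qmy1 : Qmy eps a2 x x s (S k) (S l) = h * (/ 2 + c * th (y1 k l)).
Proof. unfold Qmy. rewrite ry1, ky1. now apply Qminus_th. Qed.
Let Qpy1 : Qpy eps a2 x x s (S k) (S l) = h * (/ 2 - c * th (y2 k l)).
Proof. unfold Qpy. rewrite ry2, nat2, ky1. now apply Qplus_th. Qed.
Let QCx1 : QCx eps a1 x x s (S k) (S l) = h * qx k l.
Proof. unfold QCx. rewrite Qmx1, Qpx1. unfold qx. field. Qed.
Let QCy1 : QCy eps a2 x x s (S k) (S l) = h * qy k l.
Proof. unfold QCy. rewrite Qmy1, Qpy1. unfold qy. field. Qed.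

Lemma LN_stencil Z : LN eps a1 a2 b x x s Z (S k) (S l) = apply_stencil scheme_stencil Z k l.
Proof.
  unfold LN, LNx, LNy. rewrite QCx1, QCy1, rx1, rx2, ry1, ry2, ?hbar1, ?kbar1, ?nat2, ?hx1, ?ky1, ?nat1.
  unfold apply_stencil; simpl. field. lra.
Qed.

Lemma stencil_lx Z : apply_stencil scheme_stencil Z k l =
  qy k l * lx eps h (a1 (x k) (x (S l))) (a1 (x (S k)) (x (S l))) (a1 (x (S (S k))) (x (S l))) (Z k (S l)) (Z (S k) (S l)) (Z (S (S k)) (S l))
  + qx k l * lx eps h (a2 (x (S k)) (x l)) (a2 (x (S k)) (x (S l))) (a2 (x (S k)) (x (S (S l)))) (Z (S k) l) (Z (S k) (S l)) (Z (S k) (S (S l)))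
  + b (x (S k)) (x (S l)) * (qx k l * qy k l) * Z (S k) (S l).
Proof.
  unfold apply_stencil, lx; simpl. fold (x1 k l) (x2 k l) (y1 k l) (y2 k l). field. lra.
Qed.

Lemma Frhs_weights : Frhs eps a1 a2 f x x s (S k) (S l) =
  / 4 * ((/ 2 + c * th (x1 k l)) * ((/ 2 + c * th (y1 k l)) * f (x k) (x l) + qy k l * f (x k) (x (S l)) + (/ 2 - c * th (y2 k l)) * f (x k) (x (S (S l))))
   + qx k l * ((/ 2 + c * th (y1 k l)) * f (x (S k)) (x l) + qy k l * f (x (S k)) (x (S l)) + (/ 2 - c * th (y2 k l)) * f (x (S k)) (x (S (S l))))
   + (/ 2 - c * th (x2 k l)) * ((/ 2 + c * th (y1 k l)) * f (x (S (S k))) (x l) + qy k l * f (x (S (S k))) (x (S l)) + (/ 2 - c * th (y2 k l)) * f (x (S (S k))) (x (S (S l))))).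
Proof.
  unfold Frhs, sum3, Defs.qx, Defs.qy. rewrite Qmx1, Qpx1, Qmy1, Qpy1, QCx1, QCy1, ?hbar1, ?kbar1.
  replace (S k + 0 - 1)%nat with k by lia. replace (S k + 1 - 1)%nat with (S k) by lia. replace (S k + 2 - 1)%nat with (S (S k)) by lia.
  replace (S l + 0 - 1)%nat with l by lia. replace (S l + 1 - 1)%nat with (S l) by lia. replace (S l + 2 - 1)%nat with (S (S l)) by lia.
  field. lra.
Qed.

Let qxb : Rabs (qx k l - 1) <= L * h ^ 2 / 4 /\ / 2 <= qx k l <= 3 / 2.
Proof. apply (q_bounds _ _ _ _ _ _ _ _ s (D1 k l Hk Hl)). Qed.
Let qyb : Rabs (qy k l - 1) <= L * h ^ 2 / 4 /\ / 2 <= qy k l <= 3 / 2.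
Proof. apply (q_bounds _ _ _ _ _ _ _ _ s (D2 k l Hk Hl)). Qed.
Let KL : 1 <= K <= L.
Proof. split; [apply (ed_K _ _ _ _ _ _ _ _ (D1 k l Hk Hl))|apply (L_ge_K _ _ _ _ _ _ _ _ (D1 k l Hk Hl))]. Qed.
Let eps1 : 0 < eps <= 1.
Proof. destruct (D1 k l Hk Hl). lra. Qed.
Let h1 : 0 < h <= 1.
Proof. destruct (D1 k l Hk Hl). lra. Qed.

Lemma near_entry q sg : Rabs (q - 1) <= L * h ^ 2 / 4 -> 0 <= q <= 3 / 2 -> Rabs (sg - 1) <= L * h ->
  Rabs (q * (eps / h ^ 2) * sg - eps / h ^ 2) <= 3 * L ^ 2 / h.
Proof.
  intros Hq Hq' Hs.
  replace (q * (eps / h ^ 2) * sg - eps / h ^ 2) with (eps * (/ h * (/ h * (q * (sg - 1) + (q - 1))))) by (field; lra).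
  replace (3 * L ^ 2 / h) with (1 * (/ h * (3 * L ^ 2))) by (field; lra).
  assert (ih : Rabs (/ h) <= / h) by (rewrite Rabs_right; [lra|apply Rle_ge; left; now apply Rinv_0_lt_compat]).
  apply Rabs_mult_le; [rewrite Rabs_right; lra|]. apply Rabs_mult_le; auto.
  assert (Q : Rabs (q * (sg - 1) + (q - 1)) <= 3 / 2 * (L * h) + L * h ^ 2 / 4).
  { apply Rabs_plus_le; auto. apply Rabs_mult_le; auto. rewrite Rabs_right; lra. }
  apply Rle_trans with (/ h * (3 / 2 * (L * h) + L * h ^ 2 / 4)).
  - apply Rabs_mult_le; auto.
  - replace (/ h * (3 / 2 * (L * h) + L * h ^ 2 / 4)) with (3 / 2 * L + L * h / 4) by (field; lra).
    assert (L * h <= L * 1) by (apply Rmult_le_compat_l; lra). assert (1 * L <= L * L) by (apply Rmult_le_compat_r; lra). simpl; lra.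
Qed.

Lemma scheme_stencil_monotone_at : 0 <= cW scheme_stencil k l /\ 0 <= cE scheme_stencil k l /\ 0 <= cS scheme_stencil k l
  /\ 0 <= cN scheme_stencil k l /\ 0 <= c0 scheme_stencil k l.
Proof.
  destruct (sigma_edge_bounds _ _ _ _ _ _ _ _ (D1 k l Hk Hl)) as (s1 & s2 & _).
  destruct (sigma_edge_bounds _ _ _ _ _ _ _ _ (D2 k l Hk Hl)) as (s3 & s4 & _).
  fold (x1 k l) (x2 k l) (y1 k l) (y2 k l) in *.
  assert (e : 0 < eps / h ^ 2) by (apply Rdiv_lt_0_compat; [lra|nra]).
  destruct (Hb k l Hk Hl).
  cbn [cW cE cS cN c0 scheme_stencil]. set (ee := eps / h ^ 2) in *. clearbody ee. repeat split; repeat match goal with |- 0 <= _ * _ => apply Rmult_le_pos end; lra.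
Qed.

Lemma scheme_stencil_near_at :
    Rabs (cW scheme_stencil k l - eps / h ^ 2) <= 3 * L ^ 2 / h /\ Rabs (cE scheme_stencil k l - eps / h ^ 2) <= 3 * L ^ 2 / h /\
    Rabs (cS scheme_stencil k l - eps / h ^ 2) <= 3 * L ^ 2 / h /\ Rabs (cN scheme_stencil k l - eps / h ^ 2) <= 3 * L ^ 2 / h /\
    Rabs (c0 scheme_stencil k l) <= 3 * L ^ 2.
Proof.
  destruct (sigma_edge_bounds _ _ _ _ _ _ _ _ (D1 k l Hk Hl)) as (_ & _ & s1 & s2 & _).
  destruct (sigma_edge_bounds _ _ _ _ _ _ _ _ (D2 k l Hk Hl)) as (_ & _ & s3 & s4 & _).
  fold L (x1 k l) (x2 k l) (y1 k l) (y2 k l) in s1, s2, s3, s4.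
  destruct (Hb k l Hk Hl).
  repeat split; try (apply near_entry; try lra; assumption).
  simpl. apply Rle_trans with (K * (3 / 2 * (3 / 2))).
  - apply Rabs_mult_le; [rewrite Rabs_right; lra|]. apply Rabs_mult_le; rewrite Rabs_right; lra.
  - assert (1 * L <= L * L) by (apply Rmult_le_compat_r; lra). lra.
Qed.

(** One factor 1/2 comes from [qy], another from [sigma_edge_bounds]; what remains, eps rho / h, is
    an average of two values of a1. *)
Lemma scheme_stencil_barrier_at : alpha1 / 4 <= apply_stencil scheme_stencil (fun i _ => INR i * h) k l.
Proof.
  destruct (sigma_edge_bounds _ _ _ _ _ _ _ _ (D1 k l Hk Hl)) as (_ & s2 & _ & _ & s5).
  fold (x1 k l) (x2 k l) in *. destruct (Hb k l Hk Hl).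
  unfold apply_stencil; simpl cW; simpl cE; simpl cS; simpl cN; simpl c0. rewrite !S_INR.
  assert (X : 0 <= INR k * h) by (apply Rmult_le_pos; [apply pos_INR|lra]).
  match goal with |- _ <= ?g => replace g with
    (qy k l * (eps / h) * (Defs.sigma (x1 k l) - Defs.sigma (- x2 k l)) + b (x (S k)) (x (S l)) * (qx k l * qy k l) * ((INR k + 1) * h)) by (field; lra) end.
  assert (0 <= b (x (S k)) (x (S l)) * (qx k l * qy k l) * ((INR k + 1) * h)).
  { apply Rmult_le_pos; [apply Rmult_le_pos; [lra|apply Rmult_le_pos; lra]|lra]. }
  assert (G : alpha1 / 4 <= / 2 * (eps / h) * (x1 k l / 2)).
  { unfold x1, rho_edge. replace (/ 2 * (eps / h) * ((a1 (x k) (x (S l)) + a1 (x (S k)) (x (S l))) / 2 * h / eps / 2)) with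
      ((a1 (x k) (x (S l)) + a1 (x (S k)) (x (S l))) / 8) by (field; lra).
    destruct (D1 k l Hk Hl). lra. }
  assert (e : 0 < eps / h) by (apply Rdiv_lt_0_compat; lra).
  assert (/ 2 * (eps / h) * (x1 k l / 2) <= qy k l * (eps / h) * (Defs.sigma (x1 k l) - Defs.sigma (- x2 k l))).
  { apply Rmult_le_compat; [apply Rmult_le_pos; lra | lra | apply Rmult_le_compat_r; lra | lra]. }
  lra.
Qed.

Lemma q_product : Rabs (qx k l * qy k l - 1) <= L * h ^ 2.
Proof.
  replace (qx k l * qy k l - 1) with (qx k l * (qy k l - 1) + (qx k l - 1)) by ring.
  assert (Q : Rabs (qx k l * (qy k l - 1) + (qx k l - 1)) <= 3 / 2 * (L * h ^ 2 / 4) + L * h ^ 2 / 4).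
  { apply Rabs_plus_le; [apply Rabs_mult_le|]; try tauto. rewrite Rabs_right; lra. }
  assert (0 <= L * h ^ 2) by (apply Rmult_le_pos; [lra|apply pow2_ge_0]). lra.
Qed.

(** The factors [qx] and [qy] multiply quantities bounded by [lx_bound], so replacing them by 1
    costs only h^2; [lx_expand] does the rest. *)
Lemma LN_expand (W : nat -> nat -> R) C : 0 <= C -> Rabs (W (S k) (S l)) <= C ->
  Rabs (W (S k) (S l) - W k (S l)) <= C * h -> Rabs (W (S (S k)) (S l) - W (S k) (S l)) <= C * h ->
  Rabs (W (S (S k)) (S l) + W k (S l) - 2 * W (S k) (S l)) <= 2 * C * h ^ 2 ->
  Rabs (W (S k) (S l) - W (S k) l) <= C * h -> Rabs (W (S k) (S (S l)) - W (S k) (S l)) <= C * h ->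
  Rabs (W (S k) (S (S l)) + W (S k) l - 2 * W (S k) (S l)) <= 2 * C * h ^ 2 ->
  Rabs (apply_stencil scheme_stencil W k l
    - (- eps * ((W (S (S k)) (S l) + W k (S l) - 2 * W (S k) (S l)) / h ^ 2 + (W (S k) (S (S l)) + W (S k) l - 2 * W (S k) (S l)) / h ^ 2)
       + a1 (x (S k)) (x (S l)) * ((W (S (S k)) (S l) - W k (S l)) / (2 * h))
       + a2 (x (S k)) (x (S l)) * ((W (S k) (S (S l)) - W (S k) l) / (2 * h)) + b (x (S k)) (x (S l)) * W (S k) (S l)))
   <= 8 * K * L ^ 2 * C * h ^ 2.
Proof.
  intros HC HW U1 U2 U3 V1 V2 V3. rewrite stencil_lx.
  assert (E1 := lx_expand _ _ _ _ _ _ _ _ (D1 k l Hk Hl) _ _ _ C HC U1 U3).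
  assert (E2 := lx_expand _ _ _ _ _ _ _ _ (D2 k l Hk Hl) _ _ _ C HC V1 V3).
  assert (B1 := lx_bound _ _ _ _ _ _ _ _ (D1 k l Hk Hl) _ _ _ C HC U1 U2 U3).
  assert (B2 := lx_bound _ _ _ _ _ _ _ _ (D2 k l Hk Hl) _ _ _ C HC V1 V2 V3).
  fold L in E1, E2, B1, B2.
  set (l1 := lx eps h (a1 (x k) (x (S l))) _ _ _ _ _) in *. set (l2 := lx eps h (a2 (x (S k)) (x l)) _ _ _ _ _) in *.
  set (e1 := l1 + _ - _) in E1. set (e2 := l2 + _ - _) in E2.
  match goal with |- Rabs ?g <= _ => replace g with
    (e1 + e2 + ((qy k l - 1) * l1 + (qx k l - 1) * l2 + b (x (S k)) (x (S l)) * ((qx k l * qy k l - 1) * W (S k) (S l)))) by (unfold e1, e2; ring) end.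
  assert (bb : Rabs (b (x (S k)) (x (S l))) <= K) by (destruct (Hb k l Hk Hl); rewrite Rabs_right; lra).
  eapply Rle_trans.
  { apply Rabs_plus_le; [apply Rabs_plus_le; eassumption|]. apply Rabs_plus_le; [apply Rabs_plus_le|].
    - apply Rabs_mult_le; [apply qyb|exact B1].
    - apply Rabs_mult_le; [apply qxb|exact B2].
    - apply Rabs_mult_le; [exact bb|]. apply Rabs_mult_le; [apply q_product|exact HW]. }
  assert (P : 0 <= K * C * h ^ 2) by (apply Rmult_le_pos; [apply Rmult_le_pos; lra|apply pow2_ge_0]).
  assert (P1 : K * L * C * h ^ 2 <= K * L ^ 2 * C * h ^ 2).
  { replace (K * L * C * h ^ 2) with (L * (K * C * h ^ 2)) by ring. replace (K * L ^ 2 * C * h ^ 2) with (L * L * (K * C * h ^ 2)) by ring.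
    apply Rmult_le_compat_r; auto. assert (1 * L <= L * L) by (apply Rmult_le_compat_r; lra). lra. }
  assert (P2 : 0 <= L * (K * C * h ^ 2)) by (apply Rmult_le_pos; lra).
  lra.
Qed.

(** The weights sum to 4 qx qy. For (S1) and (S2) they are not symmetric, but the linear part of f
    is multiplied by differences such as - c (th x1 + th x2), themselves of order h, so the rule
    remains of second order. *)
Lemma Frhs_expand f1 f2 : Rabs (f (x (S k)) (x (S l))) <= K -> Rabs f1 <= K -> Rabs f2 <= K ->
  (forall d e, (d <= 2)%nat -> (e <= 2)%nat -> Rabs (f (x (k + d)%nat) (x (l + e)%nat) - f (x (S k)) (x (S l))
     - (INR d - 1) * h * f1 - (INR e - 1) * h * f2) <= 3 * K * h ^ 2) ->
  Rabs (Frhs eps a1 a2 f x x s (S k) (S l) - f (x (S k)) (x (S l))) <= 14 * K * L * h ^ 2.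
Proof.
  intros F0 F1 F2 FT. rewrite Frhs_weights.
  set (E := fun d e => f (x (k + d)%nat) (x (l + e)%nat) - f (x (S k)) (x (S l)) - (INR d - 1) * h * f1 - (INR e - 1) * h * f2).
  set (f0 := f (x (S k)) (x (S l))) in *.
  assert (R : forall d e, f (x (k + d)%nat) (x (l + e)%nat) = f0 + (INR d - 1) * h * f1 + (INR e - 1) * h * f2 + E d e).
  { intros; unfold E; ring. }
  assert (N0 : forall m, (m + 0 = m)%nat) by (intros; lia). assert (N1 : forall m, (m + 1 = S m)%nat) by (intros; lia).
  assert (N2 : forall m, (m + 2 = S (S m))%nat) by (intros; lia).
  assert (R00 := R 0%nat 0%nat). assert (R01 := R 0%nat 1%nat). assert (R02 := R 0%nat 2%nat).
  assert (R10 := R 1%nat 0%nat). assert (R12 := R 1%nat 2%nat).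
  assert (R20 := R 2%nat 0%nat). assert (R21 := R 2%nat 1%nat). assert (R22 := R 2%nat 2%nat).
  rewrite ?N0, ?N1, ?N2 in *. simpl INR in *. rewrite R00, R01, R02, R10, R12, R20, R21, R22. fold f0.
  destruct (th_edge_bounds _ _ _ _ _ _ _ _ (D1 k l Hk Hl)) as (T1 & T1' & T2 & T2' & _).
  destruct (th_edge_bounds _ _ _ _ _ _ _ _ (D2 k l Hk Hl)) as (T3 & T3' & T4 & T4' & _).
  fold L (x1 k l) (x2 k l) (y1 k l) (y2 k l) in T1, T1', T2, T2', T3, T3', T4, T4'.
  assert (Sc : Rabs c <= 1). { unfold c. destruct s; simpl; [rewrite Rabs_right|rewrite Rabs_left|rewrite Rabs_R0]; lra. }
  set (w0 := / 2 + c * th (x1 k l)). set (w2 := / 2 - c * th (x2 k l)).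
  set (v0 := / 2 + c * th (y1 k l)). set (v2 := / 2 - c * th (y2 k l)).
  assert (half : forall t, 0 <= t -> t <= / 2 -> Rabs (/ 2 + c * t) <= 1 /\ Rabs (/ 2 - c * t) <= 1).
  { intros t t0 t1. assert (Q := Rabs_mult_le c t 1 (/ 2) Sc ltac:(rewrite Rabs_right; lra)). apply Rabs_le_between in Q.
    split; apply Rabs_le; lra. }
  assert (W0 : Rabs w0 <= 1) by (apply half; lra). assert (W2 : Rabs w2 <= 1) by (apply half; lra).
  assert (V0 : Rabs v0 <= 1) by (apply half; lra). assert (V2 : Rabs v2 <= 1) by (apply half; lra).
  assert (W1 : Rabs (qx k l) <= 3 / 2) by (rewrite Rabs_right; lra).
  assert (V1 : Rabs (qy k l) <= 3 / 2) by (rewrite Rabs_right; lra).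
  match goal with |- Rabs ?g <= _ => replace g with
    (f0 * (qx k l * qy k l - 1) - / 2 * (h * (f1 * ((c * (th (x1 k l) + th (x2 k l))) * qy k l)) + h * (f2 * ((c * (th (y1 k l) + th (y2 k l))) * qx k l)))
     + / 4 * (w0 * (v0 * E 0%nat 0%nat + qy k l * E 0%nat 1%nat + v2 * E 0%nat 2%nat)
        + qx k l * (v0 * E 1%nat 0%nat + qy k l * 0 + v2 * E 1%nat 2%nat)
        + w2 * (v0 * E 2%nat 0%nat + qy k l * E 2%nat 1%nat + v2 * E 2%nat 2%nat)))
     by (unfold w0, w2, v0, v2, qx, qy; field) end.
  assert (EE : forall d e, (d <= 2)%nat -> (e <= 2)%nat -> Rabs (E d e) <= 3 * K * h ^ 2) by (intros; apply FT; auto).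
  assert (Z0 : Rabs 0 <= 3 * K * h ^ 2) by (rewrite Rabs_R0; apply Rmult_le_pos; [lra|apply pow2_ge_0]).
  assert (rowb : forall e0 e1 e2, Rabs e0 <= 3 * K * h ^ 2 -> Rabs e1 <= 3 * K * h ^ 2 -> Rabs e2 <= 3 * K * h ^ 2 ->
    Rabs (v0 * e0 + qy k l * e1 + v2 * e2) <= 4 * (3 * K * h ^ 2)).
  { intros e0 e1 e2 H0 H1 H2. eapply Rle_trans.
    - apply Rabs_plus_le; [apply Rabs_plus_le|]; (apply Rabs_mult_le; eassumption).
    - rewrite Rabs_R0 in Z0. lra. }
  assert (tt1 : Rabs (c * (th (x1 k l) + th (x2 k l))) <= 1 * (L * h / 2)) by (apply Rabs_mult_le; auto; rewrite Rabs_right; lra).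
  assert (tt2 : Rabs (c * (th (y1 k l) + th (y2 k l))) <= 1 * (L * h / 2)) by (apply Rabs_mult_le; auto; rewrite Rabs_right; lra).
  assert (hh : Rabs h <= h) by (rewrite Rabs_right; lra).
  eapply Rle_trans.
  { apply Rabs_plus_le; [apply Rabs_minus_le|].
    - apply Rabs_mult_le; [exact F0|apply q_product].
    - apply (Rabs_mult_le (/ 2) _ (/ 2)); [rewrite Rabs_right; lra|]. apply Rabs_plus_le; apply Rabs_mult_le; try exact hh; apply Rabs_mult_le; try eassumption;
      apply Rabs_mult_le; eassumption.
    - apply (Rabs_mult_le (/ 4) _ (/ 4)); [rewrite Rabs_right; lra|]. apply Rabs_plus_le; [apply Rabs_plus_le|]; apply Rabs_mult_le; try eassumption;
      apply rowb; auto. }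
  assert (P : 0 <= K * h ^ 2) by (apply Rmult_le_pos; [lra|apply pow2_ge_0]).
  assert (P1 : 1 * (K * h ^ 2) <= L * (K * h ^ 2)) by (apply Rmult_le_compat_r; lra).
  lra.
Qed.
End Node.

Lemma scheme_stencil_monotone : monotone_stencil scheme_stencil n.
Proof. intros k l Hk Hl. now apply scheme_stencil_monotone_at. Qed.
Lemma scheme_stencil_near : near_laplacian scheme_stencil n eps (3 * L ^ 2) h.
Proof. intros k l Hk Hl. now apply scheme_stencil_near_at. Qed.
End Uniform.

(** * Consistency and interpolation *)

Section Averaged.
Variables (K M0 C : R) (u P Q R S : nat -> nat -> Rdefinitions.R -> Rdefinitions.R -> Rdefinitions.R).
Hypotheses (HK : 1 <= K) (HC : 0 <= C) (H : regsol K M0 u P Q R S)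
  (Hu : forall i j x y, (i + j <= 2)%nat -> Rabs (u i j x y) <= C).
Variables (x y h : Rdefinitions.R).
Hypotheses (Hh : 0 < h) (X0 : 0 <= x - h) (X1 : x + h <= 1) (Y0 : 0 <= y - h) (Y1 : y + h <= 1).

Let cu i j : cont2 (u i j). Proof. apply (rs_u H). Qed.
Let ux i j t : (i + j < 4)%nat -> deriv_on (fun s => u i j s t) (fun s => u (Datatypes.S i) j s t).
Proof. intros Hij s Hs. now apply (rs_u H). Qed.
Let uy i j s : (i + j < 4)%nat -> deriv_on (fun t => u i j s t) (fun t => u i (Datatypes.S j) s t).
Proof. intros Hij t Ht. now apply (rs_u H). Qed.

Lemma patch_variation i j a b : (i + j <= 1)%nat -> Rabs a <= h -> Rabs b <= h ->
  Rabs (u i j (x + a) (y + b) - u i j x y) <= 2 * C * h.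
Proof.
  intros Hij Ha Hb. assert (Ha' := Ha). assert (Hb' := Hb). apply Rabs_le_between in Ha'. apply Rabs_le_between in Hb'.
  replace (u i j (x + a) (y + b) - u i j x y) with ((u i j (x + a) (y + b) - u i j x (y + b)) + (u i j x (y + b) - u i j x y)) by ring.
  eapply Rle_trans; [apply Rabs_triang|].
  assert (T1 := increment_abs (fun s => u i j s (y + b)) (fun s => u (Datatypes.S i) j s (y + b)) C x (x + a)
    ltac:(ct; apply cu) ltac:(ct; apply cu) ltac:(apply ux; lia) ltac:(intros; apply Hu; lia) ltac:(lra) ltac:(lra)).
  assert (T2 := increment_abs (fun t => u i j x t) (fun t => u i (Datatypes.S j) x t) C y (y + b)
    ltac:(ct; apply cu) ltac:(ct; apply cu) ltac:(apply uy; lia) ltac:(intros; apply Hu; lia) ltac:(lra) ltac:(lra)).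
  cbv beta in T1, T2. replace (x + a - x) with a in T1 by ring. replace (y + b - y) with b in T2 by ring.
  assert (C * Rabs a <= C * h) by (apply Rmult_le_compat_l; auto). assert (C * Rabs b <= C * h) by (apply Rmult_le_compat_l; auto). lra.
Qed.

(** Averaging commutes with a smooth coefficient up to h^2. At most one derivative falls on u, so
    its variation over the patch is bounded by second derivatives. *)
Lemma average_coefficient F i j : fam 2 F -> (forall i j x y, (i + j <= 2)%nat -> Rabs (F i j x y) <= K) -> (i + j <= 1)%nat ->
  Rabs (MM (fun a b => F 0%nat 0%nat a b * u i j a b) x y h - F 0%nat 0%nat x y * MM (u i j) x y h) <= 28 * K * C * h ^ 2.
Proof.
  intros HF HFK Hij. assert (cF : cont2 (F 0%nat 0%nat)) by apply HF.
  rewrite <- MM_scal, <- MM_minus by (ct; auto).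
  rewrite (MM_ext _ (fun a b => (F 0%nat 0%nat a b - F 0%nat 0%nat x y) * u i j a b)) by (intros; ring).
  replace (28 * K * C * h ^ 2) with (K * (12 * C + 8 * (2 * C)) * h ^ 2) by ring.
  apply MM_product; auto. intros; now apply patch_variation.
Qed.

Lemma average_function F K' : fam 2 F -> (forall i j x y, (i + j <= 2)%nat -> Rabs (F i j x y) <= K') ->
  Rabs (MM (F 0%nat 0%nat) x y h - F 0%nat 0%nat x y) <= 12 * K' * h ^ 2.
Proof.
  intros HF HFK. assert (cF : cont2 (F 0%nat 0%nat)) by apply HF.
  rewrite <- (MM_const (F 0%nat 0%nat x y) x y h), <- MM_minus by (ct; auto).
  rewrite (MM_ext _ (fun a b => (F 0%nat 0%nat a b - F 0%nat 0%nat x y) * 1)) by (intros; ring).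
  replace (12 * K' * h ^ 2) with (K' * (12 * 1 + 8 * 0) * h ^ 2) by ring.
  apply (MM_product F K' (fun _ _ => 1)); auto; [ct| |].
  - intros. rewrite Rabs_right; lra.
  - intros. rewrite Rminus_diag, Rabs_R0. lra.
Qed.

Lemma averaged_consistency :
  Rabs ((u 0%nat 0%nat (x + h) y + u 0%nat 0%nat (x - h) y - 2 * u 0%nat 0%nat x y) / h ^ 2
      + (u 0%nat 0%nat x (y + h) + u 0%nat 0%nat x (y - h) - 2 * u 0%nat 0%nat x y) / h ^ 2
      - P 0%nat 0%nat x y * ((u 0%nat 0%nat (x + h) y - u 0%nat 0%nat (x - h) y) / (2 * h))
      - Q 0%nat 0%nat x y * ((u 0%nat 0%nat x (y + h) - u 0%nat 0%nat x (y - h)) / (2 * h))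
      - R 0%nat 0%nat x y * u 0%nat 0%nat x y + S 0%nat 0%nat x y)
  <= 100 * K * (C + 1) * h ^ 2
     + 2 * K * (JJ (u 2%nat 2%nat) x y h + JJ (u 3%nat 0%nat) x y h + JJ (u 1%nat 2%nat) x y h
          + JJ (u 0%nat 3%nat) x y h + JJ (u 2%nat 1%nat) x y h).
Proof.
  assert (rb := rs_bound H).
  assert (bP : forall i j x y, (i + j <= 2)%nat -> Rabs (P i j x y) <= K) by apply rb.
  assert (bQ : forall i j x y, (i + j <= 2)%nat -> Rabs (Q i j x y) <= K) by apply rb.
  assert (bR : forall i j x y, (i + j <= 2)%nat -> Rabs (R i j x y) <= K) by apply rb.
  assert (bS : forall i j x y, (i + j <= 2)%nat -> Rabs (S i j x y) <= K) by apply rb.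
  assert (fP := rs_P H). assert (fQ := rs_Q H).
  assert (fR := rs_R H). assert (fS := rs_S H).
  assert (cP : cont2 (P 0%nat 0%nat)) by apply fP. assert (cQ : cont2 (Q 0%nat 0%nat)) by apply fQ.
  assert (cR : cont2 (R 0%nat 0%nat)) by apply fR. assert (cS : cont2 (S 0%nat 0%nat)) by apply fS.
  assert (fu := rs_u H). assert (fuT := fam_transpose _ _ fu).
  assert (a1 := average_dxx u x y h fu Hh X0 X1 Y0 Y1).
  assert (a2 := average_dxx (famT u) y x h fuT Hh Y0 Y1 X0 X1).
  assert (b1 := average_dx u x y h fu Hh X0 X1 Y0 Y1).
  assert (b2 := average_dx (famT u) y x h fuT Hh Y0 Y1 X0 X1).
  unfold famT in a2, b2.
  rewrite (MM_swap (u 0%nat 2%nat)), (JJ_swap (u 2%nat 2%nat)) in a2 by (auto; lra).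
  rewrite (MM_swap (u 0%nat 1%nat)), (JJ_swap (u 0%nat 3%nat)), (JJ_swap (u 2%nat 1%nat)) in b2 by (auto; lra).
  assert (c1 := average_coefficient P 1 0 fP bP ltac:(lia)).
  assert (c2 := average_coefficient Q 0 1 fQ bQ ltac:(lia)).
  assert (c3 := average_coefficient R 0 0 fR bR ltac:(lia)).
  assert (c4 := average_function S K fS bS).
  assert (c5 := average_function u C (fam_le 4 2 u ltac:(lia) fu) Hu).
  (* The equation enters only through its average over the patch, which is why no fourth derivative
     is evaluated at the node. *)
  assert (E : MM (u 2%nat 0%nat) x y h + MM (u 0%nat 2%nat) x y h =
     MM (fun a b => P 0%nat 0%nat a b * u 1%nat 0%nat a b) x y h + MM (fun a b => Q 0%nat 0%nat a b * u 0%nat 1%nat a b) x y h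
     + MM (fun a b => R 0%nat 0%nat a b * u 0%nat 0%nat a b) x y h - MM (S 0%nat 0%nat) x y h).
  { rewrite <- !MM_plus, <- MM_minus by (ct; auto). apply MM_ext. intros; apply (rs_pde H). }
  set (jj22 := JJ (u 2%nat 2%nat) x y h) in *. set (jj30 := JJ (u 3%nat 0%nat) x y h) in *. set (jj12 := JJ (u 1%nat 2%nat) x y h) in *.
  set (jj03 := JJ (u 0%nat 3%nat) x y h) in *. set (jj21 := JJ (u 2%nat 1%nat) x y h) in *.
  assert (p22 : 0 <= jj22) by (apply JJ_ge0; auto). assert (p30 : 0 <= jj30) by (apply JJ_ge0; auto).
  assert (p12 : 0 <= jj12) by (apply JJ_ge0; auto). assert (p03 : 0 <= jj03) by (apply JJ_ge0; auto).
  assert (p21 : 0 <= jj21) by (apply JJ_ge0; auto).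
  set (m10 := MM (u 1%nat 0%nat) x y h) in *. set (m01 := MM (u 0%nat 1%nat) x y h) in *. set (m00 := MM (u 0%nat 0%nat) x y h) in *.
  set (dx := (u 0%nat 0%nat (x + h) y - u 0%nat 0%nat (x - h) y) / (2 * h)) in *.
  set (dy := (u 0%nat 0%nat x (y + h) - u 0%nat 0%nat x (y - h)) / (2 * h)) in *.
  assert (d1 := Rabs_mult_le _ _ _ _ (bP 0%nat 0%nat x y ltac:(lia)) b1).
  assert (d2 := Rabs_mult_le _ _ _ _ (bQ 0%nat 0%nat x y ltac:(lia)) b2).
  assert (d3 := Rabs_mult_le _ _ _ _ (bR 0%nat 0%nat x y ltac:(lia)) c5).
  assert (K * jj22 >= jj22) by nra.
  apply Rabs_le_between in a1. apply Rabs_le_between in a2. apply Rabs_le_between in c1. apply Rabs_le_between in c2.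
  apply Rabs_le_between in c3. apply Rabs_le_between in c4. apply Rabs_le_between in d1. apply Rabs_le_between in d2. apply Rabs_le_between in d3.
  assert (0 <= K * h ^ 2) by (apply Rmult_le_pos; [lra|apply pow2_ge_0]).
  assert (0 <= K * C * h ^ 2) by (apply Rmult_le_pos; [apply Rmult_le_pos; lra|apply pow2_ge_0]).
  assert (0 <= K * jj30) by (apply Rmult_le_pos; lra). assert (0 <= K * jj12) by (apply Rmult_le_pos; lra).
  assert (0 <= K * jj03) by (apply Rmult_le_pos; lra). assert (0 <= K * jj21) by (apply Rmult_le_pos; lra).
  apply Rabs_le. split; lra.
Qed.
End Averaged.

(** * Bilinear interpolation on the uniform mesh *)

Lemma locate_cell h t m : 0 < h -> 0 < t <= INR m * h -> exists k, (k < m)%nat /\ INR k * h < t <= INR (S k) * h.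
Proof.
  intros Hh. induction m as [|m IH]; intros Ht.
  - simpl in Ht. lra.
  - destruct (Rle_dec t (INR m * h)).
    + destruct IH as [k [Hk Hk']]; [lra|]. exists k. split; [lia|auto].
    + exists m. split; [lia|lra].
Qed.

Lemma sum_two_terms F k m : (forall i, i <> k -> i <> S k -> F i = 0) ->
  sum_f_R0 F m = (if Nat.leb k m then F k else 0) + (if Nat.leb (S k) m then F (S k) else 0).
Proof.
  intros H. induction m as [|m IH].
  - destruct k; simpl; [ring|]. rewrite H by lia. ring.
  - rewrite tech5, IH. 
    destruct (Nat.leb_spec k m); destruct (Nat.leb_spec (S k) m); destruct (Nat.leb_spec k (S m)); destruct (Nat.leb_spec (S k) (S m)); try lia.
    + rewrite (H (S m)) by lia. ring.
    + replace m with k by lia. ring.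
    + replace (S m) with k by lia. ring.
    + rewrite (H (S m)) by lia. ring.
Qed.

(** The half-open cell assigns a node to the interval on its left, in agreement with [hat], which
    tests the left interval first. *)
Lemma hat_cell x h N k i t : (forall i, x i = INR i * h) -> 0 < h -> (k < N)%nat -> INR k * h < t <= INR (S k) * h ->
  hat x N i t = if Nat.eq_dec i (S k) then (t - INR k * h) / h else if Nat.eq_dec i k then (INR (S k) * h - t) / h else 0.
Proof.
  intros Hx Hh Hk Ht.
  assert (mono : forall a b, (a <= b)%nat -> INR a * h <= INR b * h) by (intros; apply Rmult_le_compat_r; [lra|now apply le_INR]).
  unfold hat. rewrite !Hx.
  destruct (Nat.eq_dec i (S k)) as [->|n1].
  - replace (S k - 1)%nat with k by lia. assert ((0 <? S k)%nat = true) as -> by (apply Nat.ltb_lt; lia).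
    destruct (Rle_dec (INR k * h) t); [|lra]. destruct (Rle_dec t (INR (S k) * h)); [|lra].
    cbn [andb]. f_equal. rewrite S_INR. ring.
  - destruct (Nat.eq_dec i k) as [->|n2].
    + destruct (Rle_dec t (INR k * h)); [lra|]. rewrite Bool.andb_false_r.
      replace (k + 1)%nat with (S k) by lia.
      assert ((k <? N)%nat = true) as -> by now apply Nat.ltb_lt.
      destruct (Rle_dec (INR k * h) t); [|lra]. destruct (Rle_dec t (INR (S k) * h)); [|lra].
      cbn [andb]. f_equal. rewrite S_INR. ring.
    + destruct (Nat.lt_ge_cases i k) as [lt|ge].
      * assert (INR i * h <= INR k * h) by (apply mono; lia).
        destruct (Rle_dec t (INR i * h)); [lra|]. rewrite Bool.andb_false_r.
        assert (INR (i + 1) * h <= INR k * h) by (apply mono; lia).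
        destruct (Rle_dec t (INR (i + 1) * h)); [lra|]. rewrite Bool.andb_false_r. reflexivity.
      * assert (Hi1 : INR (S k) * h <= INR (i - 1) * h) by (apply mono; lia).
        assert (Hi2 : INR (i - 1) * h + h = INR i * h) by (rewrite minus_INR by lia; simpl; ring).
        destruct (Rle_dec (INR i * h) t); [lra|]. rewrite Bool.andb_false_r. cbn [andb].
        destruct (Rle_dec (INR (i - 1) * h) t) as [r|r].
        (* The one exceptional case: t is the right end of its cell and i = k + 2, where the left
           branch of [hat] is taken but has value 0. *)
        -- assert (t = INR (i - 1) * h) by lra.
           destruct ((0 <? i)%nat && true && (if Rle_dec t (INR i * h) then true else false))%bool; [|reflexivity].
           replace (t - INR (i - 1) * h) with 0 by lra. unfold Rdiv. ring.
        -- rewrite Bool.andb_false_r. reflexivity.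
Qed.

Lemma hat_sum x h N k t g : (forall i, x i = INR i * h) -> 0 < h -> (k < N)%nat -> INR k * h < t <= INR (S k) * h ->
  sum_f_R0 (fun i => g i * hat x N i t) N = (INR (S k) * h - t) / h * g k + (t - INR k * h) / h * g (S k).
Proof.
  intros Hx Hh Hk Ht.
  rewrite (sum_two_terms _ k).
  - assert (Nat.leb k N = true) as -> by (apply Nat.leb_le; lia). assert (Nat.leb (S k) N = true) as -> by (apply Nat.leb_le; lia).
    rewrite !(hat_cell x h N k) by auto.
    destruct (Nat.eq_dec k (S k)); [lia|]. destruct (Nat.eq_dec k k); [|lia]. destruct (Nat.eq_dec (S k) (S k)); [|lia]. ring.
  - intros i n1 n2. rewrite (hat_cell x h N k) by auto.
    destruct (Nat.eq_dec i (S k)); [lia|]. destruct (Nat.eq_dec i k); [lia|]. ring.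
Qed.

Lemma linear_interpolation g g1 g2 C h k t : cont1 g -> cont1 g1 -> cont1 g2 -> deriv_on g g1 -> deriv_on g1 g2 ->
  (forall t, 0 < t < 1 -> Rabs (g2 t) <= C) -> 0 < h -> INR (S k) * h <= 1 -> INR k * h < t <= INR (S k) * h ->
  Rabs ((INR (S k) * h - t) / h * g (INR k * h) + (t - INR k * h) / h * g (INR (S k) * h) - g t) <= C * h ^ 2.
Proof.
  intros Hg Hg1 Hg2 D1 D2 HC Hh H1 Ht.
  assert (k0 : 0 <= INR k * h) by (apply Rmult_le_pos; [apply pos_INR|lra]).
  assert (Ek : INR (S k) * h = INR k * h + h) by (rewrite S_INR; ring).
  assert (C0 : 0 <= C) by (specialize (HC (1 / 2) ltac:(lra)); pose proof (Rabs_pos (g2 (1 / 2))); lra).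
  assert (T0 := taylor_1 g g1 g2 C t (INR k * h) Hg Hg1 Hg2 D1 D2 HC ltac:(lra) ltac:(lra)).
  assert (T1 := taylor_1 g g1 g2 C t (INR (S k) * h) Hg Hg1 Hg2 D1 D2 HC ltac:(lra) ltac:(lra)).
  set (a := INR k * h) in *. set (b := INR (S k) * h) in *.
  set (th := (t - a) / h). assert (E1 : (b - t) / h = 1 - th) by (unfold th; rewrite Ek; field; lra).
  assert (Hth : 0 <= th <= 1).
  { unfold th. split; [apply Rmult_le_pos; [lra|left; now apply Rinv_0_lt_compat]|].
    apply Rmult_le_reg_r with h; auto. unfold Rdiv. rewrite Rmult_assoc, Rinv_l by lra. lra. }
  rewrite E1.
  assert (Z : (1 - th) * (a - t) + th * (b - t) = 0) by (unfold th; rewrite Ek; field; lra).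
  replace ((1 - th) * g a + th * g b - g t) with
    ((1 - th) * (g a - g t - (a - t) * g1 t) + th * (g b - g t - (b - t) * g1 t) + ((1 - th) * (a - t) + th * (b - t)) * g1 t) by ring.
  rewrite Z, Rmult_0_l, Rplus_0_r.
  assert (Q0 : Rabs (g a - g t - (a - t) * g1 t) <= C * h ^ 2) by (eapply Rle_trans; [exact T0|]; apply Rmult_le_compat_l; [auto|nra]).
  assert (Q1 : Rabs (g b - g t - (b - t) * g1 t) <= C * h ^ 2) by (eapply Rle_trans; [exact T1|]; apply Rmult_le_compat_l; [auto|nra]).
  eapply Rle_trans; [apply Rabs_triang|]. rewrite !Rabs_mult, (Rabs_right (1 - th)), (Rabs_right th) by lra. nra.
Qed.

(** The nodal errors enter by convex combination and keep the bound B. Interpolating u in y on both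
    sides of the cell and then in x costs C h^2 each time. *)
Lemma bilinear_interpolation x h N u Z C B s t : (forall i, x i = INR i * h) -> 0 < h -> INR N * h = 1 -> fam 2 u ->
  (forall i j x y, (i + j <= 2)%nat -> Rabs (u i j x y) <= C) ->
  (forall i j, (i <= N)%nat -> (j <= N)%nat -> Rabs (Z i j - u 0%nat 0%nat (x i) (x j)) <= B) ->
  0 < s < 1 -> 0 < t < 1 ->
  Rabs (bilin_interp x x N Z s t - u 0%nat 0%nat s t) <= B + 2 * C * h ^ 2.
Proof.
  intros Hx Hh HN (Hc & Hux & Huy) HC HZ Hs Ht.
  destruct (locate_cell h s N Hh ltac:(lra)) as (k & Hk & Hks). destruct (locate_cell h t N Hh ltac:(lra)) as (l & Hl & Hlt).
  assert (E : forall Z, bilin_interp x x N Z s t =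
    (INR (S k) * h - s) / h * ((INR (S l) * h - t) / h * Z k l + (t - INR l * h) / h * Z k (S l))
    + (s - INR k * h) / h * ((INR (S l) * h - t) / h * Z (S k) l + (t - INR l * h) / h * Z (S k) (S l))).
  { clear Z HZ. intros Z. unfold bilin_interp.
    rewrite (sum_eq _ (fun i => ((INR (S l) * h - t) / h * Z i l + (t - INR l * h) / h * Z i (S l)) * hat x N i s)).
    - now apply (hat_sum x h N k s (fun i => (INR (S l) * h - t) / h * Z i l + (t - INR l * h) / h * Z i (S l))).
    - intros i _. rewrite <- (hat_sum x h N l t (fun j => Z i j)) by auto.
      rewrite (Rmult_comm (sum_f_R0 _ N)), scal_sum. apply sum_eq. intros; ring. }
  rewrite E.
  assert (k1 : INR (S k) * h <= 1) by (rewrite <- HN; apply Rmult_le_compat_r; [lra|apply le_INR; lia]).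
  assert (l1 : INR (S l) * h <= 1) by (rewrite <- HN; apply Rmult_le_compat_r; [lra|apply le_INR; lia]).
  assert (C0 : 0 <= C) by (specialize (HC 0%nat 0%nat s t ltac:(lia)); pose proof (Rabs_pos (u 0%nat 0%nat s t)); lra).
  assert (ly : forall p, Rabs ((INR (S l) * h - t) / h * u 0%nat 0%nat p (INR l * h) + (t - INR l * h) / h * u 0%nat 0%nat p (INR (S l) * h) - u 0%nat 0%nat p t) <= C * h ^ 2).
  { intros p. apply (linear_interpolation (fun t => u 0%nat 0%nat p t) (fun t => u 0%nat 1%nat p t) (fun t => u 0%nat 2%nat p t)); auto;
    try (ct; apply Hc); try (intros q Hq; apply Huy; auto; lia). }
  assert (lxx : Rabs ((INR (S k) * h - s) / h * u 0%nat 0%nat (INR k * h) t + (s - INR k * h) / h * u 0%nat 0%nat (INR (S k) * h) t - u 0%nat 0%nat s t) <= C * h ^ 2).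
  { apply (linear_interpolation (fun s => u 0%nat 0%nat s t) (fun s => u 1%nat 0%nat s t) (fun s => u 2%nat 0%nat s t)); auto;
    try (ct; apply Hc); try (intros q Hq; apply Hux; auto; lia). }
  assert (ly0 := ly (INR k * h)). assert (ly1 := ly (INR (S k) * h)).
  assert (w : forall a c, INR a * h < c <= INR (S a) * h -> 0 <= (c - INR a * h) / h /\ 0 <= (INR (S a) * h - c) / h /\ (INR (S a) * h - c) / h = 1 - (c - INR a * h) / h).
  { intros a c Ha. split; [|split].
    - apply Rmult_le_pos; [lra|left; now apply Rinv_0_lt_compat].
    - apply Rmult_le_pos; [lra|left; now apply Rinv_0_lt_compat].
    - rewrite S_INR. field. lra. }
  destruct (w k s Hks) as (p1 & p2 & p3). destruct (w l t Hlt) as (q1 & q2 & q3).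
  assert (z00 := HZ k l ltac:(lia) ltac:(lia)). assert (z01 := HZ k (S l) ltac:(lia) ltac:(lia)).
  assert (z10 := HZ (S k) l ltac:(lia) ltac:(lia)). assert (z11 := HZ (S k) (S l) ltac:(lia) ltac:(lia)).
  rewrite !Hx in z00, z01, z10, z11.
  rewrite p3, q3 in *.
  set (th := (s - INR k * h) / h) in *. set (ph := (t - INR l * h) / h) in *.
  apply Rabs_le_between in z00. apply Rabs_le_between in z01. apply Rabs_le_between in z10. apply Rabs_le_between in z11.
  apply Rabs_le_between in lxx. apply Rabs_le_between in ly0. apply Rabs_le_between in ly1.
  set (u00 := u 0%nat 0%nat (INR k * h) (INR l * h)) in *. set (u01 := u 0%nat 0%nat (INR k * h) (INR (S l) * h)) in *.
  set (u10 := u 0%nat 0%nat (INR (S k) * h) (INR l * h)) in *. set (u11 := u 0%nat 0%nat (INR (S k) * h) (INR (S l) * h)) in *.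
  assert (cmb : forall a b m, - m <= a <= m -> - m <= b <= m -> forall z, 0 <= z -> 0 <= 1 - z -> - m <= (1 - z) * a + z * b <= m) by (intros; nra).
  assert (r0 := cmb _ _ _ z00 z01 ph q1 q2). assert (r1 := cmb _ _ _ z10 z11 ph q1 q2).
  assert (r := cmb _ _ _ r0 r1 th p1 p2). assert (rl := cmb _ _ _ ly0 ly1 th p1 p2).
  apply Rabs_le. lra.
Qed.

Lemma node_uniform N i : (1 <= N)%nat -> Nat.even N = true -> node N (1 / 2) i = INR i * / INR N.
Proof.
  intros HN HE. apply Nat.even_spec in HE. destruct HE as [m ->].
  assert (D : (2 * m / 2 = m)%nat) by (rewrite Nat.mul_comm; apply Nat.div_mul; lia).
  assert (M : INR (2 * m) = 2 * INR m) by (rewrite mult_INR; simpl; ring).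
  assert (P : 0 < INR m) by (apply lt_0_INR; lia).
  unfold node. rewrite D, M. destruct (Nat.leb_spec i m).
  - field. lra.
  - rewrite minus_INR by lia. field. lra.
Qed.

Lemma ln_INR_large A : exists N0, forall N, (N0 <= N)%nat -> A <= ln (INR N).
Proof.
  destruct (INR_unbounded (exp A)) as [N0 H]. exists N0. intros N HN.
  assert (INR N0 <= INR N) by now apply le_INR.
  rewrite <- (ln_exp A). left. apply ln_increasing; [apply exp_pos|lra].
Qed.

Lemma tau_half eps0 eps alpha N : 0 < eps0 <= eps -> 0 < alpha -> alpha / (4 * eps0) <= ln (INR N) -> tau eps alpha N = 1 / 2.
Proof.
  intros He Ha Hl. unfold tau. apply Rmin_left.
  apply Rmult_le_reg_r with alpha; auto. unfold Rdiv at 2. rewrite Rmult_assoc, Rinv_l by lra.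
  assert (eps0 * (alpha / (4 * eps0)) <= eps0 * ln (INR N)) by (apply Rmult_le_compat_l; lra).
  replace (eps0 * (alpha / (4 * eps0))) with (alpha / 4) in H by (field; lra).
  assert (0 < alpha / (4 * eps0)) by (apply Rdiv_lt_0_compat; lra).
  assert (eps0 * ln (INR N) <= eps * ln (INR N)) by (apply Rmult_le_compat_r; lra). lra.
Qed.

Lemma edge_data_sample eps0 eps alpha K h g g1 g2 x : 0 < eps0 -> eps0 <= eps <= 1 -> 0 < h <= 1 -> 0 < alpha -> 1 <= K ->
  cont1 g -> cont1 g1 -> cont1 g2 -> deriv_on g g1 -> deriv_on g1 g2 ->
  (forall t, 0 < t < 1 -> Rabs (g1 t) <= K) -> (forall t, 0 < t < 1 -> Rabs (g2 t) <= K) ->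
  (forall t, 0 <= t <= 1 -> alpha <= g t <= K) -> 0 <= x - h -> x + h <= 1 ->
  edge_data eps0 eps alpha K h (g (x - h)) (g x) (g (x + h)).
Proof.
  intros He0 He Hh Ha HK Hg Hg1 Hg2 D1 D2 HB1 HB2 Hval Hl Hr.
  assert (hh : Rabs h = h) by (apply Rabs_right; lra).
  assert (I1 := increment_abs g g1 K (x - h) x ltac:(auto) ltac:(auto) ltac:(auto) ltac:(auto) ltac:(lra) ltac:(lra)).
  assert (I2 := increment_abs g g1 K x (x + h) ltac:(auto) ltac:(auto) ltac:(auto) ltac:(auto) ltac:(lra) ltac:(lra)).
  assert (T1 := taylor_1 g g1 g2 K x (x - h) ltac:(auto) ltac:(auto) ltac:(auto) ltac:(auto) ltac:(auto) ltac:(auto) ltac:(lra) ltac:(lra)).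
  assert (T2 := taylor_1 g g1 g2 K x (x + h) ltac:(auto) ltac:(auto) ltac:(auto) ltac:(auto) ltac:(auto) ltac:(auto) ltac:(lra) ltac:(lra)).
  replace (x - (x - h)) with h in * by ring. replace (x + h - x) with h in * by ring. replace (x - h - x) with (- h) in * by ring.
  rewrite hh in *. apply Rabs_le_between in T1. apply Rabs_le_between in T2. replace ((- h) ^ 2) with (h ^ 2) in T1 by ring.
  constructor; auto; try (split; lra); try (apply Hval; lra).
  apply Rabs_le; lra.
Qed.

Lemma cont2_eq_closed F G : cont2 F -> cont2 G -> (forall x y, in_open x y -> F x y = G x y) ->
  forall x y, in_closed x y -> F x y = G x y.
Proof.
  intros HF HG E x y [Hx Hy].
  apply (cont1_eq_closed (fun y => F x y) (fun y => G x y)); try (now apply cont1_y); auto.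
  clear y Hy. intros y Hy.
  apply (cont1_eq_closed (fun x => F x y) (fun x => G x y)); try (now apply cont1_x); auto.
  clear x Hx. intros x Hx. apply E. split; auto.
Qed.

Lemma zero_edge_x D k x0 : fam k D -> 0 <= x0 <= 1 -> (forall y, 0 <= y <= 1 -> D 0%nat 0%nat x0 y = 0) ->
  forall j, (j <= k)%nat -> forall y, 0 <= y <= 1 -> D 0%nat j x0 y = 0.
Proof.
  intros (Hc & Hx & Hy) Hx0 H0. induction j as [|j IH]; intros Hj y Hy'; [auto|].
  apply (cont1_eq_closed (fun y => D 0%nat (S j) x0 y) (fun _ => 0)); ct; try apply Hc.
  assert (D1 := Hy 0%nat j ltac:(lia) x0 x ltac:(auto)). apply is_derive_unique in D1. rewrite <- D1.
  apply is_derive_unique. apply is_derive_ext_loc with (fun _ => 0); [|apply (@is_derive_const R_AbsRing)].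
  apply locally_unit_interval; auto. intros t Ht. symmetry. apply IH; [lia|lra].
Qed.

(** * From the data of the problem to the truncation error in L2 *)

Section Data.
Variables (gamma eps0 alpha1 alpha2 K : R) (a1 a2 b f : R -> R -> R) (Da1 Da2 Db Df : nat -> nat -> R -> R -> R).
Hypotheses (He0 : 0 < eps0 <= 1) (Ha1 : 0 < alpha1) (Ha2 : 0 < alpha2)
  (La1 : forall x y, in_closed x y -> alpha1 < a1 x y) (La2 : forall x y, in_closed x y -> alpha2 < a2 x y)
  (Lb : forall x y, in_closed x y -> 0 <= b x y)
  (Ca1 : Ckg_with 5 gamma a1 Da1) (Ca2 : Ckg_with 5 gamma a2 Da2) (Cb : Ckg_with 5 gamma b Db) (Cf : Ckg_with 5 gamma f Df)
  (HK : 1 <= K)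
  (B1 : forall i j x y, (i + j <= 2)%nat -> Rabs (clamp 5 Da1 i j x y) <= K)
  (B2 : forall i j x y, (i + j <= 2)%nat -> Rabs (clamp 5 Da2 i j x y) <= K)
  (B3 : forall i j x y, (i + j <= 2)%nat -> Rabs (clamp 5 Db i j x y) <= K)
  (B4 : forall i j x y, (i + j <= 2)%nat -> Rabs (clamp 5 Df i j x y) <= K).

Let c1 x y : in_closed x y -> clamp 5 Da1 0 0 x y = a1 x y.
Proof. intros H. rewrite clamp_in by (auto; lia). now apply Ca1. Qed.
Let c2 x y : in_closed x y -> clamp 5 Da2 0 0 x y = a2 x y.
Proof. intros H. rewrite clamp_in by (auto; lia). now apply Ca2. Qed.
Let c3 x y : in_closed x y -> clamp 5 Db 0 0 x y = b x y.
Proof. intros H. rewrite clamp_in by (auto; lia). now apply Cb. Qed.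
Let c4 x y : in_closed x y -> clamp 5 Df 0 0 x y = f x y.
Proof. intros H. rewrite clamp_in by (auto; lia). now apply Cf. Qed.
Let F1 : fam 2 (clamp 5 Da1). Proof. apply (fam_le 5); [lia|]. eapply clamp_fam. apply Ca1. Qed.
Let F2 : fam 2 (clamp 5 Da2). Proof. apply (fam_le 5); [lia|]. eapply clamp_fam. apply Ca2. Qed.
Let F3 : fam 2 (clamp 5 Db). Proof. apply (fam_le 5); [lia|]. eapply clamp_fam. apply Cb. Qed.
Let F4 : fam 2 (clamp 5 Df). Proof. apply (fam_le 5); [lia|]. eapply clamp_fam. apply Cf. Qed.

Let L := K / eps0.
(** Height of the barrier for u: [K] bounds f and alpha1 bounds a1 from below; the 1 ensures the
    strict inequality in [continuous_max_principle]. *)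
Let M0 := K / alpha1 + 1.

Lemma open_closed x y : in_open x y -> in_closed x y.
Proof. intros [? ?]; split; lra. Qed.

Section Solution.
Variables (eps : R) (u : R -> R -> R) (Du : nat -> nat -> R -> R -> R).
Hypotheses (Heps : eps0 <= eps <= 1) (Cu : Ckg_with 4 gamma u Du)
  (Hpde : forall x y, in_open x y ->
     - eps * (Du 2 0 x y + Du 0 2 x y)
     + a1 x y * Du 1 0 x y + a2 x y * Du 0 1 x y
     + b x y * u x y = f x y)
  (Hbd : forall x y, on_boundary x y -> u x y = 0).

Let V := clamp 4 Du.
Let sc (D : nat -> nat -> R -> R -> R) := fun i j x y => / eps * clamp 5 D i j x y.
Let FV : fam 4 V. Proof. eapply clamp_fam. apply Cu. Qed.
Let cV x y : in_closed x y -> V 0 0 x y = u x y.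
Proof. intros H. unfold V. rewrite clamp_in by (auto; lia). now apply Cu. Qed.

Let pde_closed x y : in_closed x y -> V 2 0 x y + V 0 2 x y =
     sc Da1 0 0 x y * V 1 0 x y + sc Da2 0 0 x y * V 0 1 x y
     + sc Db 0 0 x y * V 0 0 x y - sc Df 0 0 x y.
Proof.
  revert x y. apply cont2_eq_closed.
  - apply cont2_plus; apply FV.
  - unfold sc. ct; first [apply FV | apply F1 | apply F2 | apply F3 | apply F4].
  - intros x y H. assert (HC := open_closed x y H). unfold sc. rewrite c1, c2, c3, c4, cV by auto.
    unfold V. rewrite !clamp_in by (auto; lia).
    specialize (Hpde x y H). apply Rmult_eq_reg_l with eps; [|lra].
    replace (eps * (/ eps * a1 x y * Du 1 0 x y + / eps * a2 x y * Du 0 1 x y + / eps * b x y * u x y - / eps * f x y))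
      with (a1 x y * Du 1 0 x y + a2 x y * Du 0 1 x y + b x y * u x y - f x y) by (field; lra). lra.
Qed.

Lemma build_regsol : regsol L M0 V (sc Da1) (sc Da2) (sc Db) (sc Df).
Proof.
  assert (bs : forall D i j x y, Rabs (clamp 5 D i j x y) <= K -> Rabs (sc D i j x y) <= L).
  { intros D i j x y H. unfold sc, L, Rdiv. rewrite (Rmult_comm K). apply Rabs_mult_le; auto.
    rewrite Rabs_right by (apply Rle_ge; left; apply Rinv_0_lt_compat; lra). apply Rinv_le_contravar; lra. }
  assert (Vc : forall i j x y, V i j x y = V i j (cl x) (cl y)) by (intros; apply clamp_cl).
  assert (bd : forall x y, on_boundary x y -> V 0 0 x y = 0).
  { intros x y H. rewrite cV by apply H. now apply Hbd. }
  constructor; try (apply fam_scal; auto); auto.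
  - intros x y. rewrite !(Vc _ _ x y). unfold sc. rewrite !(clamp_cl _ _ _ _ x y).
    apply pde_closed. split; apply cl_in.
  - intros i j x y Hij. repeat split; apply bs; auto.
  - intros x y. rewrite Vc.
    assert (HIN : in_closed (cl x) (cl y)) by (split; apply cl_in).
    assert (Hm : forall s, s = 1 \/ s = -1 -> s * V 0 0 (cl x) (cl y) <= M0).
    { intros s Hs.
      apply (continuous_max_principle V (sc Da1 0 0) (sc Da2 0 0) (sc Db 0 0) (sc Df 0 0) M0 s); auto.
      - apply (fam_le 4); [lia|auto].
      - unfold M0. assert (0 < K / alpha1) by (apply Rdiv_lt_0_compat; lra). lra.
      - intros x' y' H. apply pde_closed. now apply open_closed.
      - intros x' y' H. assert (HC := open_closed _ _ H). assert (ie : 0 < / eps) by (apply Rinv_0_lt_compat; lra).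
        split; unfold sc.
        + rewrite c3 by auto. apply Rmult_le_pos; [lra|auto].
        + rewrite Rabs_mult, (Rabs_right (/ eps)), Rmult_assoc by lra. apply Rmult_lt_compat_l; auto.
          rewrite c1 by auto. specialize (La1 x' y' HC). specialize (B4 0 0 x' y' ltac:(lia)).
          assert (m0 : 0 < M0) by (unfold M0; assert (0 < K / alpha1) by (apply Rdiv_lt_0_compat; lra); lra).
          assert (alpha1 * M0 < a1 x' y' * M0) by (apply Rmult_lt_compat_r; auto).
          replace (alpha1 * M0) with (K + alpha1) in H0 by (unfold M0; field; lra). lra. }
    apply Rabs_le. pose proof (Hm 1 ltac:(auto)). pose proof (Hm (-1) ltac:(auto)). lra.
  - intros j x y Hj Hx. rewrite Vc. rewrite (cl_id x) by lra.
    apply (zero_edge_x V 4); auto; try lia; try lra; try apply cl_in.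
    intros t Ht. apply bd. split; [split; lra|tauto].
  - intros i x y Hi Hy. rewrite Vc. rewrite (cl_id y) by lra.
    apply (zero_edge_x (famT V) 4 y) with (j := i) (y := cl x); auto using fam_transpose; try lia; try lra; try apply cl_in.
    intros t Ht. unfold famT. apply bd. split; [split; lra|tauto].
Qed.

Variables (C : R).
Hypotheses (HC : 0 <= C) (HuC : forall i j x y, (i + j <= 2)%nat -> 0 <= x <= 1 -> 0 <= y <= 1 -> Rabs (V i j x y) <= C)
  (HI : forall i j, (2 <= i + j <= 3 \/ i = 2 /\ j = 2)%nat -> I2 (fun x y => V i j x y ^ 2) <= C).

Let HuC' i j x y : (i + j <= 2)%nat -> Rabs (V i j x y) <= C.
Proof. intros H. unfold V. rewrite clamp_cl. apply HuC; auto; apply cl_in. Qed.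

Variables (n : nat) (x : nat -> R) (s : scheme).
Let h := / INR (S n).
Hypothesis (Hx : forall i, x i = INR i * h).

Let Npos : 1 <= INR (S n). Proof. apply (le_INR 1). lia. Qed.
Let hp : 0 < h <= 1.
Proof. unfold h. split; [apply Rinv_0_lt_compat; lra|]. rewrite <- Rinv_1. apply Rinv_le_contravar; lra. Qed.
Let Nh : INR (S n) * h = 1. Proof. unfold h. field. lra. Qed.
Let xin i : (i <= S n)%nat -> 0 <= x i <= 1.
Proof.
  intros Hi. rewrite Hx. split; [apply Rmult_le_pos; [apply pos_INR|lra]|].
  rewrite <- Nh. apply Rmult_le_compat_r; [lra|now apply le_INR].
Qed.
Let xstep i : x (S i) = x i + h. Proof. rewrite !Hx, S_INR. ring. Qed.
Let xm i : x i = x (S i) - h. Proof. rewrite xstep. ring. Qed.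
Let LK : 1 <= K <= L.
Proof.
  split; auto. unfold L. apply Rmult_le_reg_r with eps0; [lra|]. unfold Rdiv. rewrite Rmult_assoc, Rinv_l by lra. nra.
Qed.

Lemma edge_data_x k l : (k < n)%nat -> (l < n)%nat ->
  edge_data eps0 eps alpha1 K h (a1 (x k) (x (S l))) (a1 (x (S k)) (x (S l))) (a1 (x (S (S k))) (x (S l))).
Proof.
  intros Hk Hl. assert (y0 := xin (S l) ltac:(lia)). assert (x0 := xin k ltac:(lia)). assert (x2 := xin (S (S k)) ltac:(lia)).
  assert (x1 := xin (S k) ltac:(lia)).
  rewrite <- !c1 by (split; auto). rewrite (xm k), (xstep (S k)) in *.
  apply (edge_data_sample eps0 eps alpha1 K h (fun t => clamp 5 Da1 0 0 t (x (S l))) (fun t => clamp 5 Da1 1 0 t (x (S l)))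
     (fun t => clamp 5 Da1 2 0 t (x (S l)))); auto; try lra; try (apply cont1_x, F1);
    try (intros t Ht; apply F1; auto; lia).
  intros t Ht. rewrite c1 by (split; auto). specialize (La1 t (x (S l)) (conj Ht y0)).
  specialize (B1 0 0 t (x (S l)) ltac:(lia)). rewrite c1 in B1 by (split; auto). apply Rabs_le_between in B1. lra.
Qed.

Lemma edge_data_y k l : (k < n)%nat -> (l < n)%nat ->
  edge_data eps0 eps alpha2 K h (a2 (x (S k)) (x l)) (a2 (x (S k)) (x (S l))) (a2 (x (S k)) (x (S (S l)))).
Proof.
  intros Hk Hl. assert (y0 := xin (S k) ltac:(lia)). assert (x0 := xin l ltac:(lia)). assert (x2 := xin (S (S l)) ltac:(lia)).
  assert (x1 := xin (S l) ltac:(lia)).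
  rewrite <- !c2 by (split; auto). rewrite (xm l), (xstep (S l)) in *.
  apply (edge_data_sample eps0 eps alpha2 K h (fun t => clamp 5 Da2 0 0 (x (S k)) t) (fun t => clamp 5 Da2 0 1 (x (S k)) t)
     (fun t => clamp 5 Da2 0 2 (x (S k)) t)); auto; try lra; try (apply cont1_y, F2);
    try (intros t Ht; apply F2; auto; lia).
  intros t Ht. rewrite c2 by (split; auto). specialize (La2 (x (S k)) t (conj y0 Ht)).
  specialize (B2 0 0 (x (S k)) t ltac:(lia)). rewrite c2 in B2 by (split; auto). apply Rabs_le_between in B2. lra.
Qed.

Lemma b_node k l : (k < n)%nat -> (l < n)%nat -> 0 <= b (x (S k)) (x (S l)) <= K.
Proof.
  intros Hk Hl. assert (in_closed (x (S k)) (x (S l))) by (split; apply xin; lia). split; [auto|].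
  specialize (B3 0 0 (x (S k)) (x (S l)) ltac:(lia)). rewrite c3 in B3 by auto. apply Rabs_le_between in B3. lra.
Qed.

Let St := scheme_stencil eps h a1 a2 b x s.
(** The summands are the errors of [Frhs_expand], [LN_expand] and [averaged_consistency], in this
    order. *)
Let Ca := 14 * K * L + 8 * K * L ^ 2 * C + 100 * L * (C + 1).
Let Jall k l := JJ (V 2 2) (x (S k)) (x (S l)) h + JJ (V 3 0) (x (S k)) (x (S l)) h + JJ (V 1 2) (x (S k)) (x (S l)) h
          + JJ (V 0 3) (x (S k)) (x (S l)) h + JJ (V 2 1) (x (S k)) (x (S l)) h.

Lemma truncation k l : (k < n)%nat -> (l < n)%nat ->
  Rabs (Frhs eps a1 a2 f x x s (S k) (S l) - apply_stencil St (fun i j => u (x i) (x j)) k l) <= Ca * h ^ 2 + 2 * L * Jall k l.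
Proof.
  intros Hk Hl.
  assert (X := xin (S k) ltac:(lia)). assert (Y := xin (S l) ltac:(lia)).
  assert (Xm := xin k ltac:(lia)). assert (Ym := xin l ltac:(lia)).
  assert (Xp := xin (S (S k)) ltac:(lia)). assert (Yp := xin (S (S l)) ltac:(lia)).
  assert (HD1 := edge_data_x). assert (HD2 := edge_data_y). assert (Hb := b_node).
  assert (RS := build_regsol).
  assert (L1 : 1 <= L) by lra.
  assert (CNS := averaged_consistency L M0 C V _ _ _ _ L1 HC RS HuC' (x (S k)) (x (S l)) h (proj1 hp)
     ltac:(rewrite <- xm; lra) ltac:(rewrite <- xstep; lra) ltac:(rewrite <- xm; lra) ltac:(rewrite <- xstep; lra)).
  fold (Jall k l) in CNS.
  rewrite <- !xm, <- !xstep in CNS. unfold sc in CNS.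
  rewrite !cV, c1, c2, c3, c4 in CNS by (split; auto).
  set (W := fun i j => u (x i) (x j)).
  assert (cVx : forall i t, cont1 (fun r => V i 0 r t)) by (intros; apply cont1_x, FV).
  assert (cVy : forall i t, cont1 (fun r => V 0 i t r)) by (intros; apply cont1_y, FV).
  assert (dVx : forall i t, (i < 4)%nat -> deriv_on (fun r => V i 0 r t) (fun r => V (S i) 0 r t)) by (intros i t Hi r Hr; apply FV; auto; lia).
  assert (dVy : forall i t, (i < 4)%nat -> deriv_on (fun r => V 0 i t r) (fun r => V 0 (S i) t r)) by (intros i t Hi r Hr; apply FV; auto; lia).
  assert (hh : Rabs h = h) by (apply Rabs_right; lra).
  assert (Ix : forall p q t, 0 <= p <= 1 -> 0 <= q <= 1 -> 0 <= t <= 1 -> Rabs (u q t - u p t) <= C * Rabs (q - p)).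
  { intros p q t Hp Hq Ht. rewrite <- !cV by (split; auto).
    apply (increment_abs (fun r => V 0 0 r t) (fun r => V 1 0 r t)); auto. apply dVx; lia. }
  assert (Iy : forall p q t, 0 <= p <= 1 -> 0 <= q <= 1 -> 0 <= t <= 1 -> Rabs (u t q - u t p) <= C * Rabs (q - p)).
  { intros p q t Hp Hq Ht. rewrite <- !cV by (split; auto).
    apply (increment_abs (fun r => V 0 0 t r) (fun r => V 0 1 t r)); auto. apply dVy; lia. }
  assert (Tx : forall p q t, 0 <= p <= 1 -> 0 <= q <= 1 -> 0 <= t <= 1 -> Rabs (u q t - u p t - (q - p) * V 1 0 p t) <= C * (q - p) ^ 2).
  { intros p q t Hp Hq Ht. rewrite <- !cV by (split; auto).
    apply (taylor_1 (fun r => V 0 0 r t) (fun r => V 1 0 r t) (fun r => V 2 0 r t)); auto; apply dVx; lia. }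
  assert (Ty : forall p q t, 0 <= p <= 1 -> 0 <= q <= 1 -> 0 <= t <= 1 -> Rabs (u t q - u t p - (q - p) * V 0 1 t p) <= C * (q - p) ^ 2).
  { intros p q t Hp Hq Ht. rewrite <- !cV by (split; auto).
    apply (taylor_1 (fun r => V 0 0 t r) (fun r => V 0 1 t r) (fun r => V 0 2 t r)); auto; apply dVy; lia. }
  assert (sp : forall i, x (S i) - x i = h) by (intros; rewrite xstep; ring).
  assert (sm : forall i, x i - x (S i) = - h) by (intros; rewrite xstep; ring).
  assert (EXP := LN_expand eps0 eps alpha1 alpha2 K h a1 a2 b f x s n eq_refl HD1 HD2 Hb k l Hk Hl W C HC).
  fold L St in EXP.
  assert (E1 : Rabs (apply_stencil St W k l
    - (- eps * ((W (S (S k)) (S l) + W k (S l) - 2 * W (S k) (S l)) / h ^ 2 + (W (S k) (S (S l)) + W (S k) l - 2 * W (S k) (S l)) / h ^ 2)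
       + a1 (x (S k)) (x (S l)) * ((W (S (S k)) (S l) - W k (S l)) / (2 * h))
       + a2 (x (S k)) (x (S l)) * ((W (S k) (S (S l)) - W (S k) l) / (2 * h)) + b (x (S k)) (x (S l)) * W (S k) (S l)))
   <= 8 * K * L ^ 2 * C * h ^ 2).
  { apply EXP; unfold W.
    - rewrite <- cV by (split; auto). apply HuC'. lia.
    - pose proof (Ix (x k) (x (S k)) (x (S l)) Xm X Y) as Q. rewrite sp, hh in Q. exact Q.
    - pose proof (Ix (x (S k)) (x (S (S k))) (x (S l)) X Xp Y) as Q. rewrite sp, hh in Q. exact Q.
    - pose proof (Tx (x (S k)) (x (S (S k))) (x (S l)) X Xp Y) as Q1. pose proof (Tx (x (S k)) (x k) (x (S l)) X Xm Y) as Q2.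
      rewrite sp in Q1. rewrite sm in Q2. apply Rabs_le_between in Q1. apply Rabs_le_between in Q2. apply Rabs_le. lra.
    - pose proof (Iy (x l) (x (S l)) (x (S k)) Ym Y X) as Q. rewrite sp, hh in Q. exact Q.
    - pose proof (Iy (x (S l)) (x (S (S l))) (x (S k)) Y Yp X) as Q. rewrite sp, hh in Q. exact Q.
    - pose proof (Ty (x (S l)) (x (S (S l))) (x (S k)) Y Yp X) as Q1. pose proof (Ty (x (S l)) (x l) (x (S k)) Y Ym X) as Q2.
      rewrite sp in Q1. rewrite sm in Q2. apply Rabs_le_between in Q1. apply Rabs_le_between in Q2. apply Rabs_le. lra. }
  assert (E2 : Rabs (Frhs eps a1 a2 f x x s (S k) (S l) - f (x (S k)) (x (S l))) <= 14 * K * L * h ^ 2).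
  { apply (Frhs_expand eps0 eps alpha1 alpha2 K h a1 a2 f x s n Hx eq_refl HD1 HD2 k l Hk Hl
      (clamp 5 Df 1 0 (x (S k)) (x (S l))) (clamp 5 Df 0 1 (x (S k)) (x (S l)))).
    - rewrite <- c4 by (split; auto). apply B4; lia.
    - apply B4; lia.
    - apply B4; lia.
    - intros d e Hd He.
      assert (P : forall i d, (d <= 2)%nat -> x (i + d)%nat = x (S i) + (INR d - 1) * h) by (intros; rewrite !Hx, plus_INR, S_INR; ring).
      assert (Q := taylor_2d (clamp 5 Df) K (x (S k)) (x (S l)) ((INR d - 1) * h) ((INR e - 1) * h) F4 B4 X Y
         ltac:(rewrite <- P by auto; apply xin; lia) ltac:(rewrite <- P by auto; apply xin; lia)).
      rewrite <- !P, !c4 in Q by (auto; split; auto; apply xin; lia).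
      eapply Rle_trans; [exact Q|].
      assert (w : forall d, (d <= 2)%nat -> Rabs ((INR d - 1) * h) <= h).
      { intros m Hm. rewrite Rabs_mult, hh. assert (Rabs (INR m - 1) <= 1); [|nra].
        destruct m as [|[|[|]]]; [| | |lia]; simpl; apply Rabs_le; lra. }
      assert (wd := w d Hd). assert (we := w e He).
      rewrite <- (pow2_abs ((INR d - 1) * h)), <- (pow2_abs ((INR e - 1) * h)).
      pose proof (Rabs_pos ((INR d - 1) * h)). pose proof (Rabs_pos ((INR e - 1) * h)).
      replace (3 * K * h ^ 2) with (K * (3 * h ^ 2)) by ring. apply Rmult_le_compat_l; [lra|]. nra. }
  fold (W (S (S k)) (S l)) (W k (S l)) (W (S k) (S l)) (W (S k) (S (S l))) (W (S k) l) in CNS.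
  set (dxx := (W (S (S k)) (S l) + W k (S l) - 2 * W (S k) (S l)) / h ^ 2) in *.
  set (dyy := (W (S k) (S (S l)) + W (S k) l - 2 * W (S k) (S l)) / h ^ 2) in *.
  set (dx := (W (S (S k)) (S l) - W k (S l)) / (2 * h)) in *. set (dy := (W (S k) (S (S l)) - W (S k) l) / (2 * h)) in *.
  (* The averaged equation is the one divided by eps; multiplying back does not enlarge the bound,
     as eps <= 1. *)
  match type of CNS with Rabs ?c <= ?r => set (cc := c) in CNS; assert (E3 := Rabs_mult_le eps cc 1 r ltac:(rewrite Rabs_right; lra) CNS) end.
  assert (E : eps * cc = eps * (dxx + dyy) - a1 (x (S k)) (x (S l)) * dx - a2 (x (S k)) (x (S l)) * dy - b (x (S k)) (x (S l)) * W (S k) (S l) + f (x (S k)) (x (S l))).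
  { unfold cc. field. lra. }
  rewrite E in E3. apply Rabs_le_between in E1. apply Rabs_le_between in E2. apply Rabs_le_between in E3.
  unfold Ca. apply Rabs_le. split; lra.
Qed.

(** 6 comes from [sq_sum6], and 480 is 6 times 5 times 16: five patch integrals, each with the
    factor of [sum_JJ_sq]. *)
Let D := 6 * Ca ^ 2 + 480 * (2 * L) ^ 2 * C.

Lemma truncation_l2 T : (forall k l, (k < n)%nat -> (l < n)%nat -> Rabs (T k l) <= Ca * h ^ 2 + 2 * L * Jall k l) ->
  h ^ 2 * fsum2 (fun k l => T k l ^ 2) n n <= D * h ^ 4.
Proof.
  intros HT.
  set (j := fun i m k l => JJ (V i m) (x (S k)) (x (S l)) h).
  assert (JS : forall i m, (2 <= i + m <= 3 \/ i = 2 /\ m = 2)%nat -> fsum2 (fun k l => j i m k l ^ 2) n n <= 16 * h ^ 2 * C).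
  { intros i m Him. unfold j.
    rewrite (fsum2_ext _ (fun k l => JJ (V i m) (INR (S k) * h) (INR (S l) * h) h ^ 2)) by (intros; now rewrite !Hx).
    eapply Rle_trans; [apply sum_JJ_sq; [reflexivity|apply FV]|].
    apply Rmult_le_compat_l; [nra|auto]. }
  assert (S1 : fsum2 (fun k l => T k l ^ 2) n n <= 6 * (INR n * INR n * (Ca * h ^ 2) ^ 2) + 6 * ((2 * L) ^ 2 * (5 * (16 * h ^ 2 * C)))).
  { apply Rle_trans with (fsum2 (fun k l => 6 * ((Ca * h ^ 2) ^ 2) + 6 * ((2 * L) ^ 2 * (j 2%nat 2%nat k l ^ 2 + j 3%nat 0%nat k l ^ 2 + j 1%nat 2%nat k l ^ 2
       + j 0%nat 3%nat k l ^ 2 + j 2%nat 1%nat k l ^ 2))) n n).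
    - apply fsum2_le. intros k l Hk Hl. specialize (HT k l Hk Hl).
      rewrite <- (pow2_abs (T k l)).
      apply Rle_trans with ((Ca * h ^ 2 + 2 * L * Jall k l) ^ 2); [apply pow_incr; split; auto using Rabs_pos|].
      replace (Ca * h ^ 2 + 2 * L * Jall k l) with (Ca * h ^ 2 + 2 * L * j 2%nat 2%nat k l + 2 * L * j 3%nat 0%nat k l + 2 * L * j 1%nat 2%nat k l
        + 2 * L * j 0%nat 3%nat k l + 2 * L * j 2%nat 1%nat k l) by (unfold Jall, j; ring).
      eapply Rle_trans; [apply sq_sum6|]. right. ring.
    - rewrite fsum2_plus, fsum2_const, !fsum2_scal, !fsum2_plus.
      pose proof (JS 2%nat 2%nat ltac:(lia)). pose proof (JS 3%nat 0%nat ltac:(lia)). pose proof (JS 1%nat 2%nat ltac:(lia)).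
      pose proof (JS 0%nat 3%nat ltac:(lia)). pose proof (JS 2%nat 1%nat ltac:(lia)).
      apply Rplus_le_compat; [lra|]. apply Rmult_le_compat_l; [lra|]. apply Rmult_le_compat_l; [apply pow2_ge_0|]. lra. }
  assert (hn : 0 <= h * INR n <= 1).
  { split; [apply Rmult_le_pos; [lra|apply pos_INR]|]. rewrite <- Nh, Rmult_comm. apply Rmult_le_compat_r; [lra|apply le_INR; lia]. }
  apply Rle_trans with (h ^ 2 * (6 * (INR n * INR n * (Ca * h ^ 2) ^ 2) + 6 * ((2 * L) ^ 2 * (5 * (16 * h ^ 2 * C))))).
  - apply Rmult_le_compat_l; auto. apply pow2_ge_0.
  - replace (h ^ 2 * (6 * (INR n * INR n * (Ca * h ^ 2) ^ 2) + 6 * ((2 * L) ^ 2 * (5 * (16 * h ^ 2 * C))))) with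
      ((h * INR n) ^ 2 * (6 * Ca ^ 2 * h ^ 4) + 480 * (2 * L) ^ 2 * C * h ^ 4) by ring.
    unfold D. assert (0 <= 6 * Ca ^ 2 * h ^ 4) by (apply Rmult_le_pos; [pose proof (pow2_ge_0 Ca); lra|apply pow_le; lra]).
    assert ((h * INR n) ^ 2 <= 1) by nra.
    assert ((h * INR n) ^ 2 * (6 * Ca ^ 2 * h ^ 4) <= 1 * (6 * Ca ^ 2 * h ^ 4)) by (apply Rmult_le_compat_r; auto). lra.
Qed.
End Solution.
End Data.

Theorem theorem3 :
  forall (gamma eps0 alpha1 alpha2 : R) (a1 a2 b f : R -> R -> R)
         (Df : nat -> nat -> R -> R -> R),
  0 < gamma < 1 ->
  0 < eps0 <= 1 ->
  0 < alpha1 -> 0 < alpha2 ->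
  (forall x y, in_closed x y -> alpha1 < a1 x y) ->
  (forall x y, in_closed x y -> alpha2 < a2 x y) ->
  (forall x y, in_closed x y -> 0 <= b x y) ->
  Ckg 5 gamma a1 -> Ckg 5 gamma a2 -> Ckg 5 gamma b ->
  Ckg_with 5 gamma f Df ->
  f 0 0 = 0 -> f 1 0 = 0 -> f 0 1 = 0 -> f 1 1 = 0 ->
  (forall i j : nat, (i + j <= 4)%nat -> Df i j 0 0 = 0) ->
  exists (C : R) (N0 : nat),
  forall (eps : R) (u : R -> R -> R) (Du : nat -> nat -> R -> R -> R),
  eps0 <= eps <= 1 ->
  (* u is the solution of (P), and u in C^{4,gamma}(closed square) *)
  Ckg_with 4 gamma u Du ->
  (forall x y, in_open x y ->
     - eps * (Du 2%nat 0%nat x y + Du 0%nat 2%nat x y)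
     + a1 x y * Du 1%nat 0%nat x y + a2 x y * Du 0%nat 1%nat x y
     + b x y * u x y = f x y) ->
  (forall x y, on_boundary x y -> u x y = 0) ->
  forall (N : nat), (4 <= N)%nat -> Nat.even N = true -> (N0 <= N)%nat ->
  let xs := node N (tau eps alpha1 N) in
  let ys := node N (tau eps alpha2 N) in
  forall (s : scheme) (U : nat -> nat -> R),
  (forall i j : nat, (i <= N)%nat -> (j <= N)%nat ->
     (i = 0 \/ i = N \/ j = 0 \/ j = N)%nat -> U i j = 0) ->
  (forall i j : nat, (1 <= i <= N - 1)%nat -> (1 <= j <= N - 1)%nat ->
     LN eps a1 a2 b xs ys s U i j = Frhs eps a1 a2 f xs ys s i j) ->
  (forall i j : nat, (i <= N)%nat -> (j <= N)%nat ->
     Rabs (U i j - u (xs i) (ys j)) <= C / (INR N) ^ 2) /\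
  (forall x y, in_open x y ->
     Rabs (bilin_interp xs ys N U x y - u x y) <= C / (INR N) ^ 2).
Proof.
  intros gamma eps0 alpha1 alpha2 a1 a2 b f Df Hg He0 Ha1 Ha2 La1 La2 Lb [Da1 C1] [Da2 C2] [Db C3] C4 _ _ _ _ _.
  destruct (fam_bounded 5 gamma Da1 2 (proj1 C1)) as (K1 & HK1 & B1).
  destruct (fam_bounded 5 gamma Da2 2 (proj1 C2)) as (K2 & HK2 & B2).
  destruct (fam_bounded 5 gamma Db 2 (proj1 C3)) as (K3 & HK3 & B3).
  destruct (fam_bounded 5 gamma Df 2 (proj1 C4)) as (K4 & HK4 & B4).
  set (K := K1 + K2 + K3 + K4).
  assert (HK : 1 <= K) by (unfold K; lra).
  assert (B1' : forall i j x y, (i + j <= 2)%nat -> Rabs (clamp 5 Da1 i j x y) <= K)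
    by (intros i j x y Hij; specialize (B1 i j x y Hij); unfold K; lra).
  assert (B2' : forall i j x y, (i + j <= 2)%nat -> Rabs (clamp 5 Da2 i j x y) <= K)
    by (intros i j x y Hij; specialize (B2 i j x y Hij); unfold K; lra).
  assert (B3' : forall i j x y, (i + j <= 2)%nat -> Rabs (clamp 5 Db i j x y) <= K)
    by (intros i j x y Hij; specialize (B3 i j x y Hij); unfold K; lra).
  assert (B4' : forall i j x y, (i + j <= 2)%nat -> Rabs (clamp 5 Df i j x y) <= K)
    by (intros i j x y Hij; specialize (B4 i j x y Hij); unfold K; lra).
  set (L := K / eps0).
  assert (HL : 1 <= L).
  { unfold L. apply Rmult_le_reg_r with eps0; [lra|]. unfold Rdiv. rewrite Rmult_assoc, Rinv_l by lra. lra. }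
  destruct (regsol_apriori L (K / alpha1 + 1) HL) as (C & HC & Hap).
  destruct (discrete_stability eps0 (alpha1 / 4) (3 * L ^ 2)) as (Cs & HCs & Hst); [lra|lra|nra|].
  destruct (ln_INR_large (alpha1 / (4 * eps0))) as [N1 HN1].
  destruct (ln_INR_large (alpha2 / (4 * eps0))) as [N2 HN2].
  set (Ca := 14 * K * L + 8 * K * L ^ 2 * C + 100 * L * (C + 1)).
  set (D := 6 * Ca ^ 2 + 480 * (2 * L) ^ 2 * C).
  assert (HD : 0 <= D).
  { unfold D. assert (0 <= (2 * L) ^ 2 * C) by (apply Rmult_le_pos; [apply pow2_ge_0|lra]). pose proof (pow2_ge_0 Ca). lra. }
  (* Stability needs a positive tau with D h^4 <= tau^2; [D + 1] satisfies this without a square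
     root and even for D = 0. The part [2 * C] is the interpolation error. *)
  exists (Cs * (D + 1) + 2 * C), (N1 + N2)%nat.
  intros eps u Du Heps Cu Hpde Hbd N HN4 HNe HN0.
  assert (t1 : tau eps alpha1 N = 1 / 2) by (apply (tau_half eps0); [split; lra | auto | apply HN1; lia]).
  assert (t2 : tau eps alpha2 N = 1 / 2) by (apply (tau_half eps0); [split; lra | auto | apply HN2; lia]).
  rewrite t1, t2.
  intros xs ys s U HU0 HUL. subst ys. fold xs in HUL |- *.
  destruct N as [|n]; [lia|].
  set (h := / INR (S n)).
  assert (HN : 1 <= INR (S n)) by (apply (le_INR 1); lia).
  assert (hp : 0 < h) by (apply Rinv_0_lt_compat; lra).
  assert (Nh : INR (S n) * h = 1) by (unfold h; field; lra).
  assert (Hx : forall i, xs i = INR i * h) by (intros i; unfold xs; apply node_uniform; [lia|auto]).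
  assert (RS : regsol L (K / alpha1 + 1) (clamp 4 Du) (fun i j x y => / eps * clamp 5 Da1 i j x y)
    (fun i j x y => / eps * clamp 5 Da2 i j x y) (fun i j x y => / eps * clamp 5 Db i j x y)
    (fun i j x y => / eps * clamp 5 Df i j x y)) by (eapply build_regsol; eassumption).
  destruct (Hap _ _ _ _ _ RS) as [Hsup HI2].
  assert (E1 : forall k l, (k < n)%nat -> (l < n)%nat ->
     edge_data eps0 eps alpha1 K h (a1 (xs k) (xs (S l))) (a1 (xs (S k)) (xs (S l))) (a1 (xs (S (S k))) (xs (S l))))
    by (intros; eapply edge_data_x; eassumption).
  assert (E2 : forall k l, (k < n)%nat -> (l < n)%nat ->
     edge_data eps0 eps alpha2 K h (a2 (xs (S k)) (xs l)) (a2 (xs (S k)) (xs (S l))) (a2 (xs (S k)) (xs (S (S l)))))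
    by (intros; eapply edge_data_y; eassumption).
  assert (Eb : forall k l, (k < n)%nat -> (l < n)%nat -> 0 <= b (xs (S k)) (xs (S l)) <= K)
    by (intros; eapply b_node; eassumption).
  set (A := scheme_stencil eps h a1 a2 b xs s).
  set (W := fun i j => u (xs i) (xs j)).
  (* Cut off outside the grid, where [U] is arbitrary, so that [grid_zero] holds on the full
     boundary lines. *)
  set (e := fun i j => if (Nat.leb i (S n) && Nat.leb j (S n))%bool then 1 * U i j + (-1) * W i j else 0).
  assert (xin : forall i, (i <= S n)%nat -> 0 <= xs i <= 1).
  { intros i Hi. rewrite Hx. split; [apply Rmult_le_pos; [apply pos_INR|lra]|].
    rewrite <- Nh. apply Rmult_le_compat_r; [lra|now apply le_INR]. }
  assert (ein : forall i j, (i <= S n)%nat -> (j <= S n)%nat -> e i j = 1 * U i j + (-1) * W i j).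
  { intros i j Hi Hj. unfold e. apply Nat.leb_le in Hi. apply Nat.leb_le in Hj. now rewrite Hi, Hj. }
  assert (ez : grid_zero n e).
  { intros i j Hij. destruct (Nat.leb_spec i (S n)) as [Hi|Hi]; [destruct (Nat.leb_spec j (S n)) as [Hj|Hj]|].
    - rewrite ein by auto. rewrite HU0 by (auto; lia). unfold W. rewrite Hbd; [ring|].
      split; [split; apply xin; auto|].
      assert (x0 : xs 0%nat = 0) by (rewrite Hx; simpl; ring). assert (x1 : xs (S n) = 1) by (rewrite Hx; exact Nh).
      destruct Hij as [-> | [-> | [-> | ->]]]; rewrite ?x0, ?x1; tauto.
    - unfold e. apply Nat.leb_gt in Hj. rewrite Hj, Bool.andb_false_r. reflexivity.
    - unfold e. apply Nat.leb_gt in Hi. rewrite Hi. reflexivity. }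
  assert (eA : forall k l, (k < n)%nat -> (l < n)%nat -> apply_stencil A e k l =
     Frhs eps a1 a2 f xs xs s (S k) (S l) - apply_stencil A W k l).
  { intros k l Hk Hl. rewrite <- HUL by lia.
    rewrite (LN_stencil eps0 eps alpha1 alpha2 K h a1 a2 b xs s n Hx eq_refl E1 E2 k l Hk Hl). fold A.
    transitivity (apply_stencil A (fun i j => 1 * U i j + (-1) * W i j) k l).
    - unfold apply_stencil. rewrite !ein by lia. reflexivity.
    - rewrite apply_stencil_lin. ring. }
  assert (Tl2 : h ^ 2 * fsum2 (fun k l => apply_stencil A e k l ^ 2) n n <= D * h ^ 4).
  { eapply truncation_l2; try eassumption.
    intros k l Hk Hl. rewrite eA by auto. eapply (truncation gamma eps0 alpha1 alpha2 K); eassumption. }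
  assert (Err : forall i j, (i <= S n)%nat -> (j <= S n)%nat -> Rabs (U i j - u (xs i) (xs j)) <= Cs * ((D + 1) * h ^ 2)).
  { intros i j Hi Hj. replace (U i j - u (xs i) (xs j)) with (e i j) by (rewrite ein by auto; unfold W; ring).
    apply (Hst n A eps h (fun i _ => INR i * h) e ((D + 1) * h ^ 2)); auto.
    - lra.
    - eapply scheme_stencil_monotone; try eassumption; reflexivity.
    - eapply scheme_stencil_near; try eassumption; reflexivity.
    - intros i' j' Hi' _. rewrite <- Hx. now apply xin.
    - intros k l Hk Hl. eapply scheme_stencil_barrier_at; try eassumption; reflexivity.
    - apply Rmult_lt_0_compat; [lra|apply pow_lt; lra].
    - eapply Rle_trans; [exact Tl2|]. replace (((D + 1) * h ^ 2) ^ 2) with ((D + 1) ^ 2 * h ^ 4) by ring.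
      apply Rmult_le_compat_r; [apply pow_le; lra|nra]. }
  assert (hN : h ^ 2 = / INR (S n) ^ 2) by (unfold h; rewrite pow_inv; reflexivity).
  assert (h2 : 0 <= h ^ 2) by apply pow2_ge_0.
  split.
  - intros i j Hi Hj. eapply Rle_trans; [now apply Err|].
    unfold Rdiv. rewrite <- hN. assert (0 <= C * h ^ 2) by (apply Rmult_le_pos; auto). lra.
  - intros x y Hxy.
    assert (FV : fam 4 (clamp 4 Du)) by (eapply clamp_fam; apply Cu).
    assert (cV : forall x y, in_closed x y -> clamp 4 Du 0 0 x y = u x y).
    { intros x' y' H. rewrite clamp_in by (auto; lia). now apply Cu. }
    rewrite <- (cV x y) by (apply open_closed; auto).
    apply Rle_trans with (Cs * ((D + 1) * h ^ 2) + 2 * C * h ^ 2).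
    + apply (bilinear_interpolation xs h (S n) (clamp 4 Du)); auto; try apply Hxy.
      * apply (fam_le 4); [lia|auto].
      * intros i j x' y' Hij. rewrite clamp_cl. apply Hsup; auto; apply cl_in.
      * intros i j Hi Hj. rewrite cV by (split; auto). now apply Err.
    + unfold Rdiv. rewrite <- hN. lra.
Qed.
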